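(* Let $\varphi\in L^2(K)$ be such that $\{\varphi(\cdot-u(k)):k\in\mathbb{N}_0\}$ is an orthonormal system. Let $V=\overline{\mathrm{span}}\{q^{1/2}\varphi(\mathfrak{p}^{-1}\cdot-u(k)):k\in\mathbb{N}_0\}$. For $0\le l\le q-1$ let $\{h^l_k:k\in\mathbb{N}_0\}\in\ell^2(\mathbb{N}_0)$, let $m_l(\xi)=q^{-1/2}\sum_{k=0}^\infty h^l_k\,\overline{\chi_k(\xi)}$, and define $\psi_l\in L^2(K)$ by $\hat\psi_l(\xi)=m_l(\mathfrak{p}\xi)\hat\varphi(\mathfrak{p}\xi)$. Then $\{\psi_l(\cdot-u(k)):0\le l\le q-1,\ k\in\mathbb{N}_0\}$ is an orthonormal system in $V$ if and only if the $q\times q$ matrix $M(\xi)=\bigl(m_l(\mathfrak{p}\xi+\mathfrak{p}u(k))\bigr)_{l,k=0}^{q-1}$ is unitary for a.e. $\xi\in\mathfrak{D}$. Moreover, $\{\psi_l(\cdot-u(k)):0\le l\le q-1,\ k\in\mathbb{N}_0\}$ is an orthonormal basis of $V$ whenever it is orthonormal.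
   Context: $K$ is a local field (a nondiscrete, totally disconnected, locally compact topological field) of characteristic $p>0$. Let $dx$ be Haar measure on the additive group $K^+$ and $|\cdot|$ the absolute value given by $d(\alpha x)=|\alpha|\,dx$, $|0|=0$. Put $\mathfrak{D}=\{x:|x|\le1\}$, $\mathfrak{P}=\{x:|x|<1\}$, $\mathfrak{D}^*=\mathfrak{D}\setminus\mathfrak{P}$; $dx$ is normalized so that $\mathfrak{D}$ has measure $1$. $\mathfrak{p}$ is a fixed element of $\mathfrak{P}$ of maximal absolute value (a prime element), $\mathfrak{D}/\mathfrak{P}\cong GF(q)$ with $q=p^c$, and $|\mathfrak{p}|=q^{-1}$. $\mathbb{N}_0=\{0,1,2,\dots\}$. Fix $\{1=\epsilon_0,\epsilon_1,\dots,\epsilon_{c-1}\}\subset\mathfrak{D}^*$ whose $GF(p)$-linear span is isomorphic to $GF(q)$ (as a field). For $0\le n<q$ with $n=a_0+a_1p+\cdots+a_{c-1}p^{c-1}$, $0\le a_k<p$, put $u(n)=(a_0+a_1\epsilon_1+\cdots+a_{c-1}\epsilon_{c-1})\mathfrak{p}^{-1}$; for general $n\in\mathbb{N}_0$ with $n=b_0+b_1q+\cdots+b_sq^s$, $0\le b_k<q$, put $u(n)=u(b_0)+u(b_1)\mathfrak{p}^{-1}+\cdots+u(b_s)\mathfrak{p}^{-s}$. Then $\{u(n)\}_{n\ge0}$ is a complete list of distinct coset representatives of $\mathfrak{D}$ in $K^+$. $\chi$ is the continuous unitary character of $K^+$ determined by $\chi(\epsilon_\mu\mathfrak{p}^{-j})=\exp(2\pi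 i/p)$ if $\mu=0$ and $j=1$, and $\chi(\epsilon_\mu\mathfrak{p}^{-j})=1$ if $\mu\in\{1,\dots,c-1\}$ or $j\ne1$; it is trivial on $\mathfrak{D}$ and nontrivial on $\mathfrak{p}^{-1}\mathfrak{D}$. Put $\chi_k(\xi)=\chi(u(k)\xi)$ for $k\in\mathbb{N}_0$. The Fourier transform is $\hat f(\xi)=\int_K f(x)\overline{\chi(\xi x)}\,dx$ on $L^1(K)$, extended to a unitary operator on $L^2(K)$. One has $\chi_k(u(l))=1$ for all $k,l\in\mathbb{N}_0$, so each series $\sum_k c_k\overline{\chi_k}$ with $(c_k)\in\ell^2(\mathbb{N}_0)$ (convergent in $L^2(\mathfrak{D})$) defines a.e. on $K$ a function invariant under all translations by $u(l)$, $l\in\mathbb{N}_0$. *)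

(* Defs.v *)
From HB Require Import structures.
From mathcomp Require Import all_boot all_order all_algebra spectral complex.
From mathcomp Require Import all_classical all_reals all_analysis.

Set Implicit Arguments.
Unset Strict Implicit.
Unset Printing Implicit Defensive.

Import Order.TTheory GRing.Theory Num.Theory.
Import numFieldNormedType.Exports.

Local Open Scope classical_set_scope.
Local Open Scope ring_scope.
Local Open Scope complex_scope.

HB.mixin Record isTopologicalField K
    & Topological K & GRing.Field K := {
  mul_continuous : continuous (fun x : K * K => x.1 * x.2) ;
  inv_continuous : forall x : K, x != 0 -> {for x, continuous (@GRing.inv K)}
}.

#[short(type="topologicalFieldType")]
HB.structure Definition TopologicalField :=
  {K of Topological K & GRing.Field K & TopologicalZmodule K
      & isTopologicalField K}.

#[non_forgetful_inheritance]
HB.instance Definition _ (K : topologicalFieldType) :=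
  Pointed.copy K (K : zmodType).

Notation borel K := (g_sigma_algebraType (@open K)).

(** ** Complex-valued functions on a measure space *)

Section ComplexFunctions.
Context {d : measure_display} {T : measurableType d} {R : realType}.
Variable mu : {measure set T -> \bar R}.
Implicit Types f g : T -> R[i].

Definition cmeasurable f :=
  measurable_fun [set: T] (fun x => complex.Re (f x)) /\
  measurable_fun [set: T] (fun x => complex.Im (f x)).

Definition cnorm (r : \bar R) f : \bar R :=
  Lnorm mu r (fun x => (Normc.normc (f x))%:E).

Definition cLp (r : \bar R) f := cmeasurable f /\ (cnorm r f < +oo)%E.

Definition cintegral f : R[i] :=
  (\int[mu]_x complex.Re (f x))%R +i* (\int[mu]_x complex.Im (f x))%R.

Definition inner f g : R[i] := cintegral (fun x => f x * (g x)^*%C).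

Definition orthonormal_system (I : eqType) (e : I -> T -> R[i]) :=
  (forall i, cLp 2%:E (e i)) /\ forall i j, inner (e i) (e j) = (i == j)%:R.

(* Elements of L^2 are represented by functions, and a subspace of L^2 by the
   set of all representatives of its elements. *)
Definition closed_span (I : Type) (e : I -> T -> R[i]) : set (T -> R[i]) :=
  [set f | cLp 2%:E f /\
     forall eps : R, 0 < eps -> exists s : seq (R[i] * I),
       (cnorm 2%:E (fun x => f x - \sum_(a <- s) a.1 * e a.2 x)%R < eps%:E)%E].

Definition orthonormal_system_in (V : set (T -> R[i])) (I : eqType)
    (e : I -> T -> R[i]) :=
  orthonormal_system e /\ forall i, V (e i).

Definition orthonormal_basis (V : set (T -> R[i])) (I : eqType)
    (e : I -> T -> R[i]) :=
  orthonormal_system_in V e /\ V `<=` closed_span e.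

End ComplexFunctions.

(** ** Local fields *)

Record is_local_field (K : topologicalFieldType) : Prop := {
  local_field_nondiscrete : ~ (forall A : set K, open A) ;
  local_field_totally_disconnected : totally_disconnected [set: K] ;
  local_field_locally_compact : locally_compact [set: K]
}.

Section LocalField.
Context {R : realType} {K : topologicalFieldType}.
Variable mu : {measure set (borel K) -> \bar R}.

(* Haar measure on the additive group: a nonzero translation-invariant Radon
   measure. *)
Record is_haar : Prop := {
  haar_nonzero : mu [set: K] != 0%E ;
  haar_translation : forall (a : K) (A : set (borel K)), measurable A ->
    mu [set a + x | x in A] = mu A ;
  haar_compact : forall A : set K, compact A -> (mu A < +oo)%E ;
  haar_outer_regular : forall A : set (borel K), measurable A ->
    mu A = ereal_inf [set mu U | U in [set U : set K | open U /\ A `<=` U]] ;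
  haar_inner_regular : forall U : set K, open U ->
    mu U = ereal_sup [set mu C | C in [set C : set K | compact C /\ C `<=` U]]
}.

Definition is_modulus (abs : K -> R) :=
  abs 0 = 0 /\
  forall a : K, a != 0 -> forall A : set (borel K), measurable A ->
    mu [set a * x | x in A] = ((abs a)%:E * mu A)%E.

Section Ring.
Variable abs : K -> R.

Definition integers : set K := [set x | abs x <= 1].
Definition max_ideal : set K := [set x | abs x < 1].

Definition is_prime_element (t : K) :=
  max_ideal t /\ forall x, max_ideal x -> abs x <= abs t.

(* The quotient of [integers] by [max_ideal] is a field with [q] elements:
   [r] is the reduction map, its values outside [integers] being irrelevant. *)
Definition has_residue_field_GF (q : nat) :=
  exists (k : finFieldType) (r : K -> k),
    #|k| = q /\
    [/\ r 1 = 1,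
        forall x y, integers x -> integers y -> r (x + y) = r x + r y,
        forall x y, integers x -> integers y -> r (x * y) = r x * r y,
        forall z, exists2 x, integers x & r x = z
      & forall x, integers x -> (r x = 0 <-> max_ideal x)].

(* In characteristic [p], the [a%:R] for [a : nat] form the prime field. *)
Definition is_GF_basis (p c : nat) (eps : 'I_c -> K) :=
  [/\ forall i : 'I_c, i = 0%N :> nat -> eps i = 1,
      forall i, (integers `\` max_ideal) (eps i)
    & exists (k : finFieldType) (f : {rmorphism k -> K}),
        #|k| = (p ^ c)%N /\
        range f = range (fun a : 'I_c -> nat => \sum_i (a i)%:R * eps i)].

End Ring.

Section Representatives.
Variables (p c : nat) (eps : 'I_c -> K) (t : K).

Definition u_digit (n : nat) : K :=
  (\sum_(k < c) (n %/ p ^ k %% p)%:R * eps k) / t.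

(* [n %/ q ^ k %% q] is the [k]-th digit of [n] in base [q = p ^ c]; it is zero
   for [k > n]. *)
Definition u (n : nat) : K :=
  \sum_(k < n.+1) u_digit (n %/ (p ^ c) ^ k %% (p ^ c)) * t ^- k.

Record is_basic_character (chi : K -> R[i]) : Prop := {
  basic_characterD : forall x y, chi (x + y) = chi x * chi y ;
  basic_character_unitary : forall x, Normc.normc (chi x) = 1 ;
  basic_character_continuous_Re : continuous (fun x => complex.Re (chi x)) ;
  basic_character_continuous_Im : continuous (fun x => complex.Im (chi x)) ;
  basic_characterE : forall (i : 'I_c) (j : int),
    chi (eps i * t ^ (- j)) =
    if (i == 0%N :> nat) && (j == 1)
    then cos (2 * pi / p%:R) +i* sin (2 * pi / p%:R)
    else 1
}.

End Representatives.

Section Fourier.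
Variable chi : K -> R[i].

Definition fourier (f : K -> R[i]) (xi : K) : R[i] :=
  cintegral mu (fun x => f x * (chi (xi * x))^*%C).

(* [F] is the unitary operator on L^2 which extends [fourier]; as elements of
   L^2 are represented by functions, its properties are stated up to
   almost-everywhere equality. *)
Record is_fourier_L2 (F : (K -> R[i]) -> (K -> R[i])) : Prop := {
  fourier_L2_stable : forall f, cLp mu 2%:E f -> cLp mu 2%:E (F f) ;
  fourier_L2_linear : forall (a : R[i]) f g,
    cLp mu 2%:E f -> cLp mu 2%:E g ->
    {ae mu, forall x, F (fun y => a * f y + g y) x = a * F f x + F g x} ;
  fourier_L2_isometry : forall f g, cLp mu 2%:E f -> cLp mu 2%:E g ->
    inner mu (F f) (F g) = inner mu f g ;
  fourier_L2_surjective : forall g, cLp mu 2%:E g ->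
    exists2 f, cLp mu 2%:E f & {ae mu, forall x, F f x = g x} ;
  fourier_L2_extends : forall f, cLp mu 1%:E f -> cLp mu 2%:E f ->
    {ae mu, forall x, F f x = fourier f x}
}.

(* [m] is a representative of the a.e. class on [K], invariant under the
   translations by the [v k], given on [D] by the L^2(D)-convergent series
   q^(-1/2) * \sum_k h_k (chi (v k * xi))^*. *)
Definition is_symbol (D : set K) (v : nat -> K) (q : nat) (h : nat -> R[i])
    (m : K -> R[i]) :=
  [/\ cmeasurable (m : borel K -> R[i]),
      forall l, {ae mu, forall xi, m (xi + v l) = m xi}
    & cnorm mu 2%:E (fun xi : K => (\1_D xi)%:C *
        ((Num.sqrt q%:R)^-1%:C * (\sum_(k < N) h k * (chi (v k * xi))^*%C)
         - m xi)) @[N --> \oo] --> 0%E].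

End Fourier.
End LocalField.

(* Main.v *)
Require Import Defs.
From HB Require Import structures.
From mathcomp Require Import all_boot all_order all_algebra spectral complex.
From mathcomp Require Import all_classical all_reals all_analysis.
From mathcomp Require Import finfield measurable_realfun ring lra.

Import Order.TTheory GRing.Theory Num.Theory.
Import numFieldNormedType.Exports.

Local Open Scope classical_set_scope.
Local Open Scope ring_scope.
Local Open Scope complex_scope.

(** Let [e k x = q^(1/2) * phi (t^-1 * x - u k)] be the functions that span [V].
    Rescaling keeps them orthonormal, and the [u k] form an additive group
    containing every [t^-1 * u n], so translation by [u n] permutes the [e k]. The
    Fourier transform turns the definition of [psi l] into the expansion
    [psi l = sum_k h^l_k e_k] ([scaled_expansion]); hence every packet
    [psi l (x - u n)] lies in [V], with the coefficients [h^l] shifted by a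
    permutation of the indices. On the compact group [D] the conjugate characters
    [chi_k] form an orthonormal system too ([wave_orthonormal]), in which the same
    coefficients expand [q^(1/2) * m l]. Inner products of orthonormal expansions
    only depend on the coefficients ([inner_transfer]); so those of the packets are
    integrals over [D], and cutting [D] into the [q] pieces [t * (u s + D)] makes
    them the Fourier coefficients of the entries of [M * M^*] ([packet_gram]).
    Orthonormality says that these coefficients are those of the identity matrix,
    and an integrable function on [D] is determined by its coefficients
    ([fourier_unique]): this is the equivalence with unitarity.

    To expand [psi l] one has to bound the norm over [K] of a periodic function
    times the transform of [phi] by its norm over [D]
    ([integral_periodic_weight]). Orthonormality of the translates of [phi] makes
    the periodization of the square of its transform equal to [1]. This and
    [fourier_unique] rest on the same argument: the Dirichlet kernel, the average
    of the [chi_n] for [n < q^N], is on [D] the indicator of the disk [t^N * D]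
    ([dirichlet_disk]); so Fourier coefficients give the integrals over disks, and
    disks generate the Borel sets.

    Completeness is then a matter of counting. The squared coefficients
    of [e r] on the packets are the [|h^l_k|^2] with [k] congruent to [r] modulo
    [q]. By Bessel's inequality their sum is at most [1] for each of the [q]
    residues, while the total over all residues is the sum of the squared norms of
    the [q] unit vectors [psi l], that is [q]. All sums are therefore [1], and
    [e r] lies in the closed span of the packets ([scaled_in_span]).

    The structure of [K] comes from its Haar measure. Outer regularity makes the
    modulus upper semicontinuous ([modulus_usc]); a compact neighbourhood of [0]
    contracted by a multiplication then bounds the modulus on [1 + D], and the
    additivity of the Frobenius map sharpens this bound to the ultrametric
    inequality ([modulus_ultrametric]). The digits form a finite field that
    represents the residue field, which gives [|t| = 1/q] and the cosets of [D]. *)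

Set Implicit Arguments.
Unset Strict Implicit.
Unset Printing Implicit Defensive.

(** * Complex numbers and complex integrals *)

Section ComplexArithmetic.
Context {R : realType}.
Implicit Types z w : R[i].

Lemma ReD z w : complex.Re (z + w) = complex.Re z + complex.Re w.
Proof. by case: z => ? ?; case: w. Qed.
Lemma ImD z w : complex.Im (z + w) = complex.Im z + complex.Im w.
Proof. by case: z => ? ?; case: w. Qed.
Lemma ReN z : complex.Re (- z) = - complex.Re z.
Proof. by case: z. Qed.
Lemma ImN z : complex.Im (- z) = - complex.Im z.
Proof. by case: z. Qed.
Lemma ReM z w : complex.Re (z * w) =
  complex.Re z * complex.Re w - complex.Im z * complex.Im w.
Proof. by case: z => ? ?; case: w. Qed.
Lemma ImM z w : complex.Im (z * w) =
  complex.Re z * complex.Im w + complex.Im z * complex.Re w.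
Proof. by case: z => ? ?; case: w. Qed.
Lemma ReJ z : complex.Re z^*%C = complex.Re z. Proof. by case: z. Qed.
Lemma ImJ z : complex.Im z^*%C = - complex.Im z. Proof. by case: z. Qed.
Lemma ReC (r : R) : complex.Re r%:C = r. Proof. by []. Qed.
Lemma ImC (r : R) : complex.Im r%:C = 0. Proof. by []. Qed.
Definition ReImE := (ReD, ImD, ReN, ImN, ReM, ImM, ReJ, ImJ, ReC, ImC).

Lemma complexP z w :
  complex.Re z = complex.Re w -> complex.Im z = complex.Im w -> z = w.
Proof. by case: z => ? ?; case: w => ? ? /= -> ->. Qed.

Lemma conjcD z w : (z + w)^*%C = z^*%C + w^*%C. Proof. exact: rmorphD. Qed.
Lemma conjcM z w : (z * w)^*%C = z^*%C * w^*%C. Proof. exact: rmorphM. Qed.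
Lemma conjcN z : (- z)^*%C = - z^*%C. Proof. exact: rmorphN. Qed.
Lemma conjcC (r : R) : (r%:C)^*%C = r%:C. Proof. exact: conjc_real. Qed.

Definition sqabs z : R := complex.Re z ^+ 2 + complex.Im z ^+ 2.

Lemma sqabs_ge0 z : 0 <= sqabs z.
Proof. by rewrite addr_ge0 ?sqr_ge0. Qed.

Lemma sqabs_normc z : Normc.normc z ^+ 2 = sqabs z.
Proof. by case: z => a b; rewrite /= sqr_sqrtr ?addr_ge0 ?sqr_ge0. Qed.

Lemma normc_ge0 z : 0 <= Normc.normc z.
Proof. by case: z => a b; exact: sqrtr_ge0. Qed.

Lemma sqabsM z w : sqabs (z * w) = sqabs z * sqabs w.
Proof. by rewrite -!sqabs_normc Normc.normcM exprMn. Qed.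

Lemma sqabsJ z : sqabs z^*%C = sqabs z.
Proof. by rewrite /sqabs !ReImE sqrrN. Qed.

Lemma sqabsN z : sqabs (- z) = sqabs z.
Proof. by rewrite /sqabs !ReImE !sqrrN. Qed.

Lemma sqabsC (r : R) : sqabs r%:C = r ^+ 2.
Proof. by rewrite /sqabs /= expr0n addr0. Qed.

Lemma sqabs0 : sqabs 0 = 0.
Proof. by rewrite /sqabs /= expr0n addr0. Qed.

Lemma mul_conjc z : z * z^*%C = (sqabs z)%:C.
Proof. by apply: complexP; rewrite !ReImE /sqabs; ring. Qed.

Lemma sqabsD_le z w : sqabs (z + w) <= sqabs z *+ 2 + sqabs w *+ 2.
Proof.
rewrite /sqabs !ReImE.
have := sqr_ge0 (complex.Re z - complex.Re w).
have := sqr_ge0 (complex.Im z - complex.Im w).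
by nra.
Qed.

Lemma sqabs_eq0 z : sqabs z = 0 -> z = 0.
Proof.
move=> /eqP; rewrite -sqabs_normc sqrf_eq0 => /eqP; exact: Normc.eq0_normc.
Qed.

Lemma sqabs_prod_le z w : 2 * `|complex.Re (z * w^*%C)| <= sqabs z + sqabs w /\
  2 * `|complex.Im (z * w^*%C)| <= sqabs z + sqabs w.
Proof.
rewrite !ReImE /sqabs; case: z => a b; case: w => c d /=.
have h1 := sqr_ge0 (a - c); have h2 := sqr_ge0 (a + c).
have h3 := sqr_ge0 (b - d); have h4 := sqr_ge0 (b + d).
have h5 := sqr_ge0 (a - d); have h6 := sqr_ge0 (a + d).
have h7 := sqr_ge0 (b - c); have h8 := sqr_ge0 (b + c).
by split; case: (ger0P (_ + _)) => _; nra.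
Qed.

End ComplexArithmetic.

Section ComplexIntegral.
Context {d : measure_display} {T : measurableType d} {R : realType}.
Variable mu : {measure set T -> \bar R}.
Implicit Types f g : T -> R[i].

Let cmeasurableE f (a b : T -> R) :
  measurable_fun [set: T] a -> measurable_fun [set: T] b ->
  (forall x, complex.Re (f x) = a x) -> (forall x, complex.Im (f x) = b x) ->
  cmeasurable f.
Proof. by move=> ma mb /funext fa /funext fb; split; rewrite ?fa ?fb. Qed.

Lemma cmeasurableD f g : cmeasurable f -> cmeasurable g ->
  cmeasurable (fun x => f x + g x).
Proof.
move=> [f1 f2] [g1 g2].
apply: (cmeasurableE (measurable_funD f1 g1) (measurable_funD f2 g2)) => x;
  by rewrite ReImE.
Qed.

Lemma cmeasurableM f g : cmeasurable f -> cmeasurable g ->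
  cmeasurable (fun x => f x * g x).
Proof.
move=> [f1 f2] [g1 g2].
apply: (cmeasurableE
    (measurable_funB (measurable_funM f1 g1) (measurable_funM f2 g2))
    (measurable_funD (measurable_funM f1 g2) (measurable_funM f2 g1))) => x;
  by rewrite ReImE.
Qed.

Lemma cmeasurable_cst (z : R[i]) : cmeasurable (fun _ : T => z).
Proof. by split; exact: measurable_cst. Qed.

Lemma cmeasurableN f : cmeasurable f -> cmeasurable (fun x => - f x).
Proof.
move=> [f1 f2].
apply: (cmeasurableE (measurable_funN f1) (measurable_funN f2)) => x;
  by rewrite ReImE.
Qed.

Lemma cmeasurableB f g : cmeasurable f -> cmeasurable g ->
  cmeasurable (fun x => f x - g x).
Proof. by move=> mf mg; apply: cmeasurableD => //; exact: cmeasurableN. Qed.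

Lemma cmeasurableJ f : cmeasurable f -> cmeasurable (fun x => (f x)^*%C).
Proof.
move=> [f1 f2].
by apply: (cmeasurableE f1 (measurable_funN f2)) => x; rewrite ReImE.
Qed.

Lemma cmeasurableC (f : T -> R) : measurable_fun [set: T] f ->
  cmeasurable (fun x => (f x)%:C).
Proof. by move=> mf; split => //; exact: measurable_cst. Qed.

Let bigsum_nil (I : Type) (P : pred I) (f : I -> T -> R[i]) :
  (fun x => \sum_(i <- [::] | P i) f i x) = fun=> 0.
Proof. by apply/funext => x; rewrite big_nil. Qed.

Let bigsum_cons (I : Type) (P : pred I) (f : I -> T -> R[i]) j s :
  (fun x => \sum_(i <- j :: s | P i) f i x) =
  if P j then fun x => f j x + \sum_(i <- s | P i) f i x
  else fun x => \sum_(i <- s | P i) f i x.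
Proof.
by case: ifPn => [|/negbTE] Pj; apply/funext => x; rewrite big_cons Pj.
Qed.

Lemma cmeasurable_sum (I : Type) (s : seq I) (P : pred I) (f : I -> T -> R[i]) :
  (forall i, P i -> cmeasurable (f i)) ->
  cmeasurable (fun x => \sum_(i <- s | P i) f i x).
Proof.
move=> mf; elim: s => [|i s IH].
  by rewrite bigsum_nil; exact: cmeasurable_cst.
rewrite bigsum_cons.
by case: ifPn => // Pi; apply: cmeasurableD => //; exact: mf.
Qed.

Lemma measurable_sqabs f : cmeasurable f ->
  measurable_fun [set: T] (fun x => sqabs (f x)).
Proof.
by move=> [f1 f2]; apply: measurable_funD; exact: measurable_funX.
Qed.

(** Absolute integrability, stated through the real and imaginary parts because
    [cintegral] is. *)
Definition cintegrable f :=
  mu.-integrable [set: T] (EFin \o (fun x => complex.Re (f x))) /\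
  mu.-integrable [set: T] (EFin \o (fun x => complex.Im (f x))).

Lemma cintegrable_measurable f : cintegrable f -> cmeasurable f.
Proof.
move=> [/measurable_int/measurable_EFinP ? /measurable_int/measurable_EFinP ?].
by split.
Qed.

Lemma Re_cintegral f :
  complex.Re (cintegral mu f) = (\int[mu]_x complex.Re (f x))%R.
Proof. by []. Qed.

Lemma Im_cintegral f :
  complex.Im (cintegral mu f) = (\int[mu]_x complex.Im (f x))%R.
Proof. by []. Qed.

Lemma cintegrableD f g : cintegrable f -> cintegrable g ->
  cintegrable (fun x => f x + g x).
Proof.
move=> [f1 f2] [g1 g2]; split.
  have := integrableD measurableT f1 g1; apply: eq_integrable => // x _ /=.
  by rewrite ReD.
have := integrableD measurableT f2 g2; apply: eq_integrable => // x _ /=.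
by rewrite ImD.
Qed.

Lemma cintegralD f g : cintegrable f -> cintegrable g ->
  cintegral mu (fun x => f x + g x) = cintegral mu f + cintegral mu g.
Proof.
move=> [f1 f2] [g1 g2]; apply: complexP; rewrite (ReD, ImD).
  by rewrite !Re_cintegral -RintegralD//; apply: eq_Rintegral => x _; rewrite ReD.
by rewrite !Im_cintegral -RintegralD//; apply: eq_Rintegral => x _; rewrite ImD.
Qed.

Lemma cintegrableZ (z : R[i]) f : cintegrable f ->
  cintegrable (fun x => z * f x).
Proof.
move=> [f1 f2]; split.
  have := integrableB measurableT (integrableZl measurableT (complex.Re z) f1)
    (integrableZl measurableT (complex.Im z) f2).
  by apply: eq_integrable => // x _ /=; rewrite ReM.
have := integrableD measurableT (integrableZl measurableT (complex.Re z) f2)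
    (integrableZl measurableT (complex.Im z) f1).
by apply: eq_integrable => // x _ /=; rewrite ImM.
Qed.

Lemma cintegralZ (z : R[i]) f : cintegrable f ->
  cintegral mu (fun x => z * f x) = z * cintegral mu f.
Proof.
move=> [f1 f2].
have g1 (r : R) : mu.-integrable [set: T] (EFin \o (fun x => r * complex.Re (f x))).
  exact: (integrableZl measurableT r f1).
have g2 (r : R) : mu.-integrable [set: T] (EFin \o (fun x => r * complex.Im (f x))).
  exact: (integrableZl measurableT r f2).
apply: complexP; rewrite (ReM, ImM) !(Re_cintegral, Im_cintegral).
  by under eq_Rintegral do rewrite ReM; rewrite RintegralB// !RintegralZl.
by under eq_Rintegral do rewrite ImM; rewrite RintegralD// !RintegralZl.
Qed.

Lemma cintegralJ f : cintegrable f ->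
  cintegral mu (fun x => (f x)^*%C) = (cintegral mu f)^*%C.
Proof.
move=> [f1 f2]; apply: complexP; rewrite (ReJ, ImJ) !(Re_cintegral, Im_cintegral).
  by apply: eq_Rintegral => x _; rewrite ReJ.
under eq_Rintegral do rewrite ImJ -mulN1r.
by rewrite RintegralZl// mulN1r.
Qed.

Lemma cintegral0 : cintegral mu (fun=> 0) = 0.
Proof. by apply: complexP; rewrite /= /Rintegral integral0. Qed.

Lemma cintegrable0 : cintegrable (fun=> 0).
Proof. by split; exact: integrable0. Qed.

Lemma cintegrable_sum (I : Type) (s : seq I) (P : pred I) (f : I -> T -> R[i]) :
  (forall i, P i -> cintegrable (f i)) ->
  cintegrable (fun x => \sum_(i <- s | P i) f i x).
Proof.
move=> intf; elim: s => [|i s IH].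
  by rewrite bigsum_nil; exact: cintegrable0.
rewrite bigsum_cons.
by case: ifPn => // Pi; apply: cintegrableD => //; exact: intf.
Qed.

Lemma cintegral_sum (I : Type) (s : seq I) (P : pred I) (f : I -> T -> R[i]) :
  (forall i, P i -> cintegrable (f i)) ->
  cintegral mu (fun x => \sum_(i <- s | P i) f i x) =
  \sum_(i <- s | P i) cintegral mu (f i).
Proof.
move=> intf; elim: s => [|i s IH].
  by rewrite bigsum_nil; rewrite big_nil cintegral0.
rewrite bigsum_cons big_cons; case: ifPn => // Pi; rewrite cintegralD ?IH//.
  exact: intf.
exact: cintegrable_sum.
Qed.

Lemma ae_eq_cintegral f g : cmeasurable f -> cmeasurable g ->
  {ae mu, forall x, f x = g x} -> cintegral mu f = cintegral mu g.
Proof.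
move=> [f1 f2] [g1 g2] fg; apply: complexP; rewrite /=;
  congr fine; apply: ae_eq_integral => //; try exact/measurable_EFinP;
  by apply: filterS fg => x + _ => ->.
Qed.

(** Squared norms avoid the real powers of [Lnorm]; this one may be infinite. *)
Definition esqnorm f : \bar R := (\int[mu]_x (sqabs (f x))%:E)%E.

Lemma esqnorm_ge0 f : (0 <= esqnorm f)%E.
Proof. by apply: integral_ge0 => x _; rewrite lee_fin sqabs_ge0. Qed.

Lemma cnorm2E f : cnorm mu 2%:E f = (esqnorm f `^ (2^-1))%E.
Proof.
rewrite /cnorm unlock /esqnorm; congr (_ `^ _)%E; apply: eq_integral => x _.
rewrite abse_EFin ger0_norm ?normc_ge0// poweR_EFin powR_mulrn ?normc_ge0//.
by rewrite sqabs_normc.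
Qed.

Lemma cnorm2_fin f : (cnorm mu 2%:E f < +oo)%E = (esqnorm f < +oo)%E.
Proof.
rewrite cnorm2E; have := esqnorm_ge0 f; case: (esqnorm f) => [r|//|//] r0.
  by rewrite poweR_EFin !ltry.
by rewrite poweRyr// invr_eq0.
Qed.

Lemma cnorm2_lt f (e : R) : 0 < e ->
  (cnorm mu 2%:E f < e%:E)%E = (esqnorm f < (e ^+ 2)%:E)%E.
Proof.
move=> e0; rewrite cnorm2E; have := esqnorm_ge0 f; case: (esqnorm f) => [r|//|//] r0.
  rewrite poweR_EFin !lte_fin powR12_sqrt//.
  by rewrite -{1}(ger0_norm (ltW e0)) -sqrtr_sqr ltr_sqrt// exprn_gt0.
by rewrite poweRyr// invr_eq0.
Qed.

Lemma cLp2P f : cLp mu 2%:E f <-> cmeasurable f /\ (esqnorm f < +oo)%E.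
Proof. by rewrite /cLp cnorm2_fin. Qed.

Lemma cLp2_measurable f : cLp mu 2%:E f -> cmeasurable f.
Proof. by case. Qed.

Lemma esqnormD_le f g : cmeasurable f -> cmeasurable g ->
  (esqnorm (fun x => (f x + g x)%R) <= 2%:E * esqnorm f + 2%:E * esqnorm g)%E.
Proof.
move=> mf mg.
rewrite /esqnorm -!ge0_integralZl ?lee_fin//=; last 4 first.
- exact/measurable_EFinP/measurable_sqabs.
- by move=> x _; rewrite lee_fin sqabs_ge0.
- exact/measurable_EFinP/measurable_sqabs.
- by move=> x _; rewrite lee_fin sqabs_ge0.
rewrite -ge0_integralD//=; last 4 first.
- by move=> x _; rewrite -EFinM lee_fin mulr_ge0// sqabs_ge0.
- by apply/measurable_EFinP/measurable_funM => //; exact: measurable_sqabs.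
- by move=> x _; rewrite -EFinM lee_fin mulr_ge0// sqabs_ge0.
- by apply/measurable_EFinP/measurable_funM => //; exact: measurable_sqabs.
apply: ge0_le_integral => //.
- by move=> x _; rewrite lee_fin sqabs_ge0.
- by apply/measurable_EFinP/measurable_sqabs/cmeasurableD.
- by apply/measurable_EFinP/measurable_funD;
    apply/measurable_funM => //; exact: measurable_sqabs.
- by move=> x _; rewrite lee_fin !mulr_natl sqabsD_le.
Qed.

Lemma esqnormZ (z : R[i]) f : cmeasurable f ->
  esqnorm (fun x => z * f x) = ((sqabs z)%:E * esqnorm f)%E.
Proof.
move=> mf; rewrite /esqnorm -ge0_integralZl ?lee_fin ?sqabs_ge0//=.
- by apply: eq_integral => x _; rewrite sqabsM EFinM.
- exact/measurable_EFinP/measurable_sqabs.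
- by move=> x _; rewrite lee_fin sqabs_ge0.
Qed.

Lemma cLp2D f g : cLp mu 2%:E f -> cLp mu 2%:E g ->
  cLp mu 2%:E (fun x => f x + g x).
Proof.
move=> /cLp2P[mf f2] /cLp2P[mg g2]; apply/cLp2P; split.
  exact: cmeasurableD.
apply: (le_lt_trans (esqnormD_le mf mg)); apply: lte_add_pinfty;
  exact: lte_mul_pinfty.
Qed.

Lemma cLp2Z (z : R[i]) f : cLp mu 2%:E f -> cLp mu 2%:E (fun x => z * f x).
Proof.
move=> /cLp2P[mf f2]; apply/cLp2P; split.
  by apply: cmeasurableM => //; exact: cmeasurable_cst.
by rewrite esqnormZ//; apply: lte_mul_pinfty => //; rewrite lee_fin sqabs_ge0.
Qed.

Lemma cLp2N f : cLp mu 2%:E f -> cLp mu 2%:E (fun x => - f x).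
Proof.
move=> L2f; suff -> : (fun x => - f x) = (fun x => -1 * f x) by exact: cLp2Z.
by apply/funext => x; rewrite mulN1r.
Qed.

Lemma cLp2B f g : cLp mu 2%:E f -> cLp mu 2%:E g ->
  cLp mu 2%:E (fun x => f x - g x).
Proof. by move=> L2f L2g; apply: cLp2D => //; exact: cLp2N. Qed.

Lemma esqnorm0 : esqnorm (fun=> 0) = 0%E.
Proof. by rewrite /esqnorm sqabs0 integral0. Qed.

Lemma cLp20 : cLp mu 2%:E (fun=> 0).
Proof. by apply/cLp2P; split; [exact: cmeasurable_cst|rewrite esqnorm0]. Qed.

Lemma cLp2_sum (I : Type) (s : seq I) (P : pred I) (f : I -> T -> R[i]) :
  (forall i, P i -> cLp mu 2%:E (f i)) ->
  cLp mu 2%:E (fun x => \sum_(i <- s | P i) f i x).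
Proof.
move=> L2f; elim: s => [|i s IH].
  by rewrite bigsum_nil; exact: cLp20.
rewrite bigsum_cons.
by case: ifPn => // Pi; apply: cLp2D => //; exact: L2f.
Qed.

Lemma cLp2_mul_le1 (w f : T -> R[i]) : cmeasurable w ->
  (forall x, sqabs (w x) <= 1) -> cLp mu 2%:E f ->
  cLp mu 2%:E (fun x => w x * f x).
Proof.
move=> mw w1 /cLp2P[mf f2]; apply/cLp2P; split; first exact: cmeasurableM.
apply: le_lt_trans f2; apply: ge0_le_integral => //.
- by move=> x _; rewrite lee_fin sqabs_ge0.
- by apply/measurable_EFinP/measurable_sqabs/cmeasurableM.
- exact/measurable_EFinP/measurable_sqabs.
- by move=> x _; rewrite lee_fin sqabsM ler_piMl ?sqabs_ge0.
Qed.

Lemma esqnorm_mul_unit (w f : T -> R[i]) : (forall x, sqabs (w x) = 1) ->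
  esqnorm (fun x => w x * f x) = esqnorm f.
Proof.
by move=> w1; apply: eq_integral => x _; rewrite sqabsM w1 mul1r.
Qed.

Lemma ae_eq_esqnorm f g : cmeasurable f -> cmeasurable g ->
  {ae mu, forall x, f x = g x} -> esqnorm f = esqnorm g.
Proof.
move=> mf mg fg; apply: ae_eq_integral => //.
- exact/measurable_EFinP/measurable_sqabs.
- exact/measurable_EFinP/measurable_sqabs.
- by apply: filterS fg => x + _ => ->.
Qed.

Lemma cintegrable_inner f g : cLp mu 2%:E f -> cLp mu 2%:E g ->
  cintegrable (fun x => f x * (g x)^*%C).
Proof.
move=> /cLp2P[mf f2] /cLp2P[mg g2].
have mh : cmeasurable (fun x => f x * (g x)^*%C).
  by apply: cmeasurableM => //; exact: cmeasurableJ.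
have intsq k : cmeasurable k -> (esqnorm k < +oo)%E ->
    mu.-integrable [set: T] (EFin \o (fun x => sqabs (k x))).
  move=> mk k2; apply/integrableP; split.
    exact/measurable_EFinP/measurable_sqabs.
  under eq_integral do rewrite abse_EFin ger0_norm ?sqabs_ge0//.
  exact: k2.
have intfg : mu.-integrable [set: T]
    (EFin \o (fun x => sqabs (f x) + sqabs (g x))).
  have := integrableD measurableT (intsq _ mf f2) (intsq _ mg g2).
  exact: eq_integrable.
have sge x : 0 <= sqabs (f x) + sqabs (g x).
  exact: addr_ge0 (sqabs_ge0 _) (sqabs_ge0 _).
case: mh => m1 m2; split; apply: le_integrable intfg => //;
    try exact/measurable_EFinP.
- move=> x _; rewrite !abse_EFin lee_fin [leRHS]ger0_norm ?sge//.
  have [+ _] := sqabs_prod_le (f x) (g x).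
  by move=> h; apply: le_trans h; rewrite ler_peMl// ler1n.
- move=> x _; rewrite !abse_EFin lee_fin [leRHS]ger0_norm ?sge//.
  have [_ +] := sqabs_prod_le (f x) (g x).
  by move=> h; apply: le_trans h; rewrite ler_peMl// ler1n.
Qed.

Lemma innerDl f1 f2 g : cLp mu 2%:E f1 -> cLp mu 2%:E f2 -> cLp mu 2%:E g ->
  inner mu (fun x => f1 x + f2 x) g = inner mu f1 g + inner mu f2 g.
Proof.
move=> h1 h2 hg; rewrite /inner -cintegralD; try exact: cintegrable_inner.
by congr cintegral; apply/funext => x; rewrite mulrDl.
Qed.

Lemma innerZl (z : R[i]) f g : cLp mu 2%:E f -> cLp mu 2%:E g ->
  inner mu (fun x => z * f x) g = z * inner mu f g.
Proof.
move=> hf hg; rewrite /inner -cintegralZ; last exact: cintegrable_inner.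
by congr cintegral; apply/funext => x; rewrite mulrA.
Qed.

Lemma inner_conj f g : cLp mu 2%:E f -> cLp mu 2%:E g ->
  inner mu g f = (inner mu f g)^*%C.
Proof.
move=> hf hg; rewrite /inner -cintegralJ; last exact: cintegrable_inner.
congr cintegral; apply/funext => x; by rewrite conjcM conjcK mulrC.
Qed.

Lemma innerNl f g : cLp mu 2%:E f -> cLp mu 2%:E g ->
  inner mu (fun x => - f x) g = - inner mu f g.
Proof.
move=> hf hg; rewrite -mulN1r -innerZl//.
by congr inner; apply/funext => x; rewrite mulN1r.
Qed.

Lemma innerBl f1 f2 g : cLp mu 2%:E f1 -> cLp mu 2%:E f2 -> cLp mu 2%:E g ->
  inner mu (fun x => f1 x - f2 x) g = inner mu f1 g - inner mu f2 g.
Proof. by move=> *; rewrite innerDl ?innerNl//; exact: cLp2N. Qed.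

Lemma innerDr f g1 g2 : cLp mu 2%:E f -> cLp mu 2%:E g1 -> cLp mu 2%:E g2 ->
  inner mu f (fun x => g1 x + g2 x) = inner mu f g1 + inner mu f g2.
Proof.
move=> hf h1 h2; rewrite inner_conj//; last exact: cLp2D.
by rewrite innerDl// conjcD -!inner_conj.
Qed.

Lemma innerZr (z : R[i]) f g : cLp mu 2%:E f -> cLp mu 2%:E g ->
  inner mu f (fun x => z * g x) = z^*%C * inner mu f g.
Proof.
move=> hf hg; rewrite inner_conj//; last exact: cLp2Z.
by rewrite innerZl// conjcM -!inner_conj.
Qed.

Lemma innerBr f g1 g2 : cLp mu 2%:E f -> cLp mu 2%:E g1 -> cLp mu 2%:E g2 ->
  inner mu f (fun x => g1 x - g2 x) = inner mu f g1 - inner mu f g2.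
Proof.
move=> hf h1 h2; rewrite inner_conj//; last exact: cLp2B.
by rewrite innerBl// conjcD conjcN -!inner_conj.
Qed.

Lemma inner_suml (I : Type) (s : seq I) (P : pred I) (f : I -> T -> R[i]) g :
  (forall i, P i -> cLp mu 2%:E (f i)) -> cLp mu 2%:E g ->
  inner mu (fun x => \sum_(i <- s | P i) f i x) g =
  \sum_(i <- s | P i) inner mu (f i) g.
Proof.
move=> hf hg; rewrite /inner -cintegral_sum.
  by congr cintegral; apply/funext => x; rewrite mulr_suml.
by move=> i Pi; apply: cintegrable_inner => //; exact: hf.
Qed.

Lemma inner_sumr (I : Type) (s : seq I) (P : pred I) f (g : I -> T -> R[i]) :
  cLp mu 2%:E f -> (forall i, P i -> cLp mu 2%:E (g i)) ->
  inner mu f (fun x => \sum_(i <- s | P i) g i x) =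
  \sum_(i <- s | P i) inner mu f (g i).
Proof.
move=> hf hg; rewrite inner_conj//; last exact: cLp2_sum.
rewrite inner_suml// rmorph_sum; apply: eq_bigr => i Pi.
by rewrite [RHS]inner_conj//; exact: hg.
Qed.

Definition sqnorm f : R := fine (esqnorm f).

Lemma sqnorm_ge0 f : 0 <= sqnorm f.
Proof. by rewrite fine_ge0// esqnorm_ge0. Qed.

Lemma sqnormE f : cLp mu 2%:E f -> esqnorm f = (sqnorm f)%:E.
Proof. by move=> /cLp2P[_ f2]; rewrite /sqnorm fineK// ge0_fin_numE// esqnorm_ge0. Qed.

Lemma inner_sqnorm f : inner mu f f = (sqnorm f)%:C.
Proof.
apply: complexP; rewrite /= /Rintegral.
  by congr fine; apply: eq_integral => x _; rewrite mul_conjc.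
by under eq_integral do rewrite mul_conjc; rewrite integral0.
Qed.

Lemma sqnormB f g : cLp mu 2%:E f -> cLp mu 2%:E g ->
  sqnorm (fun x => f x - g x) = sqnorm f + sqnorm g - complex.Re (inner mu f g) *+ 2.
Proof.
move=> hf hg; have hfg := cLp2B hf hg.
have := inner_sqnorm (fun x => f x - g x).
rewrite innerBl// !innerBr// !inner_sqnorm (inner_conj hf hg) => /(congr1 (@complex.Re _)).
by rewrite !ReImE => <-; ring.
Qed.

Lemma sqnormD_le f g : cLp mu 2%:E f -> cLp mu 2%:E g ->
  sqnorm (fun x => f x + g x) <= sqnorm f *+ 2 + sqnorm g *+ 2.
Proof.
move=> hf hg; rewrite -lee_fin -sqnormE; last exact: cLp2D.
rewrite (le_trans (esqnormD_le _ _))//; try exact: cLp2_measurable.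
by rewrite !sqnormE// -!EFinM -EFinD lee_fin !mulr_natl.
Qed.

Lemma sqnormZ (z : R[i]) f : cLp mu 2%:E f ->
  sqnorm (fun x => z * f x) = sqabs z * sqnorm f.
Proof.
move=> hf; apply: EFin_inj; rewrite -sqnormE; last exact: cLp2Z.
by rewrite esqnormZ ?sqnormE//; exact: cLp2_measurable.
Qed.

(** The test vector is [f - (<f, g> / w) g] with [w = |g|^2 + d'], where [d' > 0]
    avoids dividing by a norm that may vanish, and then tends to [0]. *)
Lemma cauchy_schwarz f g : cLp mu 2%:E f -> cLp mu 2%:E g ->
  sqabs (inner mu f g) <= sqnorm f * sqnorm g.
Proof.
move=> hf hg; set I := inner mu f g.
have key (d' : R) : 0 < d' -> sqabs I <= sqnorm f * (sqnorm g + d').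
  move=> d0; have gd : 0 < sqnorm g + d' by rewrite ltr_wpDl// sqnorm_ge0.
  set w := sqnorm g + d' in gd *; have := sqnorm_ge0 (fun x => f x - (w^-1%:C * I) * g x).
  rewrite sqnormB//; last exact: cLp2Z.
  rewrite sqnormZ// innerZr// -/I sqabsM sqabsC conjcM conjcC.
  rewrite [X in complex.Re X](_ : _ = (w^-1 * sqabs I)%:C); last first.
    by rewrite [RHS]rmorphM /= -mul_conjc mulrA mulrAC.
  rewrite ReC.
  set s := sqabs I => h.
  have s0 : 0 <= s by exact: sqabs_ge0.
  have wI : w^-1 * w = 1 by rewrite mulVf// gt_eqF.
  have gw : w^-1 * sqnorm g <= 1 by rewrite -wI ler_pM2l ?invr_gt0// lerDl ltW.
  have : 0 <= (sqnorm f + w^-1 ^+ 2 * s * sqnorm g - w^-1 * s *+ 2) * w.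
    by rewrite mulr_ge0 ?(ltW gd).
  have -> : (sqnorm f + w^-1 ^+ 2 * s * sqnorm g - w^-1 * s *+ 2) * w =
      sqnorm f * w + (w^-1 * w) * (s * (w^-1 * sqnorm g)) - (w^-1 * w) * s *+ 2 by ring.
  rewrite wI !mul1r => h1.
  have : s * (w^-1 * sqnorm g) <= s by rewrite ler_piMr.
  by lra.
apply/ler_addgt0Pr => e e0.
have f1 : 0 < sqnorm f + 1 by rewrite ltr_wpDl// sqnorm_ge0.
apply: (le_trans (key (e / (sqnorm f + 1)) _)); first by rewrite divr_gt0.
rewrite mulrDr lerD2l mulrCA ler_piMr ?(ltW e0)//.
by rewrite ler_pdivrMr// mul1r lerDl.
Qed.

End ComplexIntegral.

(** * Orthonormal systems in [L^2] *)

(** The index map [s] allows a translation that permutes the system [e] to act on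
    an expansion. *)
Definition partial_sum (R : realType) (I T : Type) (e : I -> T -> R[i])
    (s : nat -> I) (a : nat -> R[i]) (N : nat) : T -> R[i] :=
  fun x => \sum_(k < N) a k * e (s k) x.

Section Hilbert.
Context {d : measure_display} {T : measurableType d} {R : realType}.
Variable mu : {measure set T -> \bar R}.
Implicit Types f g : T -> R[i].

Definition L2cvg (f_ : nat -> T -> R[i]) f :=
  sqnorm mu (fun x => f_ N x - f x) @[N --> \oo] --> 0.

(** The error splits into three inner products that involve [f_ N - f] or
    [g_ N - g], to which Cauchy-Schwarz applies. *)
Lemma inner_cvg (f_ g_ : nat -> T -> R[i]) f g :
  (forall N, cLp mu 2%:E (f_ N)) -> (forall N, cLp mu 2%:E (g_ N)) ->
  cLp mu 2%:E f -> cLp mu 2%:E g -> L2cvg f_ f -> L2cvg g_ g ->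
  sqabs (inner mu (f_ N) (g_ N) - inner mu f g) @[N --> \oo] --> 0.
Proof.
move=> Lf_ Lg_ Lf Lg cf cg.
pose df N := fun x => f_ N x - f x; pose dg N := fun x => g_ N x - g x.
have Ldf N : cLp mu 2%:E (df N) by exact: cLp2B.
have Ldg N : cLp mu 2%:E (dg N) by exact: cLp2B.
have split_inner N : inner mu (f_ N) (g_ N) - inner mu f g =
    (inner mu (df N) (dg N) + inner mu (df N) g) + inner mu f (dg N).
  rewrite -innerDr// [X in inner mu (df N) X](_ : _ = g_ N); last first.
    by apply/funext => x; rewrite /dg subrK.
  by rewrite innerBl// innerBr// addrA subrK.
have bnd N : sqabs (inner mu (f_ N) (g_ N) - inner mu f g) <=
    (sqnorm mu (df N) * sqnorm mu (dg N) *+ 2 + sqnorm mu (df N) * sqnorm mu g *+ 2) *+ 2 +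
    sqnorm mu f * sqnorm mu (dg N) *+ 2.
  rewrite split_inner; apply: (le_trans (sqabsD_le _ _)); apply: lerD.
    rewrite lerMn2r/=; apply: (le_trans (sqabsD_le _ _)).
    by apply: lerD; rewrite lerMn2r/=; exact: cauchy_schwarz.
  by rewrite lerMn2r/=; exact: cauchy_schwarz.
have lim0 : (sqnorm mu (df N) * sqnorm mu (dg N) *+ 2 + sqnorm mu (df N) * sqnorm mu g *+ 2) *+ 2 +
    sqnorm mu f * sqnorm mu (dg N) *+ 2 @[N --> \oo] --> 0.
  have -> : 0 = (0 * 0 *+ 2 + 0 * sqnorm mu g *+ 2) *+ 2 + sqnorm mu f * 0 *+ 2 :> R.
    by rewrite !mul0r mulr0 !mul0rn !addr0 mul0rn.
  by apply: cvgD; last (apply: cvgMn; apply: cvgM => //; exact: cvg_cst);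
    apply: cvgMn; apply: cvgD; apply: cvgMn; apply: cvgM => //; exact: cvg_cst.
apply: squeeze_cvgr lim0; last exact: cvg_cst.
by near=> N; rewrite sqabs_ge0 bnd.
Unshelve. all: end_near. Qed.

Lemma inner_lim_eq (f_ g_ f'_ g'_ : nat -> T -> R[i]) f g f' g' :
  (forall N, [/\ cLp mu 2%:E (f_ N), cLp mu 2%:E (g_ N),
                 cLp mu 2%:E (f'_ N) & cLp mu 2%:E (g'_ N)]) ->
  cLp mu 2%:E f -> cLp mu 2%:E g -> cLp mu 2%:E f' -> cLp mu 2%:E g' ->
  L2cvg f_ f -> L2cvg g_ g -> L2cvg f'_ f' -> L2cvg g'_ g' ->
  (forall N, inner mu (f_ N) (g_ N) = inner mu (f'_ N) (g'_ N)) ->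
  inner mu f g = inner mu f' g'.
Proof.
move=> L_ Lf Lg Lf' Lg' cf cg cf' cg' eqN.
have c1 : sqabs (inner mu (f_ N) (g_ N) - inner mu f g) @[N --> \oo] --> 0.
  by apply: inner_cvg => // N; have [] := L_ N.
have c2 : sqabs (inner mu (f'_ N) (g'_ N) - inner mu f' g') @[N --> \oo] --> 0.
  by apply: inner_cvg => // N; have [] := L_ N.
have c12 : sqabs (inner mu (f_ N) (g_ N) - inner mu f g) *+ 2 +
    sqabs (inner mu (f'_ N) (g'_ N) - inner mu f' g') *+ 2 @[N --> \oo] --> 0.
  have -> : 0 = 0 *+ 2 + 0 *+ 2 :> R by rewrite !mul0rn addr0.
  by apply: cvgD; exact: cvgMn.
apply/eqP; rewrite -subr_eq0; apply/eqP/sqabs_eq0/le_anti.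
rewrite sqabs_ge0 andbT.
apply: (cvgr_to_ge c12); apply: nearW => N.
rewrite -[sqabs (_ - inner mu f g)]sqabsN opprB eqN.
apply: le_trans (sqabsD_le _ _).
by rewrite addrA subrK.
Qed.

Lemma sqnorm_cvg (f_ : nat -> T -> R[i]) f :
  (forall N, cLp mu 2%:E (f_ N)) -> cLp mu 2%:E f -> L2cvg f_ f ->
  sqnorm mu (f_ N) @[N --> \oo] --> sqnorm mu f.
Proof.
move=> Lf_ Lf cf.
have := inner_cvg Lf_ Lf_ Lf Lf cf cf.
move=> c0; apply/cvgrPdist_lt => eps e0.
have /cvgr_lt/(_ _ (exprn_gt0 2 e0)) := c0.
apply: filterS => N; rewrite !inner_sqnorm -rmorphB/= sqabsC => h.
rewrite distrC -(ltr_pXn2r (isT : (0 < 2)%N)) ?nnegrE ?normr_ge0 ?(ltW e0)//.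
by rewrite real_normK ?num_real.
Qed.

Section Orthonormal.
Variables (I : eqType) (e : I -> T -> R[i]).
Hypothesis oe : orthonormal_system mu e.

Local Notation partial_sum := (partial_sum e).

Lemma cLp2_partial_sum s a N : cLp mu 2%:E (partial_sum s a N).
Proof. by apply: cLp2_sum => k _; apply: cLp2Z; case: oe. Qed.

Lemma inner_partial_sum s t a b N M :
  inner mu (partial_sum s a N) (partial_sum t b M) =
  \sum_(k < N) \sum_(j < M) a k * (b j)^*%C * (s k == t j)%:R.
Proof.
have Le i : cLp mu 2%:E (e i) by case: oe.
rewrite inner_suml; last 2 first.
- by move=> k _; exact: cLp2Z.
- exact: cLp2_partial_sum.
apply: eq_bigr => k _; rewrite inner_sumr; last 2 first.
- exact: cLp2Z.
- by move=> j _; exact: cLp2Z.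
apply: eq_bigr => j _; rewrite innerZl//; last exact: cLp2Z.
by rewrite innerZr// (proj2 oe) mulrA.
Qed.

Lemma sqnorm_partial_sum s a N : injective s ->
  sqnorm mu (partial_sum s a N) = \sum_(k < N) sqabs (a k).
Proof.
move=> sI; apply: (@complexI R); rewrite -inner_sqnorm inner_partial_sum.
rewrite rmorph_sum; apply: eq_bigr => k _ /=.
rewrite (bigD1 k)//= eqxx mulr1 mul_conjc big1 ?addr0// => j jk.
by rewrite (inj_eq sI) eq_sym (inj_eq val_inj) (negbTE jk) mulr0.
Qed.

(** Pythagoras for the projection onto finitely many members of the system; it
    yields Bessel's inequality as well as the completeness criterion
    [closed_span_parseval]. *)
Lemma sqnorm_sub_proj f (s : seq I) : cLp mu 2%:E f -> uniq s ->
  sqnorm mu (fun x => f x - \sum_(i <- s) inner mu f (e i) * e i x) =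
  sqnorm mu f - \sum_(i <- s) sqabs (inner mu f (e i)).
Proof.
move=> Lf us; have Le i : cLp mu 2%:E (e i) by case: oe.
have LS : cLp mu 2%:E (fun x => \sum_(i <- s) inner mu f (e i) * e i x).
  by apply: cLp2_sum => i _; exact: cLp2Z.
have fS : inner mu f (fun x => \sum_(i <- s) inner mu f (e i) * e i x) =
    (\sum_(i <- s) sqabs (inner mu f (e i)))%:C.
  rewrite inner_sumr//; last by move=> i _; exact: cLp2Z.
  rewrite rmorph_sum; apply: eq_bigr => i _.
  by rewrite innerZr// mulrC mul_conjc.
have SS : sqnorm mu (fun x => \sum_(i <- s) inner mu f (e i) * e i x) =
    \sum_(i <- s) sqabs (inner mu f (e i)).
  apply: (@complexI R); rewrite -inner_sqnorm inner_suml//; last first.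
    by move=> i _; exact: cLp2Z.
  rewrite rmorph_sum; apply: eq_big_seq => i si.
  rewrite innerZl// inner_sumr//; last by move=> j _; exact: cLp2Z.
  rewrite (bigD1_seq i)//= big1_seq ?addr0; last first.
    move=> j /andP[ji _]; rewrite innerZr// (proj2 oe) eq_sym (negbTE ji).
    by rewrite mulr0.
  by rewrite innerZr// (proj2 oe) eqxx mulr1 mul_conjc.
by rewrite sqnormB// fS SS ReC; ring.
Qed.

Lemma bessel f (s : seq I) : cLp mu 2%:E f -> uniq s ->
  \sum_(i <- s) sqabs (inner mu f (e i)) <= sqnorm mu f.
Proof. by move=> Lf us; rewrite -subr_ge0 -sqnorm_sub_proj// sqnorm_ge0. Qed.

Lemma inner_coef s a f i : injective s -> cLp mu 2%:E f ->
  L2cvg (partial_sum s a) f -> inner mu (e (s i)) f = (a i)^*%C.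
Proof.
move=> sI Lf cf.
have Le j : cLp mu 2%:E (e j) by case: oe.
have ce : L2cvg (fun=> e (s i)) (e (s i)).
  rewrite /L2cvg; under eq_fun do under [X in sqnorm _ X]eq_fun do rewrite subrr.
  by rewrite /sqnorm esqnorm0; exact: cvg_cst.
have := inner_cvg (fun=> Le (s i)) (cLp2_partial_sum s a) (Le _) Lf ce cf.
move=> c0; apply/eqP; rewrite -subr_eq0; apply/eqP/sqabs_eq0/le_anti.
rewrite sqabs_ge0 andbT; apply: (cvgr_to_ge c0).
exists i.+1 => // N /= iN; rewrite -[leLHS]sqabsN opprB.
suff -> : inner mu (e (s i)) (partial_sum s a N) = (a i)^*%C by [].
rewrite inner_sumr//; last by move=> j _; exact: cLp2Z.
rewrite (bigD1 (Ordinal iN))//= big1 ?addr0.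
  by rewrite innerZr// (proj2 oe) eqxx mulr1.
move=> j ji; rewrite innerZr// (proj2 oe) (inj_eq sI).
by rewrite -(inj_eq val_inj) eq_sym/= in ji; rewrite (negbTE ji) mulr0.
Qed.

End Orthonormal.

(** The inner product of two orthonormal expansions is a limit of sums that only
    involve coefficients and indices, hence is the same in any other orthonormal
    system. *)
Lemma inner_transfer (I : eqType) (e e' : I -> T -> R[i]) s t a b f g f' g' :
  orthonormal_system mu e -> orthonormal_system mu e' ->
  cLp mu 2%:E f -> cLp mu 2%:E g -> cLp mu 2%:E f' -> cLp mu 2%:E g' ->
  L2cvg (partial_sum e s a) f -> L2cvg (partial_sum e t b) g ->
  L2cvg (partial_sum e' s a) f' -> L2cvg (partial_sum e' t b) g' ->
  inner mu f g = inner mu f' g'.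
Proof.
move=> oe oe' Lf Lg Lf' Lg' cf cg cf' cg'.
apply: (inner_lim_eq _ Lf Lg Lf' Lg' cf cg cf' cg') => N.
  by split; exact: cLp2_partial_sum.
by rewrite !inner_partial_sum.
Qed.

Section ClosedSpan.
Variables (I : Type) (e : I -> T -> R[i]).
Hypothesis Le : forall i, cLp mu 2%:E (e i).

Let comb (s : seq (R[i] * I)) : T -> R[i] := fun x => \sum_(a <- s) a.1 * e a.2 x.

Let Lcomb s : cLp mu 2%:E (comb s).
Proof. by apply: cLp2_sum => i _; exact: cLp2Z. Qed.

Lemma closed_spanP f : closed_span mu e f <-> cLp mu 2%:E f /\
  forall eps : R, 0 < eps -> exists s : seq (R[i] * I),
    sqnorm mu (fun x => f x - \sum_(a <- s) a.1 * e a.2 x) < eps.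
Proof.
split=> -[Lf h]; split => // eps e0.
  have se : 0 < Num.sqrt eps by rewrite sqrtr_gt0.
  have [s] := h _ se; rewrite cnorm2_lt// sqr_sqrtr ?(ltW e0)// => hs.
  by exists s; rewrite -lte_fin -sqnormE//; apply: cLp2B => //; exact: Lcomb.
have [s hs] := h _ (exprn_gt0 2 e0); exists s.
by rewrite cnorm2_lt// sqnormE//; apply: cLp2B => //; exact: Lcomb.
Qed.

Lemma closed_span_lim (f_ : nat -> T -> R[i]) f :
  (forall N, closed_span mu e (f_ N)) -> cLp mu 2%:E f -> L2cvg f_ f ->
  closed_span mu e f.
Proof.
move=> sf Lf cf; apply/closed_spanP; split => // eps e0.
have e4 : 0 < eps / 4 by rewrite divr_gt0.
have /cvgr_lt/(_ _ e4) [N _ /(_ N (leqnn N))/= hN] := cf.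
have /closed_spanP[LN /(_ _ e4)[s hs]] := sf N; exists s.
have -> : (fun x => f x - \sum_(a <- s) a.1 * e a.2 x) = (fun x =>
    (-1) * (f_ N x - f x) + (f_ N x - comb s x)).
  by apply/funext => x; rewrite mulN1r opprB addrA subrK.
apply: (le_lt_trans (sqnormD_le _ _)).
- by apply: cLp2Z; exact: cLp2B.
- by apply: cLp2B => //; exact: Lcomb.
rewrite sqnormZ; last exact: cLp2B.
rewrite sqabsN /sqabs/= expr1n expr0n addr0 mul1r.
by move: hs hN; rewrite -/(comb s); lra.
Qed.

Lemma closed_span_comb s : closed_span mu e (comb s).
Proof.
apply/closed_spanP; split; first exact: Lcomb.
move=> eps e0; exists s.
rewrite (_ : (fun x => _) = fun=> 0) ?/sqnorm ?esqnorm0//.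
by apply/funext => x; rewrite subrr.
Qed.

Lemma closed_spanD f g : closed_span mu e f -> closed_span mu e g ->
  closed_span mu e (fun x => f x + g x).
Proof.
move=> /closed_spanP[Lf sf] /closed_spanP[Lg sg]; apply/closed_spanP.
split; first exact: cLp2D.
move=> eps e0; have e4 : 0 < eps / 4 by rewrite divr_gt0.
have [s hs] := sf _ e4; have [t ht] := sg _ e4; exists (s ++ t).
have -> : (fun x => f x + g x - \sum_(a <- s ++ t) a.1 * e a.2 x) = (fun x =>
    (f x - comb s x) + (g x - comb t x)).
  by apply/funext => x; rewrite big_cat opprD/= addrACA.
apply: (le_lt_trans (sqnormD_le _ _)); try by apply: cLp2B => //; exact: Lcomb.
by move: hs ht; rewrite -/(comb s) -/(comb t); lra.
Qed.

Lemma closed_spanZ z f : closed_span mu e f ->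
  closed_span mu e (fun x => z * f x).
Proof.
move=> /closed_spanP[Lf sf]; apply/closed_spanP; split; first exact: cLp2Z.
move=> eps e0; have z1 : 0 < sqabs z + 1 by rewrite ltr_wpDl ?sqabs_ge0.
have [s hs] := sf _ (divr_gt0 e0 z1); exists [seq (z * a.1, a.2) | a <- s].
have -> : (fun x => z * f x -
    \sum_(a <- [seq (z * a.1, a.2) | a <- s]) a.1 * e a.2 x) = (fun x =>
    z * (f x - comb s x)).
  apply/funext => x; rewrite big_map mulrBr mulr_sumr; congr (_ - _).
  by apply: eq_bigr => a _; rewrite mulrA.
rewrite sqnormZ; last by apply: cLp2B => //; exact: Lcomb.
move: hs; rewrite ltr_pdivlMr// mulrDr mulr1 -/(comb s).
have := sqnorm_ge0 mu (fun x => f x - comb s x).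
by rewrite [sqabs z * _]mulrC; lra.
Qed.

Lemma closed_span_sum (J : Type) (s : seq J) (f : J -> T -> R[i]) :
  (forall j, closed_span mu e (f j)) ->
  closed_span mu e (fun x => \sum_(j <- s) f j x).
Proof.
move=> sf; elim: s => [|j s IH].
  rewrite (_ : (fun x => _) = comb [::]); first exact: closed_span_comb.
  by apply/funext => x; rewrite /comb !big_nil.
rewrite (_ : (fun x => _) = fun x => f j x + \sum_(j <- s) f j x).
  exact: closed_spanD.
by apply/funext => x; rewrite big_cons.
Qed.

Lemma closed_span_gen i : closed_span mu e (e i).
Proof.
have := closed_span_comb [:: (1, i)]; congr closed_span.
by apply/funext => x; rewrite /comb big_seq1 mul1r.
Qed.

End ClosedSpan.

Lemma closed_span_sub (I J : Type) (e : I -> T -> R[i]) (g : J -> T -> R[i]) :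
  (forall i, cLp mu 2%:E (e i)) -> (forall j, cLp mu 2%:E (g j)) ->
  (forall i, closed_span mu g (e i)) -> closed_span mu e `<=` closed_span mu g.
Proof.
move=> Le Lg sub f /(closed_spanP Le)[Lf sf].
apply/(closed_spanP Lg); split => // eps e0.
have e4 : 0 < eps / 4 by rewrite divr_gt0.
have [s hs] := sf _ e4.
have : closed_span mu g (fun x => \sum_(a <- s) a.1 * e a.2 x).
  by apply: (closed_span_sum Lg) => a; exact: closed_spanZ.
move=> /(closed_spanP Lg)[LS /(_ _ e4)[t ht]]; exists t.
have Lt : cLp mu 2%:E (fun x => \sum_(a <- t) a.1 * g a.2 x).
  by apply: cLp2_sum => i _; exact: cLp2Z.
have -> : (fun x => f x - \sum_(a <- t) a.1 * g a.2 x) = (fun x =>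
    (f x - \sum_(a <- s) a.1 * e a.2 x) +
    (\sum_(a <- s) a.1 * e a.2 x - \sum_(a <- t) a.1 * g a.2 x)).
  by apply/funext => x; rewrite addrA subrK.
apply: (le_lt_trans (sqnormD_le _ _)); try exact: cLp2B.
by move: hs ht; lra.
Qed.

(** By Pythagoras the squared distance to a partial expansion is the part of the
    squared norm that its coefficients miss. *)
Lemma closed_span_parseval (I : eqType) (e : I -> T -> R[i]) f :
  orthonormal_system mu e -> cLp mu 2%:E f ->
  (forall eps : R, 0 < eps -> exists2 s : seq I, uniq s &
     sqnorm mu f - eps < \sum_(i <- s) sqabs (inner mu f (e i))) ->
  closed_span mu e f.
Proof.
move=> oe Lf h; apply/(closed_spanP (proj1 oe)); split => // eps e0.
have [s us hs] := h _ e0; exists [seq (inner mu f (e i), i) | i <- s].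
under [X in sqnorm _ X]eq_fun do rewrite big_map/=.
by rewrite sqnorm_sub_proj//; move: hs; lra.
Qed.

End Hilbert.

(** * Topological and locally compact fields *)

Section TopologicalField.
Context {K : topologicalFieldType}.

Lemma continuous_addl (a : K) : continuous (fun x : K => a + x).
Proof.
move=> x; apply: (@continuous_comp K (K * K)%type K (fun x => (a, x))
  (fun z => z.1 + z.2)); last exact: add_continuous.
by apply: cvg_pair => //; exact: cvg_cst.
Qed.

Lemma continuous_mull (a : K) : continuous (fun x : K => a * x).
Proof.
move=> x; apply: (@continuous_comp K (K * K)%type K (fun x => (a, x))
  (fun z => z.1 * z.2)); last exact: Defs.mul_continuous.
by apply: cvg_pair => //; exact: cvg_cst.
Qed.

Lemma image_addl (a : K) (A : set K) :
  [set a + x | x in A] = (fun x => - a + x) @^-1` A.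
Proof.
apply/seteqP; split=> [_ [x Ax <-]|x /= Ax]; first by rewrite /= addKr.
by exists (- a + x) => //; rewrite addNKr.
Qed.

Lemma image_mull (a : K) (A : set K) : a != 0 ->
  [set a * x | x in A] = (fun x => a^-1 * x) @^-1` A.
Proof.
move=> a0; apply/seteqP; split=> [_ [x Ax <-]|x /= Ax]; first by rewrite /= mulKf.
by exists (a^-1 * x) => //; rewrite mulVKf.
Qed.

Lemma open_preimage_addl (a : K) (A : set K) :
  open A -> open ((fun x => a + x) @^-1` A).
Proof. by move: A; apply/continuousP; exact: continuous_addl. Qed.

Lemma open_preimage_mull (a : K) (A : set K) :
  open A -> open ((fun x => a * x) @^-1` A).
Proof. by move: A; apply/continuousP; exact: continuous_mull. Qed.

Lemma nbhs_preimage_mull (a x : K) (A : set K) :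
  nbhs (a * x) A -> nbhs x ((fun y => a * y) @^-1` A).
Proof. exact: continuous_mull. Qed.

Lemma nbhs_preimage_mulr (a x : K) (A : set K) :
  nbhs (x * a) A -> nbhs x ((fun y => y * a) @^-1` A).
Proof.
rewrite mulrC => h; have := nbhs_preimage_mull h.
by rewrite (_ : (fun y => y * a) = (fun y => a * y))//;
  apply/funext => y; rewrite mulrC.
Qed.

(** The tube lemma for multiplication: it yields the semicontinuity of the modulus
    and a compact set contracted by a multiplication. *)
Lemma mul_compact_near (a : K) (C U : set K) : compact C -> open U ->
  (forall x, C x -> U (a * x)) -> \forall w \near a, forall x, C x -> U (w * x).
Proof.
move=> /compact_near_coveringP cC oU CU.
apply: (cC K (nbhs a) (fun w x => U (w * x))) => x Cx.
have := @Defs.mul_continuous K (a, x) U (open_nbhs_nbhs (conj oU (CU x Cx))).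
case=> -[A B] /= [nA nB] AB; exists (B, A) => // -[y w] /= [By Aw].
exact: (AB (w, y)).
Qed.

Section Measurability.

Lemma measurable_open (U : set K) : open U -> measurable (U : set (borel K)).
Proof. exact: sub_sigma_algebra. Qed.

Lemma measurable_closed (U : set K) : closed U -> measurable (U : set (borel K)).
Proof.
move=> cU; rewrite -[U]setCK.
by apply: (@measurableC _ (borel K)); apply: measurable_open; exact: closed_openC.
Qed.

Lemma measurable_continuous (f : K -> K) : continuous f ->
  measurable_fun [set: borel K] (f : borel K -> borel K).
Proof.
move=> /continuousP cf.
apply: (@measurability _ _ (borel K) (borel K) setT f (@open K) erefl).
by move=> _ [B oB <-]; rewrite setTI; apply: measurable_open; exact: cf.
Qed.

Lemma measurable_continuousR (R : realType) (f : K -> R) : continuous f ->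
  measurable_fun [set: borel K] (f : borel K -> R).
Proof.
move=> /continuousP cf; apply: (measurability _ (RGenOpens.measurableE R)).
move=> _ [_ [a [b ->] <-]]; rewrite setTI.
by apply: measurable_open; apply: cf; exact: interval_open.
Qed.

Lemma measurable_preimage_addl (a : K) (A : set (borel K)) : measurable A ->
  measurable ((fun x => a + x) @^-1` A : set (borel K)).
Proof.
move=> mA; rewrite -[X in measurable X]setTI.
by apply: (measurable_continuous (@continuous_addl a)) => //.
Qed.

Lemma measurable_preimage_mull (a : K) (A : set (borel K)) : measurable A ->
  measurable ((fun x => a * x) @^-1` A : set (borel K)).
Proof.
move=> mA; rewrite -[X in measurable X]setTI.
by apply: (measurable_continuous (@continuous_mull a)) => //.
Qed.

End Measurability.

Section LocalFieldTopology.
Hypothesis hK : is_local_field K.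

(** The closure of a point is connected: in a totally disconnected space it is the
    point itself. *)
Lemma closed_point (x : K) : closed [set x].
Proof.
suff -> : [set x] = closure [set x] by exact: closed_closure.
apply/esym/seteqP; split; last exact: subset_closure.
have xx : closure [set x] x by exact: subset_closure.
have <- : closure [set x] `&` connected_component [set: K] x = closure [set x].
  apply: setIidl; apply: connected_component_max => //.
  exact/connected_closure/connected1.
by rewrite (local_field_totally_disconnected hK (x := x) I) => y [].
Qed.

Lemma local_field_hausdorff : hausdorff_space K.
Proof.
move=> x y cxy; apply/eqP; rewrite eq_sym -subr_eq0; apply/eqP.
apply: (closed_point (x := 0)) => U nU.
have [[A B] /= [nA nB] AB] := @sub_continuous K (y, x) U nU.
have [z [Bz Az]] := cxy _ _ nB nA.
by exists 0; split => //; rewrite -(subrr z); exact: (AB (z, z)).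
Qed.

Lemma point0_not_open : ~ open [set (0 : K)].
Proof.
move=> o0; apply: (local_field_nondiscrete hK) => A.
have -> : A = \bigcup_(a in A) ((fun x => - a + x) @^-1` [set 0]).
  apply/seteqP; split=> [a Aa|x [a Aa]/=]; first by exists a => //=; rewrite addNr.
  by move/eqP; rewrite addrC subr_eq0 => /eqP ->.
by apply: bigcup_open => a _; exact: open_preimage_addl.
Qed.

Lemma nbhs0_nontrivial (U : set K) : nbhs (0 : K) U -> exists2 x, U x & x != 0.
Proof.
move=> nU; apply/not_exists2P => h; apply: point0_not_open.
rewrite openE => _ ->; apply: filterS nU => x Ux.
by have [//|/negP/negPn/eqP] := h x.
Qed.

(** Removing finitely many closed points from a finite neighbourhood of [0] would
    make [0] an open point. *)
Lemma nbhs0_infinite (U : set K) : nbhs (0 : K) U -> infinite_set U.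
Proof.
move=> nU fU; have fU0 : finite_set (U `\ 0) by exact: finite_setD.
have cU0 : closed (U `\ 0).
  rewrite -(image_id (U `\ 0)) -bigcup_imset1.
  by apply: closed_bigcup => // x _; exact: closed_point.
have [|x [Ux nx] x0] := @nbhs0_nontrivial (U `&` ~` (U `\ 0)); last first.
  by apply: nx; split => //; exact/eqP.
apply: filterI => //; apply: open_nbhs_nbhs; split; first exact: closed_openC.
by case=> _; exact.
Qed.

Lemma compact_nbhs0 : exists2 X : set K, nbhs (0 : K) X & compact X.
Proof.
have [X] := local_field_locally_compact hK I (x := 0).
rewrite /within/= => nX [cX _]; exists X => //.
by apply: filterS nX => x; exact.
Qed.

Lemma measurable_compact (C : set K) : compact C ->
  measurable (C : set (borel K)).
Proof.
move=> cC; apply: measurable_closed; apply: compact_closed => //.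
exact: local_field_hausdorff.
Qed.

End LocalFieldTopology.
End TopologicalField.

(** * Haar measure and modulus *)

Section Haar.
Context {R : realType} {K : topologicalFieldType}.
Hypothesis hK : is_local_field K.
Variable mu : {measure set (borel K) -> \bar R}.
Hypothesis hmu : is_haar mu.

Lemma haar_preimage_addl (a : K) (A : set (borel K)) : measurable A ->
  mu ((fun x => a + x) @^-1` A) = mu A.
Proof.
move=> mA; rewrite -[RHS](haar_translation hmu (- a) mA).
by rewrite image_addl opprK.
Qed.

(** Finitely many translates of a null open set cover any compact set, so inner
    regularity would make the whole measure vanish. *)
Lemma haar_open_gt0 (U : set K) : open U -> U !=set0 -> (0 < mu U)%E.
Proof.
move=> oU [u Uu]; rewrite lt0e measure_ge0 andbT; apply/negP => /eqP U0.
have := haar_nonzero hmu; rewrite (haar_inner_regular hmu openT) => /negP; apply.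
apply/eqP/le_anti/andP; split; last first.
  apply: le_ereal_sup_tmp; exists (mu set0); last by rewrite measure0.
  by exists set0 => //; split => //; exact: compact0.
apply: ge_ereal_sup => _ [C [cC _] <-].
have := cC; rewrite compact_cover => /(_ K C (fun c => (fun x => (u - c) + x) @^-1` U)).
case=> [c _|x Cx|D' DC CD]; first exact: open_preimage_addl.
  by exists x => //=; rewrite subrK.
have mC := measurable_compact hK cC.
have mF c : measurable ((fun x => (u - c) + x) @^-1` U : set (borel K)).
  by apply: measurable_preimage_addl; exact: measurable_open.
apply: (le_trans (content_sub_fsum mu (finite_fset D') (fun c _ => mF c) mC CD)).
rewrite fsbig1// => c _; rewrite -U0; apply: haar_preimage_addl.
exact: measurable_open.
Qed.

Lemma haar_compact_fin (C : set K) : compact C -> mu C \is a fin_num.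
Proof. by move=> cC; rewrite ge0_fin_numE// (haar_compact hmu cC). Qed.

Lemma haar_compact_nbhs0_gt0 (X : set K) : nbhs (0 : K) X -> compact X ->
  (0 < mu X)%E.
Proof.
move=> nX cX; have [U [oU U0] UX] : exists2 U : set K, open_nbhs 0 U & U `<=` X.
  by move: nX; rewrite nbhsE.
apply: (lt_le_trans (haar_open_gt0 oU _)); first by exists 0.
apply: le_measure; rewrite ?inE//; first exact: measurable_open.
exact: measurable_compact.
Qed.

(** All points have the same measure, and a compact neighbourhood of [0] has
    finite measure but infinitely many points. *)
Lemma haar_point (x : K) : mu [set x] = 0%E.
Proof.
have [X nX cX] := compact_nbhs0 hK.
have mpt y : measurable ([set y] : set (borel K)).
  by apply: measurable_closed; exact: closed_point.
have mu0 y : mu [set y] = mu [set (0 : K)].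
  rewrite -(haar_translation hmu y (mpt 0)); congr (mu _).
  by apply/seteqP; split=> [_ ->|_ [_ -> <-]]; [exists 0|]; rewrite ?addr0.
rewrite mu0; apply/eqP/negP => /negP n0.
have m0f : mu [set (0 : K)] \is a fin_num by apply: haar_compact_fin; exact: compact_set1.
set r := fine (mu [set (0 : K)]).
have r0 : 0 < r.
  by rewrite fine_gt0// lt0e n0 measure_ge0/= ltey_eq m0f.
have /infiniteP/pcard_leP[f] := nbhs0_infinite hK nX.
have bound n : r *+ n <= fine (mu X).
  rewrite -lee_fin fineK ?haar_compact_fin//.
  have -> : (r *+ n)%:E = mu (\big[setU/set0]_(i < n) [set f i]).
    rewrite measure_bigsetU_ord//; last first.
      move=> i j _ _ [y [/= -> fij]]; apply: val_inj.
      by apply: (inj (f := f)) fij; rewrite inE.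
    rewrite (eq_bigr (fun=> r%:E)); last by move=> i _; rewrite fineK// -(mu0 (f i)).
    by rewrite sumEFin sumr_const card_ord.
  apply: le_measure; rewrite ?inE.
  - by apply: bigsetU_measurable => i _; exact: mpt.
  - exact: measurable_compact.
  - elim/big_ind : _ => [//|A B hA hB y [/hA|/hB]//|i _ y ->]; exact: funS.
have := bound (Num.truncn (fine (mu X) / r)).+1; apply/negP; rewrite -ltNge.
by rewrite -mulr_natr mulrC -ltr_pdivrMr// truncnS_gt.
Qed.

Section Modulus.
Variable abs : K -> R.
Hypothesis habs : is_modulus mu abs.

Lemma modulus0 : abs 0 = 0. Proof. exact: (proj1 habs). Qed.

(** The defining property of the modulus extends to [a = 0] because points are
    null. *)
Lemma modulus_image (a : K) (C : set K) : compact C ->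
  mu [set a * x | x in C] = ((abs a)%:E * mu C)%E.
Proof.
move=> cC; have [->|a0] := eqVneq a 0; last first.
  by apply: (proj2 habs) => //; exact: measurable_compact.
rewrite modulus0 mul0e; apply/eqP; rewrite eq_le measure_ge0 andbT.
rewrite -(haar_point 0).
apply: le_measure; rewrite ?inE.
- apply: measurable_compact => //; apply: continuous_compact => //.
  exact/continuous_subspaceT/continuous_mull.
- by apply: measurable_closed; exact: closed_point.
- by move=> _ [x _ <-]; rewrite mul0r.
Qed.

Let refX : exists2 X : set K, compact X & (0 < mu X)%E.
Proof.
have [X nX cX] := compact_nbhs0 hK; exists X => //.
exact: haar_compact_nbhs0_gt0.
Qed.

Lemma modulus_ge0 (a : K) : 0 <= abs a.
Proof.
have [X cX X0] := refX; have aX := modulus_image a cX.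
have : (0 <= (abs a)%:E * mu X)%E by rewrite -aX measure_ge0.
rewrite -(fineK (haar_compact_fin cX)) -EFinM lee_fin.
by rewrite pmulr_lge0// fine_gt0// X0 (haar_compact hmu cX).
Qed.

Lemma modulusM (a b : K) : abs (a * b) = abs a * abs b.
Proof.
have [X cX X0] := refX.
have cbX : compact [set b * x | x in X].
  by apply: continuous_compact => //; exact/continuous_subspaceT/continuous_mull.
have := modulus_image (a * b) cX.
have -> : [set a * b * x | x in X] = [set a * y | y in [set b * x | x in X]].
  rewrite image_comp; apply: eq_imagel => x _ /=; exact: esym (mulrA _ _ _).
rewrite !modulus_image// -(fineK (haar_compact_fin cX)) -!EFinM => -[].
rewrite mulrA => /mulIf h; apply/esym/h; rewrite gt_eqF// fine_gt0//.
by rewrite X0 (haar_compact hmu cX).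
Qed.

Lemma modulus_gt0 (a : K) : a != 0 -> 0 < abs a.
Proof.
move=> a0; rewrite lt0r modulus_ge0 andbT; apply/eqP => z.
have [X cX X0] := refX.
have caX : compact [set a * x | x in X].
  by apply: continuous_compact => //; exact/continuous_subspaceT/continuous_mull.
have := modulus_image a^-1 caX.
rewrite (modulus_image a cX) z mul0e mule0 => h.
have : mu X = 0%E.
  rewrite -h image_comp; congr (mu _); apply/seteqP; split=> [x Xx|_ [x Xx <-]] /=.
    by exists x => //=; rewrite mulKf.
  by rewrite mulKf.
by move=> e; move: X0; rewrite e ltxx.
Qed.

Lemma modulus1 : abs 1 = 1.
Proof.
have := modulusM 1 1; rewrite mulr1 => h.
have : abs 1 != 0 by rewrite gt_eqF// modulus_gt0// oner_eq0.
by move=> /mulfI; apply; rewrite -h mulr1.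
Qed.

Lemma modulusX (a : K) n : abs (a ^+ n) = abs a ^+ n.
Proof.
elim: n => [|n IH]; first by rewrite !expr0 modulus1.
by rewrite !exprS modulusM IH.
Qed.

Lemma modulusV (a : K) : abs a^-1 = (abs a)^-1.
Proof.
have [->|a0] := eqVneq a 0; first by rewrite invr0 modulus0 invr0.
have h : abs a != 0 by rewrite gt_eqF// modulus_gt0.
by apply: (mulfI h); rewrite -modulusM !divff// modulus1.
Qed.

(** Upper semicontinuity: by outer regularity [a * X] lies in an open set of
    almost the same measure, which still contains [w * X] for [w] close to [a]. *)
Lemma modulus_usc (a : K) (c : R) : abs a < c -> \forall w \near a, abs w < c.
Proof.
move=> ac; have [X cX X0] := refX; have fX := haar_compact_fin cX.
have caX : compact [set a * x | x in X].
  by apply: continuous_compact => //; exact/continuous_subspaceT/continuous_mull.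
have r0 : 0 < fine (mu X) by rewrite fine_gt0// X0 (haar_compact hmu cX).
have : (mu [set (a * x)%R | x in X] < (c * fine (mu X))%R%:E)%E.
  by rewrite modulus_image// -(fineK fX) -EFinM lte_fin ltr_pM2r.
rewrite (haar_outer_regular hmu (measurable_compact hK caX)).
move=> /ereal_inf_lt[_ [U [oU aU] <-] Uc].
have := @mul_compact_near K a X U cX oU.
move=> /(_ (fun x Xx => aU _ (imageP _ Xx))); apply: filterS => w wU.
have cwX : compact [set w * x | x in X].
  by apply: continuous_compact => //; exact/continuous_subspaceT/continuous_mull.
have : (mu [set (w * x)%R | x in X] < (c * fine (mu X))%R%:E)%E.
  apply: le_lt_trans Uc; apply: le_measure; rewrite ?inE.
  - exact: measurable_compact.
  - exact: measurable_open.
  - by move=> _ [x Xx <-]; exact: wU.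
by rewrite modulus_image// -(fineK fX) -EFinM lte_fin ltr_pM2r.
Qed.

Lemma open_modulus_lt (c : R) : open [set x | abs x < c].
Proof. by rewrite openE => x /= xc; exact: modulus_usc. Qed.

Lemma usc_bounded (g : K -> R) (C : set K) : compact C ->
  (forall x c, C x -> g x < c -> \forall w \near x, g w < c) ->
  exists M : R, forall x, C x -> g x <= M.
Proof.
move=> /compact_near_coveringP cC usc.
have := cC R (pinfty_nbhs R) (fun M x => g x <= M) _.
case=> [x Cx|M [Mr]].
  have := usc x (g x + 1) Cx; rewrite ltrDl ltr01 => /(_ isT) near_x.
  exists ([set w | g w < g x + 1], [set M | g x + 1 < M]).
    by split => //=; apply: nbhs_pinfty_gt; exact: num_real.
  by move=> [w M] /= [h1 h2]; exact/ltW/(lt_trans h1 h2).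
by move=> /(_ (M + 1)); rewrite ltrDl ltr01 => /(_ isT) h; exists (M + 1).
Qed.

End Modulus.
End Haar.

(** * The ultrametric inequality *)

Section Ultrametric.
Context {R : realType} {K : topologicalFieldType}.
Hypothesis hK : is_local_field K.
Variable mu : {measure set (borel K) -> \bar R}.
Hypothesis hmu : is_haar mu.
Variable abs : K -> R.
Hypothesis habs : is_modulus mu abs.

Let abs_ge0 := modulus_ge0 hK hmu habs.
Let absM := modulusM hK hmu habs.
Let absX := modulusX hK hmu habs.
Let absV := modulusV hK hmu habs.
Let abs1 := modulus1 hK hmu habs.
Let abs0 := modulus0 habs.
Let abs_gt0 := modulus_gt0 hK hmu habs.

(** By the tube lemma the multiplications that map a compact neighbourhood of [0]
    into itself form a neighbourhood of [0], which is not reduced to [0]. *)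
Lemma contracting_compact : exists (V : set K) (r : K),
  [/\ compact V, nbhs (0 : K) V, r != 0, abs r < 1 &
      forall v, V v -> V (r * v)].
Proof.
have [V nV cV] := compact_nbhs0 hK.
have [U [oU U0] UV] : exists2 U : set K, open_nbhs 0 U & U `<=` V.
  by move: nV; rewrite nbhsE.
have W1 : \forall w \near (0 : K), forall v, V v -> U (w * v).
  by apply: mul_compact_near => // x _; rewrite mul0r.
have W2 : \forall w \near (0 : K), abs w < 1.
  by apply: (modulus_usc hK hmu habs); rewrite abs0.
have [r [r1 r2] r0] := nbhs0_nontrivial hK (filterI W1 W2).
by exists V, r; split => // v /r1 /UV.
Qed.

Section Contracting.
Variables (V : set K) (r : K).
Hypotheses (cV : compact V) (nV : nbhs (0 : K) V).
Hypotheses (r0 : r != 0) (r1 : abs r < 1) (rV : forall v, V v -> V (r * v)).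

Let rnV n v : V v -> V (r ^+ n * v).
Proof.
move=> Vv; elim: n => [|n IH]; first by rewrite expr0 mul1r.
by rewrite exprS -mulrA; exact: rV.
Qed.

Let absr_cvg (e : R) : 0 < e -> exists n, abs r ^+ n < e.
Proof.
move=> e0; have : (abs r ^+ n @[n --> \oo] --> 0).
  by apply: cvg_expr; rewrite ger0_norm ?abs_ge0.
by move=> /cvgr_lt/(_ _ e0)[n _ h]; exists n; exact: (h n (leqnn n)).
Qed.

(** The compact sets [r ^ n * V] decrease, and their intersection is [0]: if it
    contained [x != 0], the modulus would be unbounded on the points [r ^- n * x]
    of [V]. *)
Lemma contracting_base (U : set K) : nbhs (0 : K) U ->
  exists n, forall v, V v -> U (r ^+ n * v).
Proof.
move=> nU; apply/not_existsP => hn.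
have /choice[x_ hx] : forall n, exists v, V v /\ ~ U (r ^+ n * v).
  by move=> n; have /existsNP[v /not_implyP] := hn n; exists v.
pose y n := r ^+ n * x_ n.
have Vy n : V (y n) by apply: rnV; case: (hx n).
have [|x [Vx clx]] := cV (F := y @ \oo).
  by exists 0%N => // n _; exact: Vy.
have xm m : V (r ^- m * x).
  have rm0 : r ^+ m != 0 by rewrite expf_neq0.
  have cl : closed [set r ^+ m * v | v in V].
    apply: compact_closed; first exact: local_field_hausdorff.
    by apply: continuous_compact => //; exact/continuous_subspaceT/continuous_mull.
  suff [v Vv <-] : [set r ^+ m * v | v in V] x by rewrite mulKf.
  apply: cl => B nB; apply: clx nB.
  exists m => // n /= mn; exists (r ^+ (n - m) * x_ n).
    by apply: rnV; case: (hx n).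
  by rewrite mulrA -exprD subnKC.
have [M hM] := usc_bounded cV (fun x c _ => @modulus_usc _ _ hK _ hmu _ habs x c).
have x0 : x = 0.
  apply/eqP/negP => /negP x0; have ax := abs_gt0 x0.
  have M0 : 0 < M.
    by apply: lt_le_trans ax _; apply: hM.
  have [n hn'] := absr_cvg (divr_gt0 ax M0).
  have := hM _ (xm n); rewrite absM absV absX leNgt => /negP; apply.
  by rewrite mulrC ltr_pdivlMr ?exprn_gt0 ?abs_gt0// mulrC -ltr_pdivlMr.
have nUx : nbhs x U by rewrite x0.
have [z [/= nUz Uz]] : ~` U `&` U !=set0.
  by apply: clx nUx; exists 0%N => // n _; exact: (proj2 (hx n)).
exact: nUz Uz.
Qed.

(** Powers of [r] tend to [0], so every point is pushed into [V]; the last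
    power outside lands in the annulus [V \ r V], on which the modulus of the
    inverse is bounded because it is compact and avoids [0]. *)
Lemma integers_bounded : exists N, forall x, integers abs x ->
  exists2 v, V v & x = r ^- N * v.
Proof.
have to0 (x : K) : exists n, V (r ^+ n * x).
  have [v Vv v0] := nbhs0_nontrivial hK nV.
  have [|n hn] := @contracting_base ((fun w => w * (v^-1 * x)) @^-1` V).
    by apply: nbhs_preimage_mulr; rewrite mul0r.
  by exists n; move: (hn _ Vv); rewrite /= -mulrA mulVKf.
have nrV : nbhs (0 : K) [set r * v | v in V].
  rewrite image_mull//; apply: (@nbhs_preimage_mull _ r^-1 0 V).
  by rewrite mulr0.
have cA : compact (V `\` [set r * v | v in V]^°).
  apply: (subclosed_compact _ cV) => [|x []//].
  apply: closedI; first by apply: compact_closed => //; exact: local_field_hausdorff.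
  by apply: open_closedC; exact: open_interior.
have [|M hM] := usc_bounded (g := fun x => abs x^-1) cA.
  move=> x c [Vx Ax] xc; have x0 : x != 0.
    by apply: contra_notN Ax => /eqP ->; exact: nrV.
  exact: (@Defs.inv_continuous K x x0 _ (modulus_usc hK hmu habs xc)).
have M1 : 0 < (`|M| + 1)^-1 by rewrite invr_gt0 ltr_wpDl.
have [N hN] := absr_cvg M1.
exists N => x x1.
suff [n nN Vn] : exists2 n, (n <= N)%N & V (r ^+ n * x).
  exists (r ^+ (N - n) * (r ^+ n * x)); first exact: rnV.
  by rewrite mulrA -exprD subnK// mulKf// expf_neq0.
have /ex_minnP[n /asboolP Vn nmin] : exists n, `[< V (r ^+ n * x) >].
  by have [n Vn] := to0 x; exists n; exact/asboolP.
exists n => //; case: n Vn nmin => // n Vn nmin; rewrite ltnNge; apply/negP => Nn.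
have nV' : ~ V (r ^+ n * x).
  by move=> Vn'; have := nmin n (asboolT Vn'); rewrite ltnn.
have x0 : x != 0.
  apply/eqP => x0; apply: nV'; rewrite x0 mulr0; exact: nbhs_singleton nV.
have : abs (r ^+ n.+1 * x)^-1 <= M.
  apply: hM; split => // /interior_subset[v Vv].
  by rewrite exprS -mulrA => /(mulfI r0) e; apply: nV'; rewrite -e.
rewrite absV absM absX leNgt => /negP; apply.
have rn0 : 0 < abs r ^+ n.+1 * abs x by rewrite mulr_gt0 ?exprn_gt0 ?abs_gt0.
have : abs r ^+ n.+1 * abs x < (`|M| + 1)^-1.
  apply: le_lt_trans hN; rewrite -[leRHS]mulr1; apply: ler_pM => //.
    by rewrite exprn_ge0.
  by apply: ler_wiXn2l; rewrite ?abs_ge0 ?ltW// (leq_trans Nn).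
rewrite -[X in X < _]invrK ltf_pV2 ?posrE ?invr_gt0//.
by apply: le_lt_trans; rewrite (le_trans (ler_norm _))// lerDl.
Qed.

(** This bound is the constant of a quasi-triangle inequality. *)
Lemma one_plus_integers_bounded : exists B, forall x, integers abs x ->
  abs (1 + x) <= B.
Proof.
have [N hN] := integers_bounded.
have cY : compact [set r ^- N * v | v in V].
  by apply: continuous_compact => //; exact/continuous_subspaceT/continuous_mull.
have [|B hB] := usc_bounded (g := fun x => abs (1 + x)) cY.
  move=> x c _ xc.
  exact: (@continuous_addl K 1 x _ (modulus_usc hK hmu habs xc)).
by exists B => x /hN[v Vv ->]; apply: hB; exists v.
Qed.

End Contracting.

(** The topology is that of the modulus: small modulus forces [x] into a given
    neighbourhood of [0]. *)
Lemma integers_mulX_base (s : K) (U : set K) : abs s < 1 -> nbhs (0 : K) U ->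
  exists n, forall x, abs x <= abs s ^+ n -> U x.
Proof.
move=> s1 nU; have [V [r [cV nV r0 r1 rV]]] := contracting_compact.
have [N hN] := integers_bounded cV nV r0 r1 rV.
have [m hm] := contracting_base cV r0 r1 rV nU.
have : (abs s ^+ n @[n --> \oo] --> 0) by apply: cvg_expr; rewrite ger0_norm ?abs_ge0.
have rp : 0 < abs r ^+ (m + N) by rewrite exprn_gt0// abs_gt0.
move=> /cvgr_lt/(_ _ rp)[n _ /(_ n (leqnn n))/= hn]; exists n => x xn.
have [|v Vv xv] := hN (r ^- (m + N) * x).
  by rewrite /integers/= absM absV absX ler_pdivrMl// mulr1 (le_trans xn)// ltW.
suff -> : x = r ^+ m * v by exact: hm.
apply: (@mulfI _ (r ^- (m + N))); first by rewrite invr_neq0// expf_neq0.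
by rewrite xv exprD invfM mulrA [_ * r ^+ m]mulrAC mulVf ?expf_neq0// mul1r.
Qed.

Section Characteristic.
Variable p : nat.
Hypothesis hp : p \in [pchar K].

(** Frobenius turns the quasi-triangle inequality into the ultrametric one:
    raising to the power [p ^ n] and letting [n] grow removes the constant. *)
Lemma modulus_ultrametric x y M : abs x <= M -> abs y <= M -> abs (x + y) <= M.
Proof.
have [V [r [cV nV r0 r1 rV]]] := contracting_compact.
have [B hB] := one_plus_integers_bounded cV nV r0 r1 rV.
have B0 : 0 <= B.
  by apply: le_trans (hB 0 _); rewrite ?addr0 ?abs1// /integers/= abs0.
have quasi a b : abs b <= abs a -> abs (a + b) <= B * abs a.
  move=> ba; have [a0|a0] := eqVneq a 0.
    move: ba; rewrite a0 abs0 add0r mulr0; exact.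
  have -> : a + b = (1 + b / a) * a by rewrite mulrDl mul1r divfK.
  rewrite absM ler_wpM2r//; apply: hB; rewrite /integers/= absM absV.
  by rewrite ler_pdivrMr ?abs_gt0// mul1r.
wlog xy : x y / abs y <= abs x => [hw xM yM|xM _].
  have [h|/ltW h] := leP (abs y) (abs x); first exact: hw.
  by rewrite addrC; apply: hw.
apply: le_trans xM; have [x0|x0] := eqVneq x 0.
  by move: xy; rewrite x0 abs0 add0r; exact.
have ax := abs_gt0 x0.
have key n : (abs (x + y) / abs x) ^+ (p ^ n) <= B.
  rewrite exprMn exprVn ler_pdivrMr ?exprn_gt0// -!absX exprDn_pchar; last first.
    by rewrite pnatX (pnatE _ (pcharf_prime hp)) hp.
  apply: quasi; rewrite !absX ler_pXn2r ?nnegrE ?abs_ge0//.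
  by rewrite expn_gt0 prime_gt0 ?(pcharf_prime hp).
rewrite -[leRHS]mul1r -ler_pdivrMr// leNgt; apply/negP => rho1.
set rho := abs (x + y) / abs x in key rho1.
have [n] : exists n, B < rho ^+ (p ^ n).
  have : (rho^-1 ^+ n @[n --> \oo] --> 0).
    apply: cvg_expr; rewrite ger0_norm ?invr_ge0 ?(le_trans _ (ltW rho1))//.
    by rewrite invf_lt1// (lt_trans _ rho1).
  have B1 : 0 < (B + 1)^-1 by rewrite invr_gt0 ltr_wpDl.
  move=> /cvgr_lt/(_ _ B1)[n _ hn]; exists n.
  have := hn (p ^ n)%N (ltnW (ltn_expl _ (prime_gt1 (pcharf_prime hp)))).
  rewrite /= exprVn ltf_pV2 ?posrE ?ltr_wpDl ?exprn_gt0 ?(lt_trans _ rho1)//.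
  by apply: lt_trans; rewrite ltrDl.
by rewrite ltNge key.
Qed.

End Characteristic.
End Ultrametric.

(** * Digits and coset representatives *)

(** The standing assumptions on the field, bundled so that a single hypothesis
    carries them through the lemmas below. *)
Record local_field_setting (R : realType) (K : topologicalFieldType)
  (mu : {measure set (borel K) -> \bar R}) (abs : K -> R)
  (p c q : nat) (t : K) (eps : 'I_c -> K) (chi : K -> R[i]) : Prop := {
  st_local_field : is_local_field K ;
  st_char : p \in [pchar K] ;
  st_haar : is_haar mu ;
  st_modulus : is_modulus mu abs ;
  st_measure1 : mu (integers abs) = 1%E ;
  st_prime : is_prime_element abs t ;
  st_c : (0 < c)%N ;
  st_q : q = (p ^ c)%N ;
  st_residue : has_residue_field_GF abs q ;
  st_basis : is_GF_basis abs p eps ;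
  st_chi : is_basic_character p eps t chi
}.

Lemma digit_sum (p c : nat) (b : nat -> nat) : (0 < p)%N ->
  (forall i, b i < p)%N ->
  (\sum_(i < c) b i * p ^ i < p ^ c)%N /\
  forall k, (k < c)%N -> ((\sum_(i < c) b i * p ^ i) %/ p ^ k %% p = b k)%N.
Proof.
move=> p0; elim: c b => [|c IH] b bp; first by rewrite big_ord0.
have [IH1 IH2] := IH (fun i => b i.+1) (fun i => bp i.+1).
have E : (\sum_(i < c.+1) b i * p ^ i = b 0 + (\sum_(i < c) b i.+1 * p ^ i) * p)%N.
  rewrite big_ord_recl expn0 muln1 big_distrl/=; congr addn.
  by apply: eq_bigr => i _; rewrite /bump/= add1n expnSr mulnA.
rewrite E; split.
  rewrite expnSr; apply: (@leq_trans (p + (\sum_(i < c) b i.+1 * p ^ i) * p)).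
    by rewrite ltn_add2r.
  by rewrite -mulSn leq_pmul2r.
case=> [_|k]; first by rewrite expn0 divn1 addnC modnMDl modn_small.
rewrite ltnS => kc; rewrite expnS divnMA.
by rewrite addnC divnMDl// (divn_small (bp 0%N)) addn0 IH2.
Qed.

Section Digits.
Context {R : realType} {K : topologicalFieldType}.
Context {mu : {measure set (borel K) -> \bar R}} {abs : K -> R}.
Context {p c q : nat} {t : K} {eps : 'I_c -> K} {chi : K -> R[i]}.
Hypothesis S : local_field_setting mu abs p q t eps chi.

Let hK := st_local_field S.
Let hmu := st_haar S.
Let habs := st_modulus S.

Local Notation D := (integers abs).

Lemma abs_ge0 x : 0 <= abs x. Proof. exact: (modulus_ge0 hK hmu habs). Qed.
Lemma absM x y : abs (x * y) = abs x * abs y.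
Proof. exact: (modulusM hK hmu habs). Qed.
Lemma absX x n : abs (x ^+ n) = abs x ^+ n.
Proof. exact: (modulusX hK hmu habs). Qed.
Lemma absV x : abs x^-1 = (abs x)^-1.
Proof. exact: (modulusV hK hmu habs). Qed.
Lemma abs1 : abs 1 = 1. Proof. exact: (modulus1 hK hmu habs). Qed.
Lemma abs0 : abs 0 = 0. Proof. exact: modulus0 habs. Qed.
Lemma abs_gt0 x : x != 0 -> 0 < abs x.
Proof. exact: (modulus_gt0 hK hmu habs). Qed.
Lemma absD x y M : abs x <= M -> abs y <= M -> abs (x + y) <= M.
Proof. exact: (modulus_ultrametric hK hmu habs (st_char S)). Qed.
Lemma absN x : abs (- x) = abs x.
Proof.
have h : abs (-1) = 1.
  apply/eqP; rewrite -(@pexpr_eq1 _ _ 2) ?abs_ge0// -absX sqrrN expr1n.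
  by rewrite abs1.
by rewrite -mulN1r absM h mul1r.
Qed.
Lemma absB x y M : abs x <= M -> abs y <= M -> abs (x - y) <= M.
Proof. by move=> xM yM; apply: absD; rewrite ?absN. Qed.

Lemma integers0 : D 0. Proof. by rewrite /integers/= abs0. Qed.
Lemma integersD x y : D x -> D y -> D (x + y). Proof. exact: absD. Qed.
Lemma integersB x y : D x -> D y -> D (x - y). Proof. exact: absB. Qed.
Lemma integersM x y : D x -> D y -> D (x * y).
Proof. by rewrite /integers/= absM => x1 y1; rewrite mulr_ile1 ?abs_ge0. Qed.

(** If the prime element were [0], so would be the maximal ideal, which is a
    neighbourhood of [0]. *)
Lemma t_neq0 : t != 0.
Proof.
have n0 : nbhs (0 : K) [set x | abs x < 1].
  by apply: (modulus_usc hK hmu habs); rewrite abs0.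
have [x x1 x0] := nbhs0_nontrivial hK n0.
apply/eqP => t0; have := proj2 (st_prime S) x x1.
by rewrite t0 abs0 leNgt abs_gt0.
Qed.

Lemma abst_lt1 : abs t < 1. Proof. by case: (st_prime S). Qed.
Lemma abst_gt0 : 0 < abs t. Proof. exact: abs_gt0 t_neq0. Qed.
Lemma abs_lt1 x : abs x < 1 -> abs x <= abs t.
Proof. by move=> x1; apply: (proj2 (st_prime S)). Qed.

Lemma integers_mult x : D (t * x) = (abs x <= (abs t)^-1) :> Prop.
Proof. by rewrite /integers/= absM -ler_pdivlMl ?abst_gt0// mulr1. Qed.

Lemma integers_divt x : D (x / t) <-> abs x < 1.
Proof.
rewrite /integers/= absM absV ler_pdivrMr ?abst_gt0// mul1r; split.
  by move=> h; exact: le_lt_trans abst_lt1.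
exact: abs_lt1.
Qed.

Lemma open_integers : open D.
Proof.
have -> : D = (fun x => t * x) @^-1` [set x | abs x < 1].
  by apply/seteqP; split=> x /=;
    rewrite -integers_divt mulrC mulKf ?t_neq0.
by apply: open_preimage_mull; exact: (open_modulus_lt hK hmu habs).
Qed.

Lemma measurable_integers : measurable (D : set (borel K)).
Proof. by apply: measurable_open; exact: open_integers. Qed.

Lemma prime_p : prime p. Proof. exact: pcharf_prime (st_char S). Qed.
Lemma q_gt1 : (1 < q)%N.
Proof. by rewrite (st_q S) -(exp1n c) ltn_exp2r ?prime_gt1 ?prime_p ?(st_c S). Qed.
Lemma q_gt0 : (0 < q)%N. Proof. exact: ltnW q_gt1. Qed.

Definition digit (n : nat) : K := \sum_(k < c) (n %/ p ^ k %% p)%:R * eps k.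

Lemma u_digitE n : u_digit p eps t n = digit n / t. Proof. by []. Qed.

Lemma digit0 : digit 0 = 0.
Proof. by rewrite /digit big1// => k _; rewrite div0n mod0n mul0r. Qed.

Lemma natr_modp n : (n %% p)%:R = n%:R :> K.
Proof.
by rewrite [in RHS](divn_eq n p) natrD natrM (pcharf0 (st_char S)) mulr0 add0r.
Qed.

(** The [q] digits exhaust the [GF(p)]-span of the [eps k], a field with [q]
    elements, so by counting they do not repeat. *)
Lemma digits_subfield : exists (k : finFieldType) (f : {rmorphism k -> K})
    (g : 'I_q -> k), [/\ #|k| = q, bijective g &
      (forall n : 'I_q, digit n = f (g n)) /\ forall n, exists z, digit n = f z].
Proof.
have [_ _ [k [f [ck rf]]]] := st_basis S; rewrite -(st_q S) in ck.
have dig n : exists z, digit n = f z.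
  have : (range f) (digit n).
    by rewrite rf; exists (fun i : 'I_c => (n %/ p ^ i %% p)%N).
  by case=> z _ <-; exists z.
have p0 : (0 < p)%N by rewrite prime_gt0// prime_p.
have /choice[g hg] : forall n : 'I_q, exists z, digit n = f z by move=> n; exact: dig.
exists k, f, g; split => //.
have surj z : z \in codom g.
  have : (range f) (f z) by exists z.
  rewrite rf => -[a _ ha].
  pose b i := ((if insub i is Some j then a j else 0) %% p)%N.
  have bp i : (b i < p)%N by rewrite ltn_mod.
  have [nq nk] := digit_sum c p0 bp; rewrite -(st_q S) in nq.
  apply/codomP; exists (Ordinal nq); apply: (fmorph_inj f); rewrite -hg -ha.
  apply: eq_bigr => i _ /=; rewrite nk// /b insubT//= => ic.
  by rewrite natr_modp; congr (_%:R * _); congr a; exact: val_inj.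
apply: inj_card_bij; last by rewrite ck card_ord.
apply/injectiveP/card_uniqP; rewrite size_map -cardE card_ord.
rewrite -[in RHS]ck; apply: eq_card => z; rewrite [RHS]inE.
by have := surj z; rewrite /codom /image_mem.
Qed.

End Digits.

Arguments digit {K} p {c} eps n.
Arguments digit0 {K} p {c} eps.

Section Representatives.
Context {R : realType} {K : topologicalFieldType}.
Context {mu : {measure set (borel K) -> \bar R}} {abs : K -> R}.
Context {p c q : nat} {t : K} {eps : 'I_c -> K} {chi : K -> R[i]}.
Hypothesis S : local_field_setting mu abs p q t eps chi.

Local Notation D := (integers abs).
Local Notation s := (digit p eps).
Local Notation u := (u p eps t).

(** A nonzero element of a finite field has finite multiplicative order, hence
    modulus one. *)
Lemma abs_digitB (n m : 'I_q) : n != m -> abs (s n - s m) = 1.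
Proof.
have [k [f [g [ck bg [hg _]]]]] := digits_subfield S => nm.
rewrite !hg -rmorphB; set z := g n - g m.
have z0 : z != 0 by rewrite subr_eq0 (bij_eq bg).
have fz0 : f z != 0 by rewrite fmorph_eq0.
have : abs (f z) ^+ q = abs (f z) by rewrite -(absX S) -rmorphXn/= -ck expf_card.
have afz := abs_gt0 S fz0.
rewrite -(prednK (q_gt0 S)) exprS => /(congr1 (fun x => (abs (f z))^-1 * x)).
rewrite mulKf ?gt_eqF// mulVf ?gt_eqF// => /eqP.
have q1 : (0 < q.-1)%N by rewrite -subn1 subn_gt0 (q_gt1 S).
by rewrite pexpr_eq1 ?(abs_ge0 S)// => /eqP.
Qed.

Lemma digitB n m : exists2 k : nat, (k < q)%N & s n - s m = s k.
Proof.
have [k [f [g [ck bg [hg hd]]]]] := digits_subfield S.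
have [z1 ->] := hd n; have [z2 ->] := hd m.
have [g' gK g'K] := bg; exists (g' (z1 - z2)); first exact: ltn_ord.
by rewrite hg g'K rmorphB.
Qed.

Lemma digitM n m : exists2 k : nat, (k < q)%N & s n * s m = s k.
Proof.
have [k [f [g [ck bg [hg hd]]]]] := digits_subfield S.
have [z1 ->] := hd n; have [z2 ->] := hd m.
have [g' gK g'K] := bg; exists (g' (z1 * z2)); first exact: ltn_ord.
by rewrite hg g'K rmorphM.
Qed.

Lemma digit_integer n : D (s n).
Proof.
have [k kq] := digitB n 0; rewrite (digit0 p eps) subr0 => ->.
have q0 := q_gt0 S.
have [->|k0] := eqVneq k 0%N; first by rewrite (digit0 p eps); exact: (integers0 S).
rewrite /integers/= -[s k]subr0 -(digit0 p eps).
by rewrite (@abs_digitB (Ordinal kq) (Ordinal q0)).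
Qed.

Lemma digit_residue_inj n m : (n < q)%N -> (m < q)%N ->
  abs (s n - s m) < 1 -> n = m.
Proof.
move=> nq mq; apply: contraTeq => nm.
by rewrite (@abs_digitB (Ordinal nq) (Ordinal mq))// ltxx.
Qed.

(** Distinct digits have distinct residues, so by counting every residue is
    that of a digit. *)
Lemma digit_cover x : D x -> exists2 n : nat, (n < q)%N & abs (x - s n) < 1.
Proof.
move=> Dx; have [k [r [ck [r1 rD rM rsurj r0]]]] := st_residue S.
have rB y z : D y -> D z -> r y = r z -> abs (y - z) < 1.
  move=> Dy Dz yz; have Dyz := integersB S Dy Dz.
  apply/(r0 _ Dyz); have := rD _ _ Dyz Dz.
  by rewrite subrK yz => /eqP; rewrite -subr_eq subrr eq_sym => /eqP.
have rinj : injective (fun n : 'I_q => r (s n)).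
  move=> n m /(rB _ _ (digit_integer n) (digit_integer m)) h.
  by apply: contraTeq h => nm; rewrite abs_digitB// ltxx.
have kq : (#|k| <= #|'I_q|)%N by rewrite ck card_ord.
have [g gK Kg] := inj_card_bij rinj kq.
exists (g (r x)); first exact: ltn_ord.
apply: rB Dx (digit_integer _) _.
exact: (esym (Kg (r x))).
Qed.

Lemma u_widen n N : (n < N)%N ->
  u n = \sum_(k < N) u_digit p eps t (n %/ q ^ k %% q) * t ^- k.
Proof.
move=> nN; rewrite /Defs.u -(st_q S) -!(big_mkord xpredT
  (fun k => u_digit p eps t (n %/ q ^ k %% q) * t ^- k)).
rewrite [RHS](big_cat_nat _ (n := n.+1))//= [X in _ = _ + X]big_nat_cond.
rewrite [X in _ = _ + X]big1 ?addr0// => k /andP[/andP[nk _] _].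
rewrite divn_small ?mod0n ?u_digitE ?(digit0 p eps) ?mul0r//.
by apply: ltn_trans nk _; exact: ltn_expl (q_gt1 S).
Qed.

(** Peels off the lowest digit; the properties of [u] follow by induction on the
    number of digits. *)
Lemma u_rec n : u n = s (n %% q) / t + t^-1 * u (n %/ q).
Proof.
have [->|n0] := posnP n.
  have u0 : u 0 = 0.
    by rewrite (u_widen (ltnSn 0)) big_ord1 div0n mod0n u_digitE (digit0 p eps) !mul0r.
  by rewrite mod0n div0n u0 (digit0 p eps) mul0r mulr0 addr0.
rewrite [LHS](u_widen (ltnSn n)) big_ord_recl/= expn0 divn1 expr0 invr1 mulr1.
congr +%R.
have nq : (n %/ q < n)%N by rewrite ltn_Pdiv// (q_gt1 S).
rewrite (u_widen nq) mulr_sumr; apply: eq_bigr => k _.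
by rewrite /bump/= add1n expnS divnMA exprS invfM mulrCA.
Qed.

Lemma u0 : u 0 = 0.
Proof. by rewrite (u_widen (ltnSn 0)) big_ord1 div0n mod0n u_digitE (digit0 p eps) !mul0r. Qed.

Lemma u_addmul r n : (r < q)%N -> u (r + q * n) = s r / t + t^-1 * u n.
Proof.
move=> rq; rewrite u_rec addnC mulnC modnMDl modn_small//.
by rewrite divnMDl ?(q_gt0 S)// divn_small// addn0.
Qed.

Lemma u_small r : (r < q)%N -> u r = s r / t.
Proof. by move=> rq; have := u_addmul 0 rq; rewrite muln0 addn0 u0 mulr0 addr0. Qed.

Lemma u_mul n : u (q * n) = t^-1 * u n.
Proof. by have := u_addmul n (q_gt0 S); rewrite add0n (digit0 p eps) mul0r add0r. Qed.

Lemma u_split r n : (r < q)%N -> u (r + q * n) = u r + t^-1 * u n.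
Proof. move=> rq; rewrite (u_addmul n rq).
by rewrite (u_small rq). Qed.

Let divq N n : (n < q ^ N.+1)%N -> (n %/ q < q ^ N)%N.
Proof. by move=> h; rewrite ltn_divLR ?(q_gt0 S)// -expnSr. Qed.

Let addq N r n : (r < q)%N -> (n < q ^ N)%N -> (r + q * n < q ^ N.+1)%N.
Proof.
move=> rq nN; rewrite expnS; apply: (@leq_trans (q + q * n)); first by rewrite ltn_add2r.
by rewrite -mulnS leq_mul2l nN orbT.
Qed.

Lemma u_subN N n m : (n < q ^ N)%N -> (m < q ^ N)%N ->
  exists2 k, (k < q ^ N)%N & u n - u m = u k.
Proof.
elim: N n m => [|N IH] n m.
  by rewrite expn0 !ltnS !leqn0 => /eqP -> /eqP ->; exists 0%N; rewrite ?u0 ?subr0.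
move=> /divq nN /divq mN; have [k kN hk] := IH _ _ nN mN.
have [a aq ha] := digitB (n %% q) (m %% q).
exists (a + q * k)%N; first exact: addq.
by rewrite u_addmul// -hk -ha [u n]u_rec [u m]u_rec; ring.
Qed.

Let expq n : (n < q ^ n)%N. Proof. exact: ltn_expl (q_gt1 S). Qed.

Lemma u_sub n m : exists k, u n - u m = u k.
Proof.
have nm a b : (a < q ^ (a + b))%N.
  by apply: leq_trans (expq a) _; rewrite leq_exp2l ?(q_gt1 S)// leq_addr.
have [k _ ->] := u_subN (nm n m) (eq_ind_r (fun k => m < q ^ k)%N (nm m n) (addnC n m)).
by exists k.
Qed.

Lemma u_opp n : exists k, - u n = u k.
Proof. by have [k hk] := u_sub 0 n; exists k; rewrite -hk u0 sub0r. Qed.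

Lemma u_add n m : exists k, u n + u m = u k.
Proof.
have [m' hm] := u_opp m; have [k hk] := u_sub n m'.
by exists k; rewrite -hk -hm opprK.
Qed.

(** Multiplied by [t], the hypothesis says that the higher digits agree; the lowest
    ones then differ by an element of the maximal ideal. *)
Lemma u_coset_inj n m : D (u n - u m) -> n = m.
Proof.
have [N nN mN] : exists2 N, (n < q ^ N)%N & (m < q ^ N)%N.
  exists (n + m)%N.
    by apply: leq_trans (expq n) _; rewrite leq_exp2l ?(q_gt1 S)// leq_addr.
  by apply: leq_trans (expq m) _; rewrite leq_exp2l ?(q_gt1 S)// leq_addl.
elim: N n m nN mN => [|N IH] n m.
  by rewrite expn0 !ltnS !leqn0 => /eqP -> /eqP ->.
move=> /divq nN /divq mN Dnm.
set a := (n %% q)%N; set b := (m %% q)%N.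
have E : u n - u m = (s a - s b) / t + t^-1 * (u (n %/ q) - u (m %/ q)).
  by rewrite [u n]u_rec [u m]u_rec -/a -/b; ring.
have quo : (n %/ q = m %/ q)%N.
  apply: IH => //.
  have -> : u (n %/ q) - u (m %/ q) = t * (u n - u m) - (s a - s b).
    by rewrite E; field; exact: t_neq0 S.
  apply: (integersB S); last by apply: (integersB S); exact: digit_integer.
  by apply: (integersM S) => //; exact/ltW/(abst_lt1 S).
rewrite (divn_eq n q) (divn_eq m q) quo; congr addn.
apply: digit_residue_inj; rewrite ?ltn_mod ?(q_gt0 S)//.
by apply/(integers_divt S); move: Dnm; rewrite E quo subrr mulr0 addr0.
Qed.

Lemma u_inj : injective u.
Proof. by move=> n m h; apply: u_coset_inj; rewrite h subrr; exact: integers0 S. Qed.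

Lemma u_cover N x : abs x <= (abs t)^-1 ^+ N ->
  exists2 n, (n < q ^ N)%N & D (x - u n).
Proof.
elim: N x => [|N IH] x.
  by rewrite expr0 => x1; exists 0%N => //; rewrite u0 subr0.
rewrite exprS => xN.
have [n nN Dn] : exists2 n, (n < q ^ N)%N & D (t * x - u n).
  by apply: IH; rewrite (absM S) -ler_pdivlMl// (abst_gt0 S).
have [a aq ha] := digit_cover Dn; exists (a + q * n)%N; first exact: addq.
rewrite u_addmul//; have -> : x - (s a / t + t^-1 * u n) = (t * x - u n - s a) / t.
  by field; exact: t_neq0 S.
exact/(integers_divt S).
Qed.

Lemma abs_boundX x : exists N, abs x <= (abs t)^-1 ^+ N.
Proof.
have t1 : 0 < (abs x + 1)^-1 by rewrite invr_gt0 ltr_wpDl ?(abs_ge0 S).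
have : (abs t ^+ n @[n --> \oo] --> 0).
  by apply: cvg_expr; rewrite ger0_norm ?(abs_ge0 S)// (abst_lt1 S).
move=> /cvgr_lt/(_ _ t1)[N _ /(_ N (leqnn N))/= h]; exists N.
rewrite exprVn -[leLHS]invrK.
have [x0|x0] := eqVneq (abs x) 0.
  by rewrite x0 invr0 invr0 invr_ge0 exprn_ge0 ?(abs_ge0 S).
have ax : 0 < abs x by rewrite lt0r x0 (abs_ge0 S).
rewrite lef_pV2 ?posrE ?invr_gt0 ?exprn_gt0 ?(abst_gt0 S)//.
by apply/ltW/(lt_le_trans h); rewrite lef_pV2 ?posrE ?ltr_wpDl ?(abs_ge0 S)// lerDl.
Qed.

Lemma u_coverT x : exists n, D (x - u n).
Proof. by have [N /u_cover[n _ Dn]] := abs_boundX x; exists n. Qed.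

Lemma abs_u N n : (n < q ^ N)%N -> abs (u n) <= (abs t)^-1 ^+ N.
Proof.
elim: N n => [|N IH] n.
  by rewrite expn0 ltnS leqn0 => /eqP ->; rewrite u0 (abs0 S) expr0.
have ti : 1 <= (abs t)^-1 by rewrite invf_ge1 ?(abst_gt0 S)// ltW// (abst_lt1 S).
move=> /divq/IH h; rewrite u_rec; apply: (absD S).
  rewrite (absM S) (absV S) exprS mulrC.
  have := digit_integer (n %% q); rewrite /integers/= => s1.
  have t0 : 0 <= (abs t)^-1 by rewrite invr_ge0 ltW// (abst_gt0 S).
  rewrite ler_wpM2l//.
  by rewrite (le_trans s1)// exprn_ege1.
by rewrite (absM S) (absV S) exprS ler_wpM2l// invr_ge0 ltW// (abst_gt0 S).
Qed.

Lemma measure_integersM (a : K) : a != 0 -> mu [set a * x | x in D] = (abs a)%:E.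
Proof.
move=> a0; rewrite (proj2 (st_modulus S))//; last exact: measurable_integers S.
by rewrite (st_measure1 S) mule1.
Qed.

(** The [q] residue classes of [D] are translates of [t * D]. *)
Lemma abs_t : abs t = q%:R^-1.
Proof.
pose F (n : 'I_q) : set (borel K) := (fun x => - s n + x) @^-1` [set t * x | x in D].
have FE (n : 'I_q) x : F n x <-> abs (x - s n) < 1.
  rewrite /F image_mull ?(t_neq0 S)//= mulrC [- s n + x]addrC; exact: integers_divt S _.
have mtD : measurable ([set t * x | x in D] : set (borel K)).
  rewrite image_mull ?(t_neq0 S)//; apply: measurable_preimage_mull.
  exact: measurable_integers S.
have mF n : measurable (F n) by exact: measurable_preimage_addl.
have muF n : mu (F n) = (abs t)%:E.
  rewrite -(measure_integersM (t_neq0 S)).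
  exact: (haar_preimage_addl (st_haar S)).
have DF : D = \big[setU/set0]_(n < q) F n.
  apply/seteqP; split=> x.
    move=> /digit_cover[n nq xn]; rewrite (bigD1 (Ordinal nq))//=; left.
    exact/FE.
  elim/big_ind : _ => [//|A B hA hB [/hA|/hB]//|n _ /FE /ltW xn].
  rewrite -[x](subrK (s n)); apply: (integersD S) => //; exact: digit_integer.
have := st_measure1 S; rewrite DF measure_bigsetU_ord//.
  rewrite (eq_bigr _ (fun n _ => muF n)).
  rewrite sumEFin sumr_const card_ord => -[qt].
  have q0 : q%:R != 0 :> R by rewrite pnatr_eq0 -lt0n (q_gt0 S).
  by apply: (mulfI q0); rewrite divff// mulr_natl.
move=> n m _ _ [x [/FE xn /FE xm]]; apply: val_inj; apply: (@digit_residue_inj n m) => //.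
have -> : s n - s m = (x - s m) - (x - s n) by ring.
by apply: le_lt_trans (abst_lt1 S); apply: (absB S); exact: abs_lt1 S _ _.
Qed.

End Representatives.

(** * Affine changes of variables and the character *)

Section Affine.
Context {R : realType} {K : topologicalFieldType}.
Context {mu : {measure set (borel K) -> \bar R}} {abs : K -> R}.
Context {p c q : nat} {t : K} {eps : 'I_c -> K} {chi : K -> R[i]}.
Hypothesis S : local_field_setting mu abs p q t eps chi.

Definition affine (a b x : K) : K := a * x + b.

Lemma measurable_affine a b :
  measurable_fun [set: borel K] (affine a b : borel K -> borel K).
Proof.
apply: measurable_continuous => x; apply: (@continuous_comp K K K (fun x => a * x)
  (fun x => x + b)); first exact: continuous_mull.
rewrite (_ : (fun x => x + b) = (fun x => b + x)); first exact: continuous_addl.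
by apply/funext => y; rewrite addrC.
Qed.

Lemma measurable_preimage_affine a b (A : set (borel K)) : measurable A ->
  measurable (affine a b @^-1` A : set (borel K)).
Proof. by move=> mA; rewrite -[X in measurable X]setTI; exact: measurable_affine. Qed.

Lemma measure_preimage_affine a b (A : set (borel K)) : a != 0 ->
  measurable A -> mu (affine a b @^-1` A) = ((abs a)^-1%:E * mu A)%E.
Proof.
move=> a0 mA; rewrite -(haar_preimage_addl (st_haar S) b mA).
have mB : measurable ((fun x => b + x) @^-1` A : set (borel K)).
  exact: measurable_preimage_addl.
rewrite -(absV S) -(proj2 (st_modulus S)) ?invr_neq0// image_mull ?invr_neq0// invrK.
by congr (mu _); apply/seteqP; split=> x; rewrite /affine/= addrC.
Qed.

Lemma ge0_integral_affine a b (f : K -> \bar R) : a != 0 ->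
  measurable_fun [set: borel K] f -> (forall x, (0 <= f x)%E) ->
  (\int[mu]_x f (affine a b x) = (abs a)^-1%:E * \int[mu]_x f x)%E.
Proof.
move=> a0 mf f0.
have := ge0_integral_pushforward (measurable_affine a b) mu measurableT mf
  (fun x _ => f0 x).
rewrite preimage_setT => <-.
have k0 : 0 <= (abs a)^-1 by rewrite invr_ge0 (abs_ge0 S).
rewrite -(ge0_integral_mscale mu measurableT (NngNum k0) mf)//.
apply: eq_measure_integral; first exact: measurable_affine.

move=> ? A mA _.
exact: measure_preimage_affine.
Qed.

Lemma ae_affine a b (P : K -> Prop) : a != 0 ->
  {ae mu, forall x, P x} -> {ae mu, forall x, P (affine a b x)}.
Proof.
move=> a0 [N [mN N0 sN]]; exists (affine a b @^-1` N); split.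
- exact: measurable_preimage_affine.
- by rewrite measure_preimage_affine// N0 mule0.
- by move=> x /= nP; apply: sN.
Qed.

Lemma cmeasurable_affine a b (f : K -> R[i]) :
  cmeasurable (f : borel K -> R[i]) ->
  cmeasurable (fun x : borel K => f (affine a b x)).
Proof.
by move=> [f1 f2]; split; [apply: (measurableT_comp f1)|apply: (measurableT_comp f2)];
  exact: measurable_affine.
Qed.

Lemma esqnorm_affine a b (f : K -> R[i]) : a != 0 ->
  cmeasurable (f : borel K -> R[i]) ->
  esqnorm mu (fun x => f (affine a b x)) = ((abs a)^-1%:E * esqnorm mu f)%E.
Proof.
move=> a0 mf; apply: (ge0_integral_affine b a0 (f := fun x => (sqabs (f x))%:E)).
  exact/measurable_EFinP/measurable_sqabs.
by move=> x; rewrite lee_fin sqabs_ge0.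
Qed.

Lemma cLp2_affine a b (f : K -> R[i]) : a != 0 -> cLp mu 2%:E f ->
  cLp mu 2%:E (fun x => f (affine a b x)).
Proof.
move=> a0 /cLp2P[mf f2]; apply/cLp2P; split; first exact: cmeasurable_affine.
rewrite esqnorm_affine//; apply: lte_mul_pinfty => //.
by rewrite lee_fin invr_ge0 (abs_ge0 S).
Qed.

Lemma sqnorm_affine a b (f : K -> R[i]) : a != 0 -> cLp mu 2%:E f ->
  sqnorm mu (fun x => f (affine a b x)) = (abs a)^-1 * sqnorm mu f.
Proof.
move=> a0 Lf; rewrite /sqnorm esqnorm_affine//; last exact: cLp2_measurable Lf.
by rewrite (sqnormE Lf).
Qed.

Lemma integrable_affine a b (f : K -> R) : a != 0 ->
  mu.-integrable [set: borel K] (EFin \o f) ->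
  mu.-integrable [set: borel K] (EFin \o (fun x => f (affine a b x))) /\
  \int[mu]_x f (affine a b x) = (abs a)^-1 * \int[mu]_x f x.
Proof.
move=> a0 intf; have mf := measurable_int _ intf.
have mfa : measurable_fun [set: borel K] (EFin \o (fun x => f (affine a b x))).
  by apply: (measurableT_comp mf); exact: measurable_affine.
have int_a g : measurable_fun [set: borel K] g -> (forall x, (0 <= g x)%E) ->
    (\int[mu]_x g (affine a b x) = (abs a)^-1%:E * \int[mu]_x g x)%E.
  exact: ge0_integral_affine.
split.
  apply/integrableP; split=> //.
  rewrite (int_a (fun x => `|(f x)%:E|)%E)//; last exact: measurableT_comp.
  apply: lte_mul_pinfty => //; first by rewrite lee_fin invr_ge0 (abs_ge0 S).
  by case/integrableP : intf.
rewrite /Rintegral integralE.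
have -> : (\int[mu]_x (EFin \o (fun x => f (affine a b x)))^\+ x =
    (abs a)^-1%:E * \int[mu]_x (EFin \o f)^\+ x)%E.
  rewrite -(int_a _ (measurable_funepos mf)); last by move=> x; exact: funepos_ge0.
  by apply: eq_integral => x _; rewrite !funeposE.
have -> : (\int[mu]_x (EFin \o (fun x => f (affine a b x)))^\- x =
    (abs a)^-1%:E * \int[mu]_x (EFin \o f)^\- x)%E.
  rewrite -(int_a _ (measurable_funeneg mf)); last by move=> x; exact: funeneg_ge0.
  by apply: eq_integral => x _; rewrite !funenegE.
have fp := integrable_pos_fin_num measurableT intf.
have fn := integrable_neg_fin_num measurableT intf.
rewrite -muleBr//; last by rewrite fin_num_adde_defr.
rewrite fineM//=; last by rewrite fin_numB; exact/andP.
congr (_ * fine _).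
by rewrite [RHS]integralE.
Qed.

Lemma cintegrable_affine a b (f : K -> R[i]) : a != 0 -> cintegrable mu f ->
  cintegrable mu (fun x => f (affine a b x)).
Proof.
move=> a0 [f1 f2]; split.
  exact: (proj1 (integrable_affine b a0 f1)).
exact: (proj1 (integrable_affine b a0 f2)).
Qed.

Lemma cintegral_affine a b (f : K -> R[i]) : a != 0 -> cintegrable mu f ->
  cintegral mu (fun x => f (affine a b x)) = (abs a)^-1%:C * cintegral mu f.
Proof.
move=> a0 [f1 f2]; apply: complexP; rewrite (ReM, ImM) ReC ImC mul0r ?subr0 ?addr0.
  exact: (proj2 (integrable_affine b a0 f1)).
exact: (proj2 (integrable_affine b a0 f2)).
Qed.

End Affine.

Section Character.
Context {R : realType} {K : topologicalFieldType}.
Context {mu : {measure set (borel K) -> \bar R}} {abs : K -> R}.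
Context {p c q : nat} {t : K} {eps : 'I_c -> K} {chi : K -> R[i]}.
Hypothesis S : local_field_setting mu abs p q t eps chi.

Local Notation D := (integers abs).
Local Notation s := (digit p eps).
Local Notation u := (u p eps t).

Lemma chiD x y : chi (x + y) = chi x * chi y.
Proof. exact: basic_characterD (st_chi S) x y. Qed.

Lemma sqabs_chi x : sqabs (chi x) = 1.
Proof. by rewrite -sqabs_normc (basic_character_unitary (st_chi S)) expr1n. Qed.

Lemma chi0 : chi 0 = 1.
Proof.
have c0 : chi 0 != 0.
  by apply/eqP => z; have := sqabs_chi 0; rewrite z sqabs0 => /eqP; rewrite eq_sym oner_eq0.
by apply: (mulfI c0); rewrite mulr1 -chiD addr0.
Qed.

Lemma chiN x : chi (- x) = (chi x)^*%C.
Proof.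
have c0 : chi x != 0.
  by apply/eqP => z; have := sqabs_chi x; rewrite z sqabs0 => /eqP; rewrite eq_sym oner_eq0.
by apply: (mulfI c0); rewrite -chiD subrr chi0 mul_conjc sqabs_chi.
Qed.

Lemma chiB x y : chi (x - y) = chi x * (chi y)^*%C.
Proof. by rewrite chiD chiN. Qed.

Lemma chi_sum1 (I : Type) (r : seq I) (P : pred I) (f : I -> K) :
  (forall i, P i -> chi (f i) = 1) -> chi (\sum_(i <- r | P i) f i) = 1.
Proof.
move=> h; elim/big_ind : _ => //; first exact: chi0.
by move=> x y hx hy; rewrite chiD hx hy mulr1.
Qed.

Lemma chi_mulr_nat x n : chi x = 1 -> chi (n%:R * x) = 1.
Proof.
move=> h; elim: n => [|n IH]; first by rewrite mul0r chi0.
by rewrite -addn1 natrD mulrDl mul1r chiD IH h mulr1.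
Qed.

Lemma chi_digit n (j : int) : j != 1 -> chi (s n * t ^ (- j)) = 1.
Proof.
move=> j1; rewrite /digit mulr_suml; apply: chi_sum1 => k _.
rewrite -mulrA; apply: chi_mulr_nat.
by rewrite (basic_characterE (st_chi S)) (negbTE j1) andbF.
Qed.

Lemma chi_digit_pos n j : chi (s n * t ^+ j) = 1.
Proof. by have := @chi_digit n (- j%:Z); rewrite opprK; apply; case: j. Qed.

Lemma chi_digit_neg n j : chi (s n * t ^- j.+2) = 1.
Proof. exact: (@chi_digit n j.+2). Qed.

(** Elements of [D] are limits of finite digit expansions with nonnegative powers
    of [t], on which [chi] is trivial. *)
Lemma chi_integer x : D x -> chi x = 1.
Proof.
move=> Dx.
have approx N : exists2 y, chi y = 1 & abs (x - y) <= abs t ^+ N.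
  elim: N => [|N [y y1 yN]]; first by exists 0; rewrite ?chi0// subr0 expr0.
  have tN : t ^+ N != 0 by rewrite expf_neq0 ?(t_neq0 S).
  have aN : 0 < abs t ^+ N by rewrite exprn_gt0 ?(abst_gt0 S).
  have Dy : D ((x - y) / t ^+ N).
    by rewrite /integers/= (absM S) (absV S) (absX S) ler_pdivrMr// mul1r.
  have [a _ /(abs_lt1 S) ha] := digit_cover S Dy.
  exists (y + s a * t ^+ N); first by rewrite chiD y1 chi_digit_pos mulr1.
  have -> : x - (y + s a * t ^+ N) = ((x - y) / t ^+ N - s a) * t ^+ N by field.
  by rewrite (absM S) (absX S) exprS ler_wpM2r// ltW.
have eq_lim (g : K -> R) : continuous g ->
    (forall y z, chi y = 1 -> g (y + z) = g z) -> g x = g 0.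
  move=> cg gy; apply/eqP; rewrite -subr_eq0 -normr_le0 leNgt; apply/negP => e0.
  have /cvgrPdist_lt/(_ _ e0) near0 := cg 0.
  have [n hn] := integers_mulX_base (st_local_field S) (st_haar S) (st_modulus S)
    (abst_lt1 S) near0.
  have [y y1 yn] := approx n; have := hn _ yn.
  by rewrite -(gy y (x - y) y1) [y + _]addrC subrK distrC ltxx.
have chiy y z : chi y = 1 -> chi (y + z) = chi z by move=> h; rewrite chiD h mul1r.
apply: complexP; rewrite -chi0.
  apply: (eq_lim (fun z => complex.Re (chi z))).
    exact: basic_character_continuous_Re (st_chi S).
  by move=> y z /chiy ->.
apply: (eq_lim (fun z => complex.Im (chi z))).
  exact: basic_character_continuous_Im (st_chi S).
by move=> y z /chiy ->.
Qed.

(** The digits are closed under multiplication and the product only involves the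
    powers [t ^- j] with [j >= 2]. *)
Lemma chi_uu n m : chi (u n * u m) = 1.
Proof.
rewrite /Defs.u mulr_suml; apply: chi_sum1 => k _.
rewrite mulr_sumr; apply: chi_sum1 => l _; rewrite !u_digitE.
set a := (_ %% _)%N; set b := (_ %% _)%N.
have [d _ hd] := digitM S a b.
have -> : s a / t * t ^- k * (s b / t * t ^- l) = s d * t ^- (k + l).+2.
  rewrite -hd !exprS exprD !invfM; ring.
exact: chi_digit_neg.
Qed.

Lemma chi_tV_neq1 : chi t^-1 != 1.
Proof.
have := basic_characterE (st_chi S) (Ordinal (st_c S)) 1.
have [eps0 _ _] := st_basis S; rewrite eps0// mul1r eqxx/= => ->.
have p1 := prime_gt1 (prime_p S).
have p0 : 0 < p%:R :> R by rewrite ltr0n ltnW.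
apply/eqP => -[hc hs].
have [p2|p2] := eqVneq p 2%N.
  move: hc; rewrite p2 mulrAC divff ?pnatr_eq0// mul1r cospi => /eqP.
  by rewrite -subr_eq0 -opprD oppr_eq0 (_ : 1 + 1 = 2%:R) ?pnatr_eq0// -natr1.
have : 0 < sin (2 * pi / p%:R) :> R.
  apply: sin_gt0_pi; apply/andP; split.
    by rewrite divr_gt0// mulr_gt0// pi_gt0.
  rewrite ltr_pdivrMr// mulrC ltr_pM2l ?pi_gt0// ltr_nat.
  by rewrite ltn_neqAle eq_sym p2.
by rewrite hs ltxx.
Qed.

(** [chi] is nontrivial on [t^-1 * D], hence on [x * D] when [x] is not an
    integer. *)
Lemma chi_nontrivial x : ~ D x -> exists2 y, D y & chi (x * y) != 1.
Proof.
move=> Dx; have x0 : x != 0.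
  by apply: contra_notN Dx => /eqP ->; exact: integers0 S.
exists (x^-1 / t); last by rewrite mulVKf// chi_tV_neq1.
apply/(integers_divt S); rewrite (absV S) invf_lt1 ?(abs_gt0 S)// ltNge.
by apply/negP.
Qed.

Lemma cmeasurable_chi a : cmeasurable (fun x : borel K => chi (a * x)).
Proof.
have mchi : cmeasurable (chi : borel K -> R[i]).
  split; apply: measurable_continuousR.
    exact: basic_character_continuous_Re (st_chi S).
  exact: basic_character_continuous_Im (st_chi S).
have := cmeasurable_affine a 0 mchi.
by congr cmeasurable; apply/funext => x; rewrite /affine addr0.
Qed.

Lemma cmeasurable_chiJ a : cmeasurable (fun x : borel K => (chi (a * x))^*%C).
Proof. by apply: cmeasurableJ; exact: cmeasurable_chi. Qed.

Lemma cmeasurable_indicD : cmeasurable (fun x : borel K => (\1_D x)%:C : R[i]).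
Proof.
apply: cmeasurableC; apply/measurable_indicP; exact: measurable_integers S.
Qed.

(** The conjugate of [chi_k] on [D], extended by [0] so that the space [L^2(D)]
    sits inside [L^2(K)]. *)
Definition wave (k : nat) : K -> R[i] := fun x => (\1_D x)%:C * (chi (u k * x))^*%C.

Lemma sqabs_indicD x : sqabs ((\1_D x)%:C : R[i]) = \1_D x.
Proof. by rewrite sqabsC indicE; case: (_ \in _); rewrite ?expr1n ?expr0n. Qed.

Lemma sqabs_wave k x : sqabs (wave k x) = \1_D x.
Proof. by rewrite sqabsM sqabsJ sqabs_chi mulr1 sqabs_indicD. Qed.

Lemma cLp2_wave k : cLp mu 2%:E (wave k).
Proof.
apply/cLp2P; split.
  by apply: cmeasurableM; [exact: cmeasurable_indicD|exact: cmeasurable_chiJ].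
rewrite /esqnorm; under eq_integral do rewrite sqabs_wave.
by rewrite integral_indic//; [rewrite setIT (st_measure1 S) ltry|exact: measurable_integers S].
Qed.

Lemma indicD_shift x y : D y -> \1_D (x + y) = \1_D x :> R.
Proof.
move=> Dy; rewrite !indicE; congr (_%:R); congr nat_of_bool; apply/idP/idP;
  rewrite !inE => h; last exact: integersD S _ _ h Dy.
by have := integersB S h Dy; rewrite addrK.
Qed.

Lemma cintegral_indicD : cintegral mu (fun x : borel K => (\1_D x)%:C) = 1 :> R[i].
Proof.
apply: complexP; rewrite /= /Rintegral ?integral0//.
by rewrite integral_indic ?setIT ?(st_measure1 S)//; exact: measurable_integers S.
Qed.

(** Translating by an element of [D] multiplies the integral of a nontrivial
    character over [D] by a number other than [1]. *)
Lemma wave_orthonormal : orthonormal_system mu wave.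
Proof.
split=> [|j k]; first exact: cLp2_wave.
have [l hl] := u_sub S j k.
have E x : wave j x * (wave k x)^*%C = (\1_D x)%:C * (chi (u l * x))^*%C.
  rewrite /wave !conjcM conjcC conjcK -hl mulrBl chiB !conjcM conjcK mulrACA.
  by rewrite -[_%:C * _%:C]rmorphM/= indicE -natrM mulnb andbb.
rewrite /inner; under eq_fun do rewrite E.
have [jk|jk] := eqVneq j k.
  have l0 : l = 0%N.
    by apply: (u_inj S); rewrite -hl jk subrr (u0 S).
  rewrite l0 (u0 S); under eq_fun do rewrite mul0r chi0 conjc1 mulr1.
  exact: cintegral_indicD.
have nD : ~ D (u l).
  by rewrite -hl => /(u_coset_inj S)/eqP; rewrite (negbTE jk).
have [y Dy chiy] := chi_nontrivial nD.
have intl : cintegrable mu (fun x : borel K => (\1_D x)%:C * (chi (u l * x))^*%C).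
  by have := cintegrable_inner (cLp2_wave j) (cLp2_wave k);
    congr cintegrable; apply/funext => x; rewrite E.
have := cintegral_affine S y (oner_neq0 K) intl.
rewrite (abs1 S) invr1 mul1r.
under eq_fun do rewrite /affine mul1r (indicD_shift _ Dy) mulrDr chiD conjcM mulrA mulrC.
rewrite cintegralZ// => /eqP; rewrite -subr_eq0 -[X in _ - X]mul1r -mulrBl mulf_eq0.
case/orP => [|/eqP//]; rewrite subr_eq0 => /eqP h.
by move: chiy; rewrite -[chi _]conjcK h conjc1 eqxx.
Qed.

End Character.

(** * The Fourier transform *)

Section AlmostEverywhere.
Context {d : measure_display} {T : measurableType d} {R : realType}.
Context {mu : {measure set T -> \bar R}}.

Lemma aeS (P Q : T -> Prop) : (forall x, P x -> Q x) ->
  {ae mu, forall x, P x} -> {ae mu, forall x, Q x}.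
Proof. by move=> PQ; apply: filterS. Qed.

Lemma aeS2 (P P' Q : T -> Prop) : (forall x, P x -> P' x -> Q x) ->
  {ae mu, forall x, P x} -> {ae mu, forall x, P' x} -> {ae mu, forall x, Q x}.
Proof. by move=> PQ; apply: filterS2. Qed.

End AlmostEverywhere.

Lemma sqnorm_eq0_ae (d : measure_display) (T : measurableType d) (R : realType)
    (mu : {measure set T -> \bar R}) (f : T -> R[i]) :
  cLp mu 2%:E f -> sqnorm mu f = 0 -> {ae mu, forall x, f x = 0}.
Proof.
move=> Lf f0; have mf := cLp2_measurable Lf.
have : (\int[mu]_x `|(sqabs (f x))%:E| = 0)%E.
  under eq_integral do rewrite abse_EFin ger0_norm ?sqabs_ge0//.
  by have := sqnormE Lf; rewrite f0.
move/ae_eq_integral_abs => /(_ measurableT) [|N [mN N0 sN]].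
  exact/measurable_EFinP/measurable_sqabs.
exists N; split => // x /= nf; apply: sN => /= h; apply: nf.
by apply: sqabs_eq0; have := h I; case.
Qed.

Lemma cintegrable_mul_le1 (d : measure_display) (T : measurableType d)
    (R : realType) (mu : {measure set T -> \bar R}) (f w : T -> R[i]) :
  cintegrable mu f -> cmeasurable w -> (forall x, sqabs (w x) <= 1) ->
  cintegrable mu (fun x => f x * w x).
Proof.
move=> intf mw w1; have mf := cintegrable_measurable intf.
have [m1 m2] := cmeasurableM mf mw; case: intf => f1 f2.
have := integrableD measurableT (integrable_abse f1) (integrable_abse f2).
move=> intg.
have wle x : `|complex.Re (w x)| <= 1 /\ `|complex.Im (w x)| <= 1.
  have := w1 x; rewrite /sqabs => h.
  have r0 := sqr_ge0 (complex.Re (w x)); have i0 := sqr_ge0 (complex.Im (w x)).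
  by split; rewrite -(@ler_pXn2r _ 2) ?nnegrE// expr1n real_normK ?num_real//; lra.
have bound (a b a' b' : R) : `|a'| <= 1 -> `|b'| <= 1 ->
    `|a| * `|a'| + `|b| * `|b'| <= `|a| + `|b|.
  by move=> ha hb; apply: lerD; rewrite ler_piMr.
split; apply: le_integrable intg => //; try exact/measurable_EFinP.
- move=> x _; have [w1' w2'] := wle x; rewrite /= ReM lee_fin [leRHS]ger0_norm ?addr_ge0//.
  by apply: le_trans (bound _ _ _ _ w1' w2'); rewrite -!normrM; exact: ler_normB.
- move=> x _; have [w1' w2'] := wle x; rewrite /= ImM lee_fin [leRHS]ger0_norm ?addr_ge0//.
  by apply: le_trans (bound _ _ _ _ w2' w1'); rewrite -!normrM; exact: ler_normD.
Qed.

Lemma eq_sqnorm (d : measure_display) (T : measurableType d) (R : realType)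
    (mu : {measure set T -> \bar R}) (f g : T -> R[i]) :
  cmeasurable f -> cmeasurable g -> {ae mu, forall x, f x = g x} ->
  sqnorm mu f = sqnorm mu g.
Proof. by move=> mf mg fg; rewrite /sqnorm (ae_eq_esqnorm mf mg fg). Qed.

Section Fourier.
Context {R : realType} {K : topologicalFieldType}.
Context {mu : {measure set (borel K) -> \bar R}} {abs : K -> R}.
Context {p c q : nat} {t : K} {eps : 'I_c -> K} {chi : K -> R[i]}.
Hypothesis S : local_field_setting mu abs p q t eps chi.
Variable F : (K -> R[i]) -> K -> R[i].
Hypothesis hF : is_fourier_L2 mu chi F.

Let LF f : cLp mu 2%:E f -> cLp mu 2%:E (F f).
Proof. exact: fourier_L2_stable hF f. Qed.

Lemma fourierB f g : cLp mu 2%:E f -> cLp mu 2%:E g ->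
  {ae mu, forall x, F (fun y => f y - g y) x = F f x - F g x}.
Proof.
move=> Lf Lg; have := fourier_L2_linear hF (-1) Lg Lf.
rewrite (_ : (fun y => -1 * g y + f y) = (fun y => f y - g y)).
  by apply: aeS => x ->; rewrite mulN1r addrC.
by apply/funext => y; rewrite mulN1r addrC.
Qed.

Lemma sqnorm_fourier f : cLp mu 2%:E f -> sqnorm mu (F f) = sqnorm mu f.
Proof.
move=> Lf; apply: (@complexI R).
by rewrite -!inner_sqnorm (fourier_L2_isometry hF).
Qed.

Lemma sqnorm_fourierB f g : cLp mu 2%:E f -> cLp mu 2%:E g ->
  sqnorm mu (fun x => F f x - F g x) = sqnorm mu (fun x => f x - g x).
Proof.
move=> Lf Lg; rewrite -(sqnorm_fourier (cLp2B Lf Lg)); apply: eq_sqnorm.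
- by apply: cLp2_measurable; apply: cLp2B; exact: LF.
- by apply: cLp2_measurable; apply: LF; exact: cLp2B.
- by apply: aeS _ (fourierB Lf Lg) => x ->.
Qed.

Lemma fourier_sum (e : nat -> K -> R[i]) (a : nat -> R[i]) N :
  (forall k, cLp mu 2%:E (e k)) ->
  {ae mu, forall x, F (fun y => \sum_(k < N) a k * e k y) x =
                    \sum_(k < N) a k * F (e k) x}.
Proof.
move=> Le; elim: N => [|N IH].
  have -> : (fun y : K => \sum_(k < 0) a k * e k y) = (fun y => 0 - 0).
    by apply/funext => y; rewrite big_ord0 subrr.
  have L0 := @cLp20 _ (borel K) R mu.
  apply: aeS _ (fourierB L0 L0) => x ->.
  by rewrite subrr big_ord0.
have LS : cLp mu 2%:E (fun y : K => \sum_(k < N) a k * e k y).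
  by apply: cLp2_sum => k _; exact: cLp2Z.
have -> : (fun y : K => \sum_(k < N.+1) a k * e k y) =
    (fun y => a N * e N y + \sum_(k < N) a k * e k y).
  by apply/funext => y; rewrite big_ord_recr addrC.
apply: aeS2 _ IH (fourier_L2_linear hF (a N) (Le N) LS) => x h ->.
by rewrite h big_ord_recr addrC.
Qed.

Section AffineFourier.
Variables (a b : K).
Hypothesis a0 : a != 0.

(** What the change of variables [affine a b] becomes under the Fourier
    transform. *)
Definition modulate (g : K -> R[i]) : K -> R[i] :=
  fun xi => ((abs a)^-1%:C * chi (xi * (a^-1 * b))) * g (a^-1 * xi).

Let abs_a0 : 0 < abs a. Proof. exact: abs_gt0 S _ a0. Qed.

Lemma cLp2_modulate g : cLp mu 2%:E g -> cLp mu 2%:E (modulate g).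
Proof.
move=> Lg; rewrite /modulate; under eq_fun do rewrite -mulrA.
apply: cLp2Z; apply: cLp2_mul_le1.
- by have := cmeasurable_chi S (a^-1 * b); congr cmeasurable;
    apply/funext => x; rewrite mulrC.
- by move=> x; rewrite (sqabs_chi S).
- have := cLp2_affine S 0 (a := a^-1) _ Lg; rewrite invr_neq0// => /(_ isT).
  by congr (cLp mu _ _); apply/funext => x; rewrite /affine addr0.
Qed.

Lemma sqnorm_modulate g : cLp mu 2%:E g ->
  sqnorm mu (modulate g) = (abs a)^-1 * sqnorm mu g.
Proof.
move=> Lg; have La : cLp mu 2%:E (fun x => g (affine a^-1 0 x)).
  by apply: (cLp2_affine S) => //; rewrite invr_neq0.
have -> : modulate g = (fun x => (abs a)^-1%:C *
    (chi (x * (a^-1 * b)) * g (affine a^-1 0 x))).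
  by apply/funext => x; rewrite /modulate /affine addr0 mulrA.
rewrite sqnormZ; last first.
  apply: cLp2_mul_le1 => //.
    by have := cmeasurable_chi S (a^-1 * b); congr cmeasurable;
      apply/funext => x; rewrite mulrC.
  by move=> x; rewrite (sqabs_chi S).
have -> : sqnorm mu (fun x => chi (x * (a^-1 * b)) * g (affine a^-1 0 x)) =
    sqnorm mu (fun x => g (affine a^-1 0 x)).
  by rewrite /sqnorm esqnorm_mul_unit// => x; rewrite (sqabs_chi S).
rewrite (sqnorm_affine S)// ?invr_neq0// (absV S) invrK sqabsC mulrA; congr (_ * _).
by rewrite expr2 mulrAC mulVf ?gt_eqF// mul1r.
Qed.

Lemma fourier_affine_L1 f xi : cintegrable mu (f : borel K -> R[i]) ->
  fourier mu chi (fun x => f (affine a b x)) xi = modulate (fourier mu chi f) xi.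
Proof.
move=> intf.
have mchi z : cmeasurable (fun x : borel K => (chi (z * x))^*%C).
  exact: cmeasurable_chiJ S z.
have int2 z : cintegrable mu (fun y : borel K => f y * (chi (z * y))^*%C).
  apply: cintegrable_mul_le1 => // x; by rewrite sqabsJ (sqabs_chi S).
rewrite /modulate /fourier.
have -> : (fun x : borel K => f (affine a b x) * (chi (xi * x))^*%C) =
  (fun x => chi (xi * (a^-1 * b)) *
     (f (affine a b x) * (chi (a^-1 * xi * affine a b x))^*%C)).
  apply/funext => x; rewrite mulrCA; congr (_ * _).
  rewrite -!(chiN S) -(chiD S); congr chi; rewrite /affine; field; exact: a0.
rewrite cintegralZ; last exact: (cintegrable_affine S b a0 (int2 (a^-1 * xi))).
by rewrite (cintegral_affine S b a0 (int2 (a^-1 * xi))); ring.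
Qed.

End AffineFourier.
End Fourier.

Lemma cintegrable_cLp1 (d : measure_display) (T : measurableType d)
    (R : realType) (mu : {measure set T -> \bar R}) (f : T -> R[i]) :
  cintegrable mu f -> cLp mu 1%:E f.
Proof.
move=> intf; have mf := cintegrable_measurable intf; split => //.
rewrite /cnorm Lnorm1; case: intf => f1 f2.
have := integrableD measurableT (integrable_abse f1) (integrable_abse f2).
case/integrableP => _; apply: le_lt_trans; apply: ge0_le_integral => //.
- apply: measurableT_comp => //; apply/measurable_EFinP.
  rewrite (_ : (fun x => Normc.normc (f x)) = Num.sqrt \o (fun x => sqabs (f x))).
    apply: (measurableT_comp (continuous_measurable_fun (@sqrt_continuous R))).
    exact: measurable_sqabs.
  by apply/funext => x; rewrite /= -sqabs_normc sqrtr_sqr ger0_norm ?normc_ge0.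
- apply: measurableT_comp => //.
  have m1 := measurable_int _ f1; have m2 := measurable_int _ f2.
  by apply: emeasurable_funD; [exact: measurableT_comp m1|exact: measurableT_comp m2].
- move=> x _ /=; rewrite ger0_norm ?normc_ge0// lee_fin ger0_norm ?addr_ge0//.
  rewrite -(@ler_pXn2r _ 2) ?nnegrE ?normc_ge0 ?addr_ge0//.
  rewrite sqabs_normc sqrrD /sqabs !real_normK ?num_real//.
  by rewrite [leRHS]addrAC lerDl mulrn_wge0 ?mulr_ge0.
Qed.

Section FourierAffine.
Context {R : realType} {K : topologicalFieldType}.
Context {mu : {measure set (borel K) -> \bar R}} {abs : K -> R}.
Context {p c q : nat} {t : K} {eps : 'I_c -> K} {chi : K -> R[i]}.
Hypothesis S : local_field_setting mu abs p q t eps chi.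

Let bigball N : set K := [set x | abs x <= (abs t)^-1 ^+ N].

Let measurable_bigball N : measurable (bigball N : set (borel K)) /\
  mu (bigball N) \is a fin_num.
Proof.
have tN : t ^+ N != 0 by rewrite expf_neq0 ?(t_neq0 S).
have -> : bigball N = affine (t ^+ N) 0 @^-1` integers abs.
  apply/seteqP; split=> x; rewrite /affine/bigball /integers/= addr0 (absM S) (absX S);
    by rewrite -ler_pdivlMl ?exprn_gt0 ?(abst_gt0 S)// mulr1 exprVn.
split; first by apply: measurable_preimage_affine; exact: measurable_integers S.
rewrite (measure_preimage_affine S)//; last exact: measurable_integers S.
by rewrite (st_measure1 S).
Qed.

Let trunc N (f : K -> R[i]) : K -> R[i] := fun x => (\1_(bigball N) x)%:C * f x.

Let cLp2_ball N : cLp mu 2%:E (fun x : borel K => (\1_(bigball N) x)%:C).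
Proof.
have [mB fB] := measurable_bigball N; apply/cLp2P; split.
  by apply: cmeasurableC; exact/measurable_indicP.
rewrite /esqnorm (_ : (fun x => _) = (fun x => (\1_(bigball N) x)%:E)).
  by rewrite integral_indic// setIT ltey_eq fB.
by apply/funext => x; rewrite sqabsC indicE; case: (_ \in _); rewrite ?expr1n ?expr0n.
Qed.

Let cLp2_trunc N f : cLp mu 2%:E f -> cLp mu 2%:E (trunc N f).
Proof.
move=> Lf; apply: cLp2_mul_le1 => //; first exact: cLp2_measurable (cLp2_ball N).
move=> x; rewrite sqabsC indicE; case: (_ \in _); rewrite ?expr1n ?expr0n//.
Qed.

Let cintegrable_trunc N f : cLp mu 2%:E f -> cintegrable mu (trunc N f : borel K -> R[i]).
Proof.
move=> Lf; have := cintegrable_inner Lf (cLp2_ball N).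
by congr cintegrable; apply/funext => x; rewrite conjcC mulrC.
Qed.

Let trunc_cvg f : cLp mu 2%:E f -> L2cvg mu (fun N => trunc N f) f.
Proof.
move=> Lf; have mf := cLp2_measurable Lf.
have LT N : cLp mu 2%:E (fun x => trunc N f x - f x).
  by apply: cLp2B => //; exact: cLp2_trunc.
have intf : mu.-integrable [set: borel K] (fun x => (sqabs (f x))%:E).
  apply/integrableP; split; first exact/measurable_EFinP/measurable_sqabs.
  under eq_integral do rewrite abse_EFin ger0_norm ?sqabs_ge0//.
  by have /cLp2P[] := Lf.
have mT N : measurable_fun [set: borel K]
    (fun x => (sqabs (trunc N f x - f x))%:E).
  by apply/measurable_EFinP/measurable_sqabs; exact: cLp2_measurable (LT N).
have [||_ _] := @dominated_convergence _ _ _ mu _ measurableT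
  (fun N x => (sqabs (trunc N f x - f x))%:E) (cst 0)%E _ mT
  (measurable_cst _) _ intf _.
- apply: nearW => x _; apply: cvg_near_cst.
  have [N xN] := abs_boundX S x; exists N => // n /= Nn.
  have -> : trunc n f x = f x.
    rewrite /trunc indicE mem_set ?mul1r//.
    rewrite /bigball/=; apply: (le_trans xN).
    by apply: ler_weXn2l => //; rewrite invf_ge1 ?(abst_gt0 S)// ltW// (abst_lt1 S).
  by rewrite subrr sqabs0.
- apply: nearW => x N _; rewrite abse_EFin ger0_norm ?sqabs_ge0// lee_fin.
  rewrite /trunc indicE; case: (_ \in _); first by rewrite mul1r subrr sqabs0 sqabs_ge0.
  by rewrite mul0r sub0r sqabsN.
rewrite integral0 => h; apply: (fine_cvg h).
Qed.

Variable F : (K -> R[i]) -> K -> R[i].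
Hypothesis hF : is_fourier_L2 mu chi F.

(** On truncations both sides are given by the Fourier integral; both sides are
    bounded operators on [L^2], so the identity extends by density. *)
Lemma fourier_affine (a b : K) f : a != 0 -> cLp mu 2%:E f ->
  {ae mu, forall xi, F (fun x => f (affine a b x)) xi =
                     modulate (abs := abs) (chi := chi) a b (F f) xi}.
Proof.
move=> a0 Lf; pose A g := fun x : K => g (affine a b x) : R[i].
pose B := modulate (abs := abs) (chi := chi) a b.
have LA g : cLp mu 2%:E g -> cLp mu 2%:E (A g) by move=> Lg; exact: (cLp2_affine S b a0 Lg).
have LB g : cLp mu 2%:E g -> cLp mu 2%:E (B g) by move=> Lg; exact: (cLp2_modulate S b a0 Lg).
have LF g : cLp mu 2%:E g -> cLp mu 2%:E (F g) by exact: fourier_L2_stable hF g.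
have LT N := cLp2_trunc N Lf.
have FT N : {ae mu, forall xi, F (A (trunc N f)) xi = B (F (trunc N f)) xi}.
  have e1 : {ae mu, forall x, F (A (trunc N f)) x = fourier mu chi (A (trunc N f)) x}.
    apply: (fourier_L2_extends hF); last exact: LA.
    by apply: cintegrable_cLp1; apply: (cintegrable_affine S) => //; exact: cintegrable_trunc.
  have e2 : {ae mu, forall x, F (trunc N f) x = fourier mu chi (trunc N f) x}.
    apply: (fourier_L2_extends hF) => //.
    by apply: cintegrable_cLp1; exact: cintegrable_trunc.
  have e3 := ae_affine S 0 (invr_neq0 a0) e2.
  apply: aeS2 e1 e3 => x ->; rewrite (fourier_affine_L1 S)//; last exact: cintegrable_trunc.
  by rewrite /B /modulate /affine addr0 => ->.
have LD : cLp mu 2%:E (fun x => F (A f) x - B (F f) x).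
  by apply: cLp2B; [exact/LF/LA|exact/LB/LF].
suff : sqnorm mu (fun x => F (A f) x - B (F f) x) = 0.
  by move=> /(sqnorm_eq0_ae LD); apply: aeS => x /eqP; rewrite subr_eq0 => /eqP.
apply/le_anti; rewrite sqnorm_ge0 andbT.
have bnd N : sqnorm mu (fun x => F (A f) x - B (F f) x) <=
    (abs a)^-1 * sqnorm mu (fun x => trunc N f x - f x) *+ 4.
  have -> : sqnorm mu (fun x => F (A f) x - B (F f) x) =
      sqnorm mu (fun x => (F (A f) x - F (A (trunc N f)) x) +
                      (B (F (trunc N f)) x - B (F f) x)).
    apply: eq_sqnorm.
    - exact: cLp2_measurable LD.
    - by apply: cLp2_measurable; apply: cLp2D; apply: cLp2B;
        do ?[exact/LF/LA|exact/LB/LF].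
    - by apply: aeS (FT N) => x ->; rewrite addrA subrK.
  apply: (le_trans (sqnormD_le _ _)).
  - by apply: cLp2B; exact/LF/LA.
  - by apply: cLp2B; exact/LB/LF.
  have n2sub (g h : K -> R[i]) : cLp mu 2%:E g -> cLp mu 2%:E h ->
      sqnorm mu (fun x => g x - h x) = sqnorm mu (fun x => h x - g x).
    move=> Lg Lh; rewrite -[RHS]mul1r -[X in X * _](_ : sqabs (-1 : R[i]) = _).
      by rewrite -sqnormZ; [congr sqnorm; apply/funext => x; rewrite mulN1r opprB|exact: cLp2B].
    by rewrite sqabsN /sqabs/= expr1n expr0n addr0.
  have -> : sqnorm mu (fun x => F (A f) x - F (A (trunc N f)) x) =
      (abs a)^-1 * sqnorm mu (fun x => trunc N f x - f x).
    rewrite (sqnorm_fourierB hF); [|exact: LA|exact: LA].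
    rewrite n2sub; [|exact: LA|exact: LA].
    exact: (sqnorm_affine S b a0 (cLp2B (LT N) Lf)).
  have -> : sqnorm mu (fun x => B (F (trunc N f)) x - B (F f) x) =
      (abs a)^-1 * sqnorm mu (fun x => trunc N f x - f x).
    rewrite -(sqnorm_fourierB hF (LT N) Lf).
    rewrite -(sqnorm_modulate S b a0); last exact: (cLp2B (LF _ (LT N)) (LF _ Lf)).
    by congr sqnorm; apply/funext => x; rewrite /B /modulate mulrBr.
  by rewrite -mulrnDr.
have lim0 : (abs a)^-1 * sqnorm mu (fun x => trunc N f x - f x) *+ 4 @[N --> \oo] --> 0.
  rewrite -[X in _ --> X](mul0rn _ 4) -[X in X *+ 4](mulr0 (abs a)^-1).
  by apply: cvgMn; apply: cvgM; [exact: cvg_cst|exact: trunc_cvg].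
by apply: (cvgr_to_ge lim0); apply: nearW => N; exact: bnd.
Qed.

End FourierAffine.

(** * Disks and the Dirichlet kernel *)

(** Both densities define finite measures, which agree as soon as they agree on a
    generating family of sets closed under intersection. *)
Section DensityUniqueness.
Context {d : measure_display} {T : measurableType d} {R : realType}.
Variable mu : {measure set T -> \bar R}.

Section Density.
Variable f : T -> \bar R.
Hypotheses (mf : measurable_fun [set: T] f) (f0 : forall x, (0 <= f x)%E).

Definition density (A : set T) : \bar R := (\int[mu]_(x in A) f x)%E.

Let density0 : density set0 = 0%E. Proof. exact: integral_set0. Qed.

Let density_ge0 A : (0 <= density A)%E. Proof. exact: integral_ge0. Qed.

Let density_sigma_additive : semi_sigma_additive density.
Proof. exact: semi_sigma_additive_nng_induced. Qed.

HB.instance Definition _ := isMeasure.Build _ _ _ density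
  density0 density_ge0 density_sigma_additive.

Definition density_measure : {measure set T -> \bar R} := density.

End Density.

Lemma density_unique (G : set (set T)) (g : (set T)^nat) (f1 f2 : T -> \bar R) :
  @measurable _ T = <<s G >> -> setI_closed G -> (forall i, G (g i)) ->
  \bigcup_k g k = [set: T] ->
  mu.-integrable [set: T] f1 -> mu.-integrable [set: T] f2 ->
  (forall x, (0 <= f1 x)%E) -> (forall x, (0 <= f2 x)%E) ->
  (forall A, G A -> (\int[mu]_(x in A) f1 x = \int[mu]_(x in A) f2 x)%E) ->
  {ae mu, forall x, f1 x = f2 x}.
Proof.
move=> mG IG Gg cg i1 i2 f10 f20 e12.
have m1 := measurable_int _ i1; have m2 := measurable_int _ i2.
have mGA A : G A -> measurable A by rewrite mG; exact: sub_sigma_algebra.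
have fin1 k : (density_measure m1 f10 (g k) < +oo)%E.
  apply: integrable_lty; first exact/mGA.
  by apply: integrableS i1 => //; exact/mGA.
have eqm A : measurable A ->
    (\int[mu]_(x in A) f1 x = \int[mu]_(x in A) f2 x)%E.
  exact: (@measure_unique _ _ _ G g mG IG Gg cg (density_measure m1 f10)
    (density_measure m2 f20) e12 fin1).
have := integral_ae_eq measurableT i1 m2 (fun E _ mE => eqm E mE).
by apply: filterS => x; apply.
Qed.

End DensityUniqueness.

Section Balls.
Context {R : realType} {K : topologicalFieldType}.
Context {mu : {measure set (borel K) -> \bar R}} {abs : K -> R}.
Context {p c q : nat} {t : K} {eps : 'I_c -> K} {chi : K -> R[i]}.
Hypothesis S : local_field_setting mu abs p q t eps chi.

Local Notation D := (integers abs).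
Local Notation u := (u p eps t).

Definition disk (N : nat) (x0 : K) : set K := [set x | abs (x - x0) <= abs t ^+ N].

Let tN N : t ^+ N != 0. Proof. by rewrite expf_neq0 ?(t_neq0 S). Qed.
Let aN N : 0 < abs t ^+ N. Proof. by rewrite exprn_gt0 ?(abst_gt0 S). Qed.

Lemma diskE N x0 : disk N x0 = affine (t ^- N) (- (t ^- N * x0)) @^-1` D.
Proof.
apply/seteqP; split=> x; rewrite /disk /affine /integers/= -mulrBr (absM S);
  by rewrite (absV S) (absX S) ler_pdivrMl// mulr1.
Qed.

Lemma open_disk N x0 : open (disk N x0).
Proof.
rewrite diskE; have -> : affine (t ^- N) (- (t ^- N * x0)) @^-1` D =
    (fun x => - x0 + x) @^-1` ((fun x => t ^- N * x) @^-1` D).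
  by apply/seteqP; split=> x; rewrite /affine/= mulrDr mulrN addrC.
by apply: open_preimage_addl; apply: open_preimage_mull; exact: open_integers S.
Qed.

Lemma measurable_disk N x0 : measurable (disk N x0 : set (borel K)).
Proof. by apply: measurable_open; exact: open_disk. Qed.

Lemma measure_disk N x0 : mu (disk N x0) = ((q%:R ^+ N)^-1)%:E.
Proof.
rewrite diskE (measure_preimage_affine S) ?invr_neq0//; last exact: measurable_integers S.
by rewrite (st_measure1 S) mule1 (absV S) (absX S) (abs_t S) invrK exprVn.
Qed.

Lemma disk_refl N x : disk N x x.
Proof. by rewrite /disk/= subrr (abs0 S) ltW. Qed.

Lemma disk_sub N N' x x' z : (N <= N')%N -> disk N x z -> disk N' x' z ->
  disk N' x' `<=` disk N x.
Proof.
move=> NN zx zx' y yx'; rewrite /disk/=.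
have le_N : abs t ^+ N' <= abs t ^+ N.
  by apply: ler_wiXn2l; rewrite ?(abs_ge0 S) ?ltW ?(abst_lt1 S).
have -> : y - x = (y - x') - (z - x') + (z - x) by ring.
apply: (absD S) => //; apply: (absB S); exact: le_trans le_N.
Qed.

Lemma disk0 : disk 0 0 = D.
Proof. by apply/seteqP; split=> x; rewrite /disk /integers/= subr0 expr0. Qed.

Definition disks : set (set (borel K)) :=
  [set A | A = set0 \/ exists N x0, A = disk N x0].

Lemma disks_setI : setI_closed disks.
Proof.
move=> A B [->{A}|[N [x ->{A}]]]; first by move=> _; left; rewrite set0I.
case=> [->{B}|[N' [x' ->{B}]]]; first by left; rewrite setI0.
have [e|/set0P[z [zx zx']]] := eqVneq (disk N x `&` disk N' x') set0; first by left.
right; have [NN|/ltnW NN] := leqP N N'.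
  by exists N', x'; apply: setIidr; exact: disk_sub zx zx'.
by exists N, x; apply: setIidl; exact: disk_sub zx' zx.
Qed.

(** The disks with the centres [t ^+ N * u n] form a countable base of the
    topology. *)
Lemma disks_generate : @measurable _ (borel K) = <<s disks >>.
Proof.
apply/seteqP; split; last first.
  apply: smallest_sub; first exact: sigma_algebra_measurable.
  by move=> _ [->|[N [x ->]]]; [exact: measurable0|exact: measurable_disk].
apply: smallest_sub; first exact: smallest_sigma_algebra.
move=> U oU; pose B N n : set K := disk N (t ^+ N * u n).
pose C N n : set K := if `[< B N n `<=` U >] then B N n else set0.
have -> : U = \bigcup_N \bigcup_n C N n.
  apply/seteqP; split=> [x Ux|x [N _ [n _]]]; last first.
    by rewrite /C; case: asboolP => // h; exact: h.
  have nU : nbhs (0 : K) ((fun z => x + z) @^-1` U).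
    by apply: open_nbhs_nbhs; split; [exact: open_preimage_addl|rewrite /= addr0].
  have [N hN] := integers_mulX_base (st_local_field S) (st_haar S) (st_modulus S)
    (abst_lt1 S) nU.
  have [n Dn] := u_coverT S (t ^- N * x).
  have xB : B N n x.
    rewrite /B /disk/= -[x](mulVKf (tN N)) -mulrBr (absM S) (absX S).
    by rewrite -[leRHS]mulr1 ler_wpM2l// ltW.
  exists N => //; exists n => //; rewrite /C; case: asboolP => // -[].
  move=> y yB; have : disk N x y by apply: (@disk_sub N N _ _ x) yB => //; exact: disk_refl.
  by move=> /hN/=; rewrite addrC subrK.
pose GT : measurableType disks.-sigma := g_sigma_algebraType disks.
apply: (@bigcupT_measurable _ GT) => N; apply: (@bigcupT_measurable _ GT) => n.
apply: sub_sigma_algebra; rewrite /C; case: ifP => _; last by left.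
by right; exists N, (t ^+ N * u n).
Qed.

Lemma disk_D N x0 : D x0 -> disk N x0 `<=` D.
Proof.
rewrite -{1}disk0 -disk0 => h; apply: (disk_sub _ h) => //; exact: disk_refl.
Qed.

(** Two disks are nested or disjoint, so the disks and the empty set form a family
    closed under intersection that generates the Borel sets. *)
Lemma ae_eq_disks (f1 f2 : K -> \bar R) :
  mu.-integrable (D : set (borel K)) f1 -> mu.-integrable (D : set (borel K)) f2 ->
  (forall x, (0 <= f1 x)%E) -> (forall x, (0 <= f2 x)%E) ->
  (forall N x0, D x0 -> (\int[mu]_(x in (disk N x0 : set (borel K))) f1 x =
                         \int[mu]_(x in (disk N x0 : set (borel K))) f2 x)%E) ->
  {ae mu, forall x, D x -> f1 x = f2 x}.
Proof.
move=> i1 i2 f10 f20 e12; have mD := measurable_integers S.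
have mBall := measurable_disk.
suff : {ae mu, forall x : borel K, (f1 \_ D) x = (f2 \_ D) x}.
  apply: aeS => x + Dx; rewrite !patchE mem_set//.
apply: (@density_unique _ (borel K) R mu disks (fun k => disk 0 (u k))).
- exact: disks_generate.
- exact: disks_setI.
- by move=> k; right; exists 0%N, (u k).
- apply/seteqP; split => // x _; have [n Dn] := u_coverT S x.
  by exists n => //; rewrite /disk/= expr0.
- by rewrite -integrable_mkcond.
- by rewrite -integrable_mkcond.
- by move=> x; rewrite patchE; case: ifP.
- by move=> x; rewrite patchE; case: ifP.
- move=> _ [->|[N [x0 ->]]]; first by rewrite !integral_set0.
  have [D0|nD0] := pselect (D x0).
    transitivity (\int[mu]_(x in (disk N x0 : set (borel K))) f1 x)%E.
      apply: eq_integral => x; rewrite inE => /(disk_D D0) Dx.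
      by rewrite patchE mem_set.
    rewrite e12//; apply: eq_integral => x; rewrite inE => /(disk_D D0) Dx.
    by rewrite patchE mem_set.
  apply: eq_integral => x; rewrite inE => xB; rewrite !patchE.
  rewrite memNset// => Dx; apply: nD0; rewrite -disk0.
  have z0 : disk 0 0 x by rewrite disk0.
  exact: (disk_sub (leq0n N) z0 xB (disk_refl N x0)).
Qed.

(** The [chi_n] with [n < q ^ N] form a group, so multiplying the sum by one of its
    terms permutes the summands. *)
Lemma dirichlet_group N x :
  \sum_(n < q ^ N) chi (u n * x) =
    if `[< forall n, (n < q ^ N)%N -> chi (u n * x) = 1 >] then (q ^ N)%:R else 0.
Proof.
case: asboolP => [h|/existsNP[m /not_implyP[mN chim]]].
  rewrite (eq_bigr (fun=> 1)); last by move=> n _; exact: h.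
  by rewrite sumr_const card_ord.
have /choice[k hk] : forall n : 'I_(q ^ N), exists k : 'I_(q ^ N), u n - u m = u k.
  by move=> n; have [k kN e] := u_subN S (ltn_ord n) mN; exists (Ordinal kN).
have kinj : injective k.
  move=> n n' e; apply/val_inj/(u_inj S)/(addIr (- u m)).
  by rewrite !hk e.
set s := LHS; have : s = chi (u m * x) * s.
  rewrite {2}/s (reindex_inj kinj) mulr_sumr; apply: eq_bigr => n _.
  by rewrite -hk mulrBl -(chiD S) addrC subrK.
move/eqP; rewrite -subr_eq0 -{1}[s]mul1r -mulrBl mulf_eq0 subr_eq0.
by case/orP => /eqP// e; case: chim; rewrite -e.
Qed.

Definition dirichlet (N : nat) (x : K) : R[i] :=
  ((q%:R ^+ N)^-1)%:C * \sum_(n < q ^ N) chi (u n * x).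

Let qN N : q%:R ^+ N != 0 :> R.
Proof. by rewrite expf_neq0// pnatr_eq0 -lt0n (q_gt0 S). Qed.

Lemma dirichletE N x : dirichlet N x =
  (`[< forall n, (n < q ^ N)%N -> chi (u n * x) = 1 >])%:R.
Proof.
rewrite /dirichlet dirichlet_group; case: asboolP => _; last by rewrite mulr0.
have -> : (q ^ N)%:R = (q%:R ^+ N)%:C :> R[i] by rewrite natrX rmorphXn/= rmorph_nat.
by rewrite -rmorphM/= mulVf.
Qed.

Lemma dirichlet_periodic N x j : dirichlet N (x + u j) = dirichlet N x.
Proof.
congr (_ * _); apply: eq_bigr => n _.
by rewrite mulrDr (chiD S) (chi_uu S) mulr1.
Qed.

(** The [u n] with [n < q ^ N] represent [t ^- N * D] modulo [D]; hence if
    [x - x0] is not in [t ^+ N * D], one of these characters takes there a value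
    other than [1]. *)
Lemma dirichlet_disk N x0 x : D x0 -> D x ->
  dirichlet N (x - x0) = (\1_(disk N x0) x)%:C.
Proof.
move=> Dx0 Dx; rewrite dirichletE indicE.
suff -> : `[< forall n, (n < q ^ N)%N -> chi (u n * (x - x0)) = 1 >] =
    (x \in disk N x0) by case: (_ \in _).
apply/asboolP/idP; rewrite inE /disk/=; last first.
  move=> xN n nN; apply: (chi_integer S); rewrite /integers/= (absM S).
  have := abs_u S nN; rewrite exprVn => un.
  rewrite -[leRHS](mulVf (lt0r_neq0 (aN N))); apply: ler_pM => //; exact: abs_ge0 S _.
move=> h; rewrite leNgt; apply/negP => xN; set z := x - x0 in h xN.
have z0 : z != 0.
  by apply/eqP => z0; move: xN; rewrite z0 (abs0 S) ltNge ltW.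
have az := abs_gt0 S z0.
have Dz : D z by exact: integersB S _ _ Dx Dx0.
have yN : abs (z^-1 / t) <= (abs t)^-1 ^+ N.
  have : abs (t ^+ N / z) <= abs t.
    by apply: (abs_lt1 S); rewrite (absM S) (absV S) (absX S) ltr_pdivrMr// mul1r.
  rewrite !(absM S) !(absV S) (absX S) exprVn => hz.
  rewrite ler_pdivrMr ?(abst_gt0 S)// -ler_pdivrMl ?invr_gt0//.
  by rewrite invrK.
have [n nN Dn] := u_cover S yN.
have := h n nN; have -> : u n * z = z * (z^-1 / t) - z * (z^-1 / t - u n) by ring.
rewrite (chiB S) [in X in _ * X](chi_integer S); last exact: integersM S _ _ Dz Dn.
rewrite conjc1 mulr1 mulVKf// => /eqP.
by rewrite (negbTE (chi_tV_neq1 S)).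
Qed.

End Balls.

Arguments disk {R K} abs t N x0.
Arguments dirichlet {R K} p {c} q t eps chi N x.

(** * Periodization *)

Section Periodization.
Context {R : realType} {K : topologicalFieldType}.
Context {mu : {measure set (borel K) -> \bar R}} {abs : K -> R}.
Context {p c q : nat} {t : K} {eps : 'I_c -> K} {chi : K -> R[i]}.
Hypothesis S : local_field_setting mu abs p q t eps chi.

Local Notation D := (integers abs).
Local Notation DB := (integers abs : set (borel K)).
Local Notation u := (u p eps t).

Let mD : measurable DB := measurable_integers S.

Lemma measurable_translate (w : K -> \bar R) (b : K) : measurable_fun [set: borel K] w ->
  measurable_fun [set: borel K] (fun x => w (x + b)).
Proof.
move=> mw; have := measurableT_comp mw (measurable_affine 1 b).
by congr measurable_fun; apply/funext => x; rewrite /affine/= mul1r.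
Qed.

Lemma integral_coset (w : K -> \bar R) (b : K) : measurable_fun [set: borel K] w ->
  (forall x, (0 <= w x)%E) ->
  (\int[mu]_(x in [set x | D (x - b)%R] : set (borel K)) w x =
   \int[mu]_(x in DB) w (x + b)%R)%E.
Proof.
move=> mw w0; set A : set (borel K) := [set x | D (x - b)].
have mA : measurable A.
  have := measurable_preimage_affine 1 (- b) mD.
  by congr measurable; apply/seteqP; split=> x; rewrite /A /affine/= mul1r.
rewrite integral_mkcond [RHS]integral_mkcond.
have mwA : measurable_fun [set: borel K] (w \_ A).
  exact: (proj1 (@measurable_restrictT _ _ (borel K) _ A w mA) (measurable_funTS mw)).
have wA0 x : (0 <= (w \_ A) x)%E by rewrite patchE; case: ifP.
have := ge0_integral_affine S b (oner_neq0 K) mwA wA0.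
rewrite (abs1 S) invr1 mul1e => <-.
apply: eq_integral => x _; rewrite !patchE /affine mul1r.
by congr (if _ then _ else _); apply/idP/idP; rewrite !inE /A/= ?addrK.
Qed.

(** [K] is the disjoint union of the cosets [u j + D]. *)
Lemma integral_cosets (w : K -> \bar R) : measurable_fun [set: borel K] w ->
  (forall x, (0 <= w x)%E) ->
  (\int[mu]_x w x = \sum_(j <oo) \int[mu]_(x in DB) w (x + u j)%R)%E.
Proof.
move=> mw w0; pose F j : set (borel K) := [set x | D (x - u j)].
have mF j : measurable (F j).
  have := measurable_preimage_affine 1 (- u j) mD.
  by congr measurable; apply/seteqP; split=> x; rewrite /F /affine/= mul1r.
have FT : \bigcup_j F j = [set: borel K].
  apply/seteqP; split=> // x _; have [n Dn] := u_coverT S x; by exists n.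
rewrite -FT ge0_integral_bigcup//; last 2 first.
- by rewrite FT.
- move=> i j _ _ [x [Fi Fj]]; apply: (u_coset_inj S).
  have -> : u i - u j = (x - u j) - (x - u i) by ring.
  exact: integersB S _ _ Fj Fi.
by apply: eq_eseriesr => j _; exact: integral_coset.
Qed.

Definition periodization (w : K -> R) (x : K) : \bar R :=
  (\sum_(j <oo) (w (x + u j)%R)%:E)%E.

Section Weight.
Variable w : K -> R.
Hypotheses (mw : measurable_fun [set: borel K] w) (w0 : forall x, 0 <= w x).

Let mwj j : measurable_fun [set: borel K] (fun x => (w (x + u j))%:E).
Proof. apply: (measurable_translate (w := fun x => (w x)%:E) (u j)); exact/measurable_EFinP. Qed.

Lemma measurable_periodization : measurable_fun [set: borel K] (periodization w).
Proof.
by apply: ge0_emeasurable_sum => // j x _ _; rewrite lee_fin.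
Qed.

Lemma periodization_ge0 x : (0 <= periodization w x)%E.
Proof. by apply: nneseries_ge0 => j _ _; rewrite lee_fin. Qed.

Lemma integral_periodic (g : K -> R) : measurable_fun [set: borel K] g ->
  (forall x, 0 <= g x) -> (forall j, {ae mu, forall x, g (x + u j) = g x}) ->
  (\int[mu]_x (g x * w x)%:E = \int[mu]_(x in DB) ((g x)%:E * periodization w x))%E.
Proof.
move=> mg g0 pg; rewrite integral_cosets; last 2 first.
- by apply/measurable_EFinP; exact: measurable_funM.
- by move=> x; rewrite lee_fin mulr_ge0.
have mgw j : measurable_fun DB (fun x => ((g x)%:E * (w (x + u j))%:E)%E).
  apply: emeasurable_funM; apply: measurable_funTS; last exact: mwj.
  exact/measurable_EFinP.
transitivity (\sum_(j <oo) \int[mu]_(x in DB) ((g x)%:E * (w (x + u j)%R)%:E))%E.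
  apply: eq_eseriesr => j _; apply: ge0_ae_eq_integral => //.
  - apply: measurable_funTS; apply: (measurable_translate
      (w := fun x => (g x * w x)%:E) (u j)).
    by apply/measurable_EFinP; exact: measurable_funM.
  - by move=> x _; rewrite lee_fin mulr_ge0.
  - by move=> x _; rewrite -EFinM lee_fin mulr_ge0.
  - by apply: aeS (pg j) => x -> _; rewrite EFinM.
rewrite -integral_nneseries//; last first.
  by move=> j x _; rewrite -EFinM lee_fin mulr_ge0.
by apply: eq_integral => x _; rewrite nneseriesZl// => j _; rewrite lee_fin.
Qed.

End Weight.

(** For [f] the Fourier transform of a function with orthonormal translates, the
    periodization of [|f|^2] has the Fourier coefficients of the constant [1]. *)
Section OrthonormalTranslates.
Variable f : K -> R[i].
Hypothesis Lf : cLp mu 2%:E f.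
Hypothesis coef : forall n,
  inner mu (fun x => chi (u n * x) * f x) f = (n == 0%N)%:R.

Let w x : R := sqabs (f x).
Let mw : measurable_fun [set: borel K] w.
Proof. by apply: measurable_sqabs; exact: cLp2_measurable Lf. Qed.
Let w0 x : 0 <= w x. Proof. exact: sqabs_ge0. Qed.

Let Lchif n : cLp mu 2%:E (fun x => chi (u n * x) * f x).
Proof.
apply: cLp2_mul_le1 => //; first exact: cmeasurable_chi S _.
by move=> x; rewrite (sqabs_chi S).
Qed.

Let inner_dirichlet N x0 :
  inner mu (fun x => dirichlet p q t eps chi N (x - x0) * f x) f =
  ((q%:R ^+ N)^-1)%:C.
Proof.
have -> : (fun x => dirichlet p q t eps chi N (x - x0) * f x) =
  (fun x => ((q%:R ^+ N)^-1)%:C *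
    \sum_(n < q ^ N) (chi (u n * x0))^*%C * (chi (u n * x) * f x)).
  apply/funext => x; rewrite /dirichlet -mulrA mulr_suml; congr (_ * _).
  by apply: eq_bigr => n _; rewrite mulrBr (chiB S) mulrA [_ * (chi _)^*%C]mulrC.
have LS : cLp mu 2%:E (fun x : borel K =>
    \sum_(n < q ^ N) (chi (u n * x0))^*%C * (chi (u n * x) * f x)).
  by apply: cLp2_sum => n _; exact: cLp2Z.
rewrite innerZl// inner_suml//; last by move=> n _; exact: cLp2Z.
have qN : (0 < q ^ N)%N by rewrite expn_gt0 (q_gt0 S).
rewrite (bigD1 (Ordinal qN))//= big1 ?addr0.
  by rewrite innerZl// coef eqxx mulr1 (u0 S) mul0r (chi0 S) conjc1 mulr1.
move=> n n0; rewrite innerZl// coef.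
by rewrite -(inj_eq val_inj)/= in n0; rewrite (negbTE n0) mulr0.
Qed.

Let mdir N x0 : cmeasurable (fun x : borel K =>
  dirichlet p q t eps chi N (x - x0)).
Proof.
apply: cmeasurableM; first exact: cmeasurable_cst.
apply: cmeasurable_sum => n _.
have -> : (fun x : borel K => chi (u n * (x - x0))) =
    (fun x => chi (u n * x) * chi (- (u n * x0))).
  by apply/funext => x; rewrite -(chiD S) mulrBr.
by apply: cmeasurableM; [exact: cmeasurable_chi S _|exact: cmeasurable_cst].
Qed.

(** The Dirichlet kernel is periodic and equals the indicator of the disk on [D]:
    the integral unfolds to all of [K], where it is a combination of the [coef]. *)
Lemma integral_periodization_disk N x0 : D x0 ->
  (\int[mu]_(x in disk abs t N x0 : set (borel K)) periodization w x =
   ((q%:R ^+ N)^-1)%:E)%E.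
Proof.
move=> Dx0.
pose k x : R := complex.Re (dirichlet p q t eps chi N (x - x0)).
have kE x : dirichlet p q t eps chi N (x - x0) = (k x)%:C.
  by rewrite /k (dirichletE S); case: asboolP.
have k01 x : k x = 0 \/ k x = 1.
  by rewrite /k (dirichletE S); case: asboolP => _; [right|left].
have k0 x : 0 <= k x by have [->|->] := k01 x.
have mk : measurable_fun [set: borel K] k by case: (mdir N x0).
have pk j : {ae mu, forall x, k (x + u j) = k x}.
  by apply: aeW => x; rewrite /k addrAC (dirichlet_periodic S).
have := integral_periodic mw w0 mk k0 pk.
have -> : (\int[mu]_(x in DB) ((k x)%:E * periodization w x) =
    \int[mu]_(x in disk abs t N x0 : set (borel K)) periodization w x)%E.
  rewrite integral_mkcond [RHS]integral_mkcond; apply: eq_integral => x _.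
  rewrite !patchE; case: ifPn => [|nDx].
    rewrite inE => Dx; have := dirichlet_disk S N Dx0 Dx; rewrite kE => -[->].
    by rewrite indicE; case: (_ \in _); rewrite ?mul1e ?mul0e.
  case: ifPn => //; rewrite inE => /(disk_D S Dx0) Dx.
  by rewrite mem_set in nDx.
move=> <-.
have Lk : cLp mu 2%:E (fun x => (k x)%:C * f x).
  apply: cLp2_mul_le1; [exact: (cmeasurableC mk)| |exact: Lf].
  by move=> x; rewrite sqabsC; have [->|->] := k01 x; rewrite ?expr1n ?expr0n.
have := inner_dirichlet N x0; under eq_fun do rewrite kE.
move=> /(congr1 (@complex.Re _)); rewrite /inner Re_cintegral [X in _ = X -> _]ReC.
have E x : complex.Re ((k x)%:C * f x * (f x)^*%C) = k x * w x.
  by rewrite -mulrA mul_conjc -rmorphM.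
under eq_Rintegral do rewrite E.
move=> <-; rewrite /Rintegral fineK//.
have [+ _] := cintegrable_inner Lk Lf.
move=> /(integrable_fin_num measurableT); congr (_ \is a fin_num).
by apply: eq_integral => x _ /=; rewrite E.
Qed.

Lemma periodization_eq1 : {ae mu, forall x, D x -> periodization w x = 1%E}.
Proof.
have mP := measurable_periodization mw w0; have P0 := periodization_ge0 w0.
have int1 : mu.-integrable DB (cst 1%E).
  apply/integrableP; split => //.
  under eq_integral do rewrite /= normr1.
  by rewrite integral_cst// (st_measure1 S) mule1 ltry.
apply: (ae_eq_disks S) => //.
- apply/integrableP; split; first exact: measurable_funTS.
  under eq_integral do rewrite gee0_abs//.
  have := integral_periodization_disk 0 (integers0 S).
  by rewrite disk0 => ->; rewrite ltry.
- move=> N x0 Dx0; rewrite integral_periodization_disk//.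
  by rewrite integral_cst ?(measure_disk S) ?mul1e//; exact: measurable_disk S _ _.
Qed.

Lemma integral_periodic_weight (g : K -> R) : measurable_fun [set: borel K] g ->
  (forall x, 0 <= g x) -> (forall j, {ae mu, forall x, g (x + u j) = g x}) ->
  (\int[mu]_x (g x * sqabs (f x))%:E = \int[mu]_(x in DB) (g x)%:E)%E.
Proof.
move=> mg g0 pg; rewrite (integral_periodic mw w0)//.
have mP := measurable_periodization mw w0; have P0 := periodization_ge0 w0.
apply: ge0_ae_eq_integral => //.
- apply: emeasurable_funM; apply: measurable_funTS => //.
  exact/measurable_EFinP.
- by apply: measurable_funTS; exact/measurable_EFinP.
- by move=> x _; rewrite mule_ge0// lee_fin.
- by move=> x _; rewrite lee_fin.
- by apply: aeS periodization_eq1 => x h Dx; rewrite h// mule1.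
Qed.

End OrthonormalTranslates.
End Periodization.

(** * Symbols and orthonormal expansions *)

Section Multiresolution.
Context {R : realType} {K : topologicalFieldType}.
Context {mu : {measure set (borel K) -> \bar R}} {abs : K -> R}.
Context {p c q : nat} {t : K} {eps : 'I_c -> K} {chi : K -> R[i]}.
Hypothesis S : local_field_setting mu abs p q t eps chi.
Variable F : (K -> R[i]) -> K -> R[i].
Hypothesis hF : is_fourier_L2 mu chi F.

Local Notation D := (integers abs).
Local Notation DB := (integers abs : set (borel K)).
Local Notation u := (u p eps t).
Local Notation wave := (wave (abs := abs) (p := p) (t := t) (eps := eps) (chi := chi)).

Variable phi : K -> R[i].
Hypothesis Lphi : cLp mu 2%:E phi.
Hypothesis phi_on : orthonormal_system mu (fun (k : nat) (x : K) => phi (x - u k)).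

Lemma ae_eq_inner (f g f' : K -> R[i]) : cLp mu 2%:E f -> cLp mu 2%:E f' ->
  cLp mu 2%:E g -> {ae mu, forall x, f x = f' x} -> inner mu f g = inner mu f' g.
Proof.
move=> Lf Lf' Lg ff'.
have mg := cmeasurableJ (cLp2_measurable Lg).
apply: ae_eq_cintegral.
- exact: cmeasurableM (cLp2_measurable Lf) mg.
- exact: cmeasurableM (cLp2_measurable Lf') mg.
- by apply: aeS ff' => x ->.
Qed.

Lemma inner_affine a b (f g : K -> R[i]) : a != 0 -> cLp mu 2%:E f ->
  cLp mu 2%:E g ->
  inner mu (fun x => f (affine a b x)) (fun x => g (affine a b x)) =
  (abs a)^-1%:C * inner mu f g.
Proof.
move=> a0 Lf Lg; rewrite -(cintegral_affine S b a0)//; exact: cintegrable_inner.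
Qed.

(** Multiplication by [chi_n] on the Fourier side is a translation of [phi]. *)
Lemma fourier_coef n :
  inner mu (fun x => chi (u n * x) * F phi x) (F phi) = (n == 0%N)%:R.
Proof.
have LF : cLp mu 2%:E (F phi) by exact: fourier_L2_stable hF _ Lphi.
have Lc : cLp mu 2%:E (fun x => chi (u n * x) * F phi x).
  apply: cLp2_mul_le1; [exact: cmeasurable_chi S _| |exact: LF].
  by move=> x; rewrite (sqabs_chi S).
have La : cLp mu 2%:E (fun x => phi (affine 1 (u n) x)).
  by apply: (cLp2_affine S) => //; exact: oner_neq0.
have := fourier_affine S hF (u n) (oner_neq0 K) Lphi => e.
have -> : inner mu (fun x => chi (u n * x) * F phi x) (F phi) =
    inner mu (F (fun x => phi (affine 1 (u n) x))) (F phi).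
  apply: ae_eq_inner => //; first exact: fourier_L2_stable hF _ La.
  apply: aeS e => x ->; rewrite /modulate (abs1 S) !invr1 !mul1r.
  by rewrite [x * _]mulrC.
rewrite (fourier_L2_isometry hF)//.
have [k hk] := u_opp S n.
have := proj2 phi_on k 0%N; rewrite (u0 S).
have -> : (fun x : K => phi (x - u k)) = (fun x => phi (affine 1 (u n) x)).
  by apply/funext => x; rewrite /affine mul1r -hk opprK.
have -> : (fun x : K => phi (x - 0)) = phi by apply/funext => x; rewrite subr0.
move=> ->; congr (_%:R); congr nat_of_bool; apply/eqP/eqP => [k0|n0].
  by apply: (u_inj S); rewrite -[u n]opprK hk k0 !(u0 S) oppr0.
by apply: (u_inj S); rewrite -hk n0 !(u0 S) oppr0.
Qed.

Local Notation sq := ((Num.sqrt (q%:R : R))%:C).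

Lemma q_neq0 : q%:R != 0 :> R.
Proof. by rewrite pnatr_eq0 -lt0n (q_gt0 S). Qed.

Lemma sqrtq_gt0 : 0 < Num.sqrt (q%:R : R).
Proof. by rewrite sqrtr_gt0 ltr0n (q_gt0 S). Qed.

Lemma sqK : sq * ((Num.sqrt (q%:R : R))^-1)%:C = 1.
Proof. by rewrite -rmorphM/= divff// gt_eqF// sqrtq_gt0. Qed.

Lemma sqabs_sq : sqabs sq = q%:R.
Proof. by rewrite sqabsC sqr_sqrtr. Qed.

Definition scaled (k : nat) : K -> R[i] := fun x => sq * phi (t^-1 * x - u k).

Let phik (k : nat) : K -> R[i] := fun x => phi (x - u k).

Let scaledE k : scaled k = fun x => sq * phik k (affine t^-1 0 x).
Proof. by apply/funext => x; rewrite /phik /affine addr0. Qed.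

Let t'0 : t^-1 != 0. Proof. by rewrite invr_neq0// (t_neq0 S). Qed.

Lemma scaled_orthonormal : orthonormal_system mu scaled.
Proof.
have Lk k : cLp mu 2%:E (phik k) by case: phi_on => + _; apply.
have La k : cLp mu 2%:E (fun x => phik k (affine t^-1 0 x)).
  exact: (cLp2_affine S 0 t'0 (Lk k)).
split=> [k|j k]; first by rewrite scaledE; exact: cLp2Z.
rewrite !scaledE innerZl//; last exact: cLp2Z.
rewrite innerZr// inner_affine// (proj2 phi_on) (absV S) invrK (abs_t S).
rewrite !mulrA conjcC -!rmorphM/= -expr2 sqr_sqrtr// mulfV ?q_neq0//.
by rewrite mul1r.
Qed.

Let Lscaled k : cLp mu 2%:E (scaled k). Proof. by case: scaled_orthonormal. Qed.

Lemma fourier_scaled k : {ae mu, forall xi, F (scaled k) xi =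
  ((Num.sqrt (q%:R : R))^-1)%:C * (chi (u k * (t * xi)))^*%C * F phi (t * xi)}.
Proof.
have La : cLp mu 2%:E (fun x => phi (affine t^-1 (- u k) x)).
  exact: (cLp2_affine S _ t'0 Lphi).
have L0 := @cLp20 _ (borel K) R mu.
have := fourier_L2_linear hF sq La L0.
have -> : (fun y => sq * phi (affine t^-1 (- u k) y) + 0) = scaled k.
  by apply/funext => y; rewrite addr0.
move=> e1; have e0 := fourierB hF L0 L0.
have e2 := fourier_affine S hF (- u k) t'0 Lphi.
have e12 : {ae mu, forall xi, F (fun=> 0) xi = 0}.
  apply: aeS e0 => x; rewrite (_ : (fun=> 0 - 0) = fun=> 0); last first.
    by apply/funext => y; rewrite subrr.
  by rewrite subrr.
have e3 : {ae mu, forall xi, F (scaled k) xi = sq * F (fun x => phi (affine t^-1 (- u k) x)) xi}.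
  by apply: aeS2 _ e1 e12 => x -> ->; rewrite addr0.
apply: aeS2 _ e3 e2 => xi -> ->; rewrite /modulate (absV S) !invrK (abs_t S).
rewrite !mulrA -rmorphM/=.
have -> : Num.sqrt q%:R * q%:R^-1 = (Num.sqrt q%:R)^-1 :> R.
  rewrite -{2}[q%:R](@sqr_sqrtr R)// expr2 invfM mulrA mulfV ?mul1r//.
  by rewrite gt_eqF// sqrtq_gt0.
by rewrite mulrN (chiN S); congr (_ * (chi _)^*%C * _); ring.
Qed.

Section Symbol.
Variables (h : nat -> R[i]) (m : K -> R[i]).
Hypothesis hm : is_symbol mu chi D u q h m.

Let mm : cmeasurable (m : borel K -> R[i]). Proof. by case: hm. Qed.

Let T N (x : K) : R[i] :=
  (Num.sqrt q%:R)^-1%:C * (\sum_(k < N) h k * (chi (u k * x))^*%C).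

Let mTN N : cmeasurable (T N : borel K -> R[i]).
Proof.
apply: cmeasurableM; first exact: cmeasurable_cst.
apply: cmeasurable_sum => k _; apply: cmeasurableM; first exact: cmeasurable_cst.
exact: cmeasurable_chiJ S _.
Qed.

Let err N : \bar R := esqnorm mu (fun x : borel K => (\1_D x)%:C * (T N x - m x)).

Let err_small (e : R) : 0 < e -> \forall N \near \oo, (err N < e%:E)%E.
Proof.
move=> e0; have se : 0 < Num.sqrt e by rewrite sqrtr_gt0.
case: hm => _ _ /fine_cvgP[nfin ncvg].
have /cvgr_lt/(_ _ se) := ncvg.
apply: filterS2 nfin => N fN /= hN.
set g := fun x : borel K => (\1_D x)%:C * (T N x - m x).
have : (cnorm mu 2%:E g < (Num.sqrt e)%:E)%E.
  by rewrite -(fineK fN) lte_fin.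
by rewrite cnorm2_lt// sqr_sqrtr ?ltW.
Qed.

Let mtT N x : (\1_D x)%:C * T N x = (Num.sqrt q%:R)^-1%:C * partial_sum wave id h N x.
Proof.
rewrite /T /partial_sum mulrCA; congr (_ * _); rewrite mulr_sumr.
by apply: eq_bigr => k _; rewrite mulrCA.
Qed.

Let LT N : cLp mu 2%:E (fun x : borel K => (\1_D x)%:C * T N x).
Proof.
under eq_fun do rewrite mtT.
apply: cLp2Z; exact: (cLp2_partial_sum (wave_orthonormal S)).
Qed.

Lemma cLp2_symbol : cLp mu 2%:E (fun x : borel K => (\1_D x)%:C * m x).
Proof.
have [N _ /(_ N (leqnn N)) hN] := err_small ltr01.
have Lerr : cLp mu 2%:E (fun x : borel K => (\1_D x)%:C * (T N x - m x)).
  apply/cLp2P; split; last by apply: lt_trans hN _; rewrite ltry.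
  apply: cmeasurableM; first exact: cmeasurable_indicD S.
  exact: cmeasurableB.
have := cLp2B (LT N) Lerr; congr cLp; apply/funext => x.
by rewrite -mulrBr opprB addrC subrK.
Qed.

(** The factor [q^(1/2)] makes [h] the sequence of coefficients of this function
    of [L^2(D)] on [wave]. *)
Definition symbolD : K -> R[i] := fun x => sq * ((\1_D x)%:C * m x).

Lemma cLp2_symbolD : cLp mu 2%:E symbolD. Proof. exact: cLp2Z cLp2_symbol. Qed.

Let err_sqnorm N : (sqnorm mu (fun x : borel K => (\1_D x)%:C * (T N x - m x)))%:E = err N.
Proof.
rewrite -sqnormE//; have := cLp2B (LT N) cLp2_symbol; congr cLp; apply/funext => x.
by rewrite mulrBr.
Qed.

Lemma wave_expansion : L2cvg mu (partial_sum wave id h) symbolD.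
Proof.
have s0 := sqrtq_gt0; have q0 : 0 < q%:R :> R by rewrite ltr0n (q_gt0 S).
apply/cvgr0Pnorm_lt => e e0.
apply: filterS (err_small (divr_gt0 e0 q0)) => N.
rewrite -err_sqnorm lte_fin ltr_pdivlMr// mulrC => hN.
rewrite ger0_norm ?sqnorm_ge0//; apply: le_lt_trans hN.
rewrite -sqabs_sq -sqnormZ; last first.
  have := cLp2B (LT N) cLp2_symbol; congr cLp; apply/funext => x.
  by rewrite mulrBr.
rewrite le_eqVlt; apply/predU1P; left; congr sqnorm; apply/funext => x.
rewrite mulrBr mtT mulrBr [sq * (_%:C * _)]mulrA sqK mul1r.
by rewrite /symbolD.
Qed.

Variable psi : K -> R[i].
Hypothesis Lpsi : cLp mu 2%:E psi.
Hypothesis psi_hat : {ae mu, forall xi, F psi xi = m (t * xi) * F phi (t * xi)}.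

(** On the Fourier side the error is [(T_N - m)(t xi) * phihat (t xi)]; as
    [T_N - m] is periodic, its weighted norm over [K] is its norm over [D]. *)
Lemma scaled_expansion : L2cvg mu (partial_sum scaled id h) psi.
Proof.
have q0 : 0 < q%:R :> R by rewrite ltr0n (q_gt0 S).
have Lphat : cLp mu 2%:E (F phi) by exact: fourier_L2_stable hF _ Lphi.
have LP N : cLp mu 2%:E (partial_sum scaled id h N).
  exact: (cLp2_partial_sum scaled_orthonormal).
have mper j : {ae mu, forall x, m (x + u j) = m x} by case: hm.
have main N : (sqnorm mu (fun x => partial_sum scaled id h N x - psi x))%:E =
    (q%:R%:E * err N)%E.
  rewrite -sqnormE; last exact: cLp2B.
  rewrite sqnormE; last exact: cLp2B.
  rewrite -(sqnorm_fourierB hF)// -sqnormE; last first.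
    by apply: cLp2B; apply: (fourier_L2_stable hF).
  pose G x := (T N x - m x) * F phi x.
  have mG : cmeasurable (G : borel K -> R[i]).
    apply: cmeasurableM; last exact: cLp2_measurable Lphat.
    exact: cmeasurableB.
  have -> : esqnorm mu (fun x => F (partial_sum scaled id h N) x - F psi x) =
      esqnorm mu (fun x => G (affine t 0 x)).
    apply: ae_eq_esqnorm.
    - by apply: cmeasurableB; apply: cLp2_measurable; apply: (fourier_L2_stable hF).
    - exact: cmeasurable_affine.
    - have e1 := fourier_sum hF h N Lscaled.
      have e2 : {ae mu, forall x, forall k, F (scaled k) x = ((Num.sqrt (q%:R : R))^-1)%:C *
          (chi (u k * (t * x)))^*%C * F phi (t * x)}.
        by apply: ae_foralln => k; exact: fourier_scaled.
      apply: aeS2 _ (aeS2 _ e1 e2) psi_hat => [x|x y1 y2]; last exact: (conj y1 y2).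
      move=> [e1x e2x] ->; rewrite /partial_sum e1x /G /affine addr0 mulrBl /T.
      congr (_ - _); rewrite -mulrA mulr_suml mulr_sumr.
      by apply: eq_bigr => k _; rewrite e2x; ring.
  rewrite (esqnorm_affine S)// ?(t_neq0 S)// (abs_t S) invrK; congr (_ * _)%E.
  have : (\int[mu]_x (sqabs (T N x - m x) * sqabs (F phi x))%:E =
      \int[mu]_(x in DB) (sqabs (T N x - m x))%:E)%E.
    apply: (integral_periodic_weight S Lphat fourier_coef).
    - by apply: measurable_sqabs; exact: cmeasurableB.
    - by move=> x; exact: sqabs_ge0.
    - move=> j; apply: aeS (mper j) => x ->; congr (sqabs (_ - _)).
      congr (_ * _); apply: eq_bigr => k _.
      by rewrite mulrDr (chiD S) (chi_uu S) mulr1.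
  have -> : esqnorm mu G = (\int[mu]_x (sqabs (T N x - m x) * sqabs (F phi x))%:E)%E.
    by apply: eq_integral => x _; rewrite sqabsM.
  move=> ->; rewrite /err /esqnorm [LHS]integral_mkcond.
apply: eq_integral => x _.
  rewrite patchE sqabsM (sqabs_indicD (abs := abs)) indicE.
  by case: (_ \in _); rewrite ?mul1r ?mul0r.
apply/cvgr0Pnorm_lt => e e0.
apply: filterS (err_small (divr_gt0 e0 q0)) => N; rewrite -err_sqnorm => hN.
rewrite ger0_norm ?sqnorm_ge0// -lte_fin main -err_sqnorm -EFinM lte_fin mulrC.
by rewrite -ltr_pdivlMr// -lte_fin.
Qed.

End Symbol.
End Multiresolution.

Arguments scaled {R K} p {c} q t eps phi k.
Arguments symbolD {R K} abs q m.

(** * Uniqueness of Fourier coefficients *)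

Section Subdivision.
Context {R : realType} {K : topologicalFieldType}.
Context {mu : {measure set (borel K) -> \bar R}} {abs : K -> R}.
Context {p c q : nat} {t : K} {eps : 'I_c -> K} {chi : K -> R[i]}.
Hypothesis S : local_field_setting mu abs p q t eps chi.

Local Notation D := (integers abs).
Local Notation u := (u p eps t).
Local Notation wave := (wave (abs := abs) (p := p) (t := t) (eps := eps) (chi := chi)).

Lemma indicD_idem x : (\1_D x)%:C * (\1_D x)%:C = (\1_D x)%:C :> R[i].
Proof. by rewrite indicE; case: (_ \in _); rewrite ?mulr1 ?mulr0. Qed.

Lemma sqabs_indicD_le1 x : sqabs ((\1_D x)%:C : R[i]) <= 1.
Proof. by rewrite (sqabs_indicD (abs := abs)) indicE; case: (_ \in _). Qed.

(** [D] is the disjoint union of the sets [t * (u s + D)]. *)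
Lemma indicD_split x :
  (\1_D x)%:C = \sum_(s < q) (\1_D (t^-1 * x - u s))%:C :> R[i].
Proof.
have t0 := t_neq0 S.
have memE (s : nat) : (s < q)%N -> D (t^-1 * x - u s) -> D x.
  move=> sq Ds; have := abs_u S (N := 1) (n := s); rewrite expn1 expr1 => /(_ sq) us.
  have : abs (t^-1 * x) <= (abs t)^-1.
    rewrite -[t^-1 * x](subrK (u s)); apply: (absD S) => //.
    by apply: (le_trans Ds); rewrite invf_ge1 ?(abst_gt0 S)// ltW// (abst_lt1 S).
  by rewrite -(integers_mult S)// mulVKf.
have [Dx|nDx] := pselect (D x); last first.
  rewrite indicE memNset// big1// => s _; rewrite indicE memNset//.
  by move=> Ds; apply: nDx; exact: memE (ltn_ord s) Ds.
have tx : abs (t^-1 * x) <= (abs t)^-1 ^+ 1.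
  by rewrite expr1 -(integers_mult S)// mulVKf.
have [s sq Ds] := u_cover S tx; rewrite expn1 in sq.
rewrite indicE mem_set// (bigD1 (Ordinal sq))//= indicE mem_set// big1 ?addr0//.
move=> s' ss'; rewrite indicE memNset// => Ds'.
have : u s' = u s.
  congr u; apply: (u_coset_inj S).
  have -> : u s' - u s = (t^-1 * x - u s) - (t^-1 * x - u s') by ring.
  exact: integersB S _ _ Ds Ds'.
by move=> /(u_inj S) e; move: ss'; rewrite -(inj_eq val_inj)/= e eqxx.
Qed.

Lemma integral_subdivide (H : K -> R[i]) :
  cintegrable mu (fun x : borel K => (\1_D x)%:C * H x) ->
  (forall s : nat, (s < q)%N ->
    cintegrable mu (fun x : borel K => (\1_D x)%:C * H (t * x + t * u s))) /\
  cintegral mu (fun x : borel K => (\1_D x)%:C * H x) =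
  (abs t)%:C * \sum_(s < q)
    cintegral mu (fun x : borel K => (\1_D x)%:C * H (t * x + t * u s)).
Proof.
move=> intH; have t0 := t_neq0 S.
pose P (s : nat) x := ((\1_D x)%:C * H x) * (\1_D (t^-1 * x - u s))%:C.
have intP s : cintegrable mu (P s : borel K -> R[i]).
  apply: cintegrable_mul_le1 => //; last by move=> x; exact: sqabs_indicD_le1.
  by have := cmeasurable_affine t^-1 (- u s) (cmeasurable_indicD S); apply.
have PE (s : nat) : (s < q)%N ->
    (fun x => P s (affine t (t * u s) x)) = (fun x => (\1_D x)%:C * H (t * x + t * u s)).
  move=> sq; apply/funext => x; rewrite /P /affine mulrDr !mulKf// addrK.
  rewrite mulrAC; congr (_ * _).
  (* the class [t * (u s + D)] lies in [D] *)
  have := indicD_split (t * x + t * u s); rewrite (bigD1 (Ordinal sq))//=.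
  rewrite mulrDr !mulKf// addrK [\1_D x]indicE.
  have [Dx|nDx] := boolP (x \in D); last by rewrite mulr0.
  rewrite inE in Dx; rewrite mulr1 indicE mem_set//.
  rewrite -mulrDr (integers_mult S)//; apply: (absD S).
    by apply: (le_trans Dx); rewrite invf_ge1 ?(abst_gt0 S)// ltW// (abst_lt1 S).
  by have := abs_u S (N := 1) (n := s); rewrite expn1 expr1; apply.
have intA s sq := cintegrable_affine S (t * u s) t0 (intP s).
split=> [s sq|]; first by rewrite -PE//; exact: intA.
have -> : (fun x : borel K => (\1_D x)%:C * H x) = (fun x => \sum_(s < q) P s x).
  apply/funext => x; rewrite -mulr_sumr -indicD_split mulrAC.
  by rewrite indicD_idem.
rewrite cintegral_sum; last by move=> s _; exact: intP.
rewrite mulr_sumr; apply: eq_bigr => s _.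
rewrite -PE// (cintegral_affine S)//.
by rewrite mulrA -rmorphM/= divff ?mul1r// gt_eqF// (abst_gt0 S).
Qed.

(** Summed against the Dirichlet kernel, the coefficients give the integrals over
    all disks; the positive and negative parts of [H] then have equal integrals
    over disks. *)
Lemma fourier_unique (H : K -> R[i]) :
  cintegrable mu (fun x : borel K => (\1_D x)%:C * H x) ->
  (forall n, cintegral mu (fun x : borel K =>
     ((\1_D x)%:C * H x) * (chi (u n * x))^*%C) = 0) ->
  {ae mu, forall x, D x -> H x = 0}.
Proof.
move=> intH coef0.
have mD := measurable_integers S.
pose HD x := (\1_D x)%:C * H x.
have intHc n : cintegrable mu (fun x : borel K => HD x * chi (u n * x)).
  apply: cintegrable_mul_le1 => //; first exact: cmeasurable_chi S _.
  by move=> x; rewrite (sqabs_chi S).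
have coef0' n : cintegral mu (fun x : borel K => HD x * chi (u n * x)) = 0.
  have [k hk] := u_opp S n; rewrite -(coef0 k); congr cintegral.
  by apply/funext => x; rewrite -hk mulNr (chiN S) conjcK.
have disk0 N x0 : D x0 ->
    cintegral mu (fun x : borel K => (\1_(disk abs t N x0) x)%:C * H x) = 0.
  move=> Dx0.
  have -> : (fun x : borel K => (\1_(disk abs t N x0) x)%:C * H x) = (fun x =>
      ((q%:R ^+ N)^-1)%:C * \sum_(n < q ^ N) (chi (u n * x0))^*%C * (HD x * chi (u n * x))).
    apply/funext => x.
    transitivity (dirichlet p q t eps chi N (x - x0) * HD x).
      rewrite /HD; have [Dx|nDx] := pselect (D x).
        by rewrite (dirichlet_disk S)// [\1_D x]indicE mem_set// mul1r.
      rewrite [\1_D x]indicE memNset// mul0r mulr0 indicE memNset ?mul0r//.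
      by move=> /(disk_D S Dx0).
    rewrite /dirichlet -mulrA mulr_suml; congr (_ * _); apply: eq_bigr => n _.
    by rewrite mulrBr (chiB S); ring.
  rewrite cintegralZ; last by apply: cintegrable_sum => n _; exact: cintegrableZ.
  rewrite cintegral_sum; last by move=> n _; exact: cintegrableZ.
  by rewrite big1 ?mulr0// => n _; rewrite cintegralZ// coef0' mulr0.
have real0 (g : K -> R) :
    mu.-integrable [set: borel K] (EFin \o (fun x => \1_D x * g x)) ->
    (forall N x0, D x0 -> \int[mu]_x (\1_(disk abs t N x0) x * g x) = 0) ->
    {ae mu, forall x, D x -> g x = 0}.
  move=> intg g0.
  have intgD : mu.-integrable (D : set (borel K)) (EFin \o g).
    apply/(integrable_mkcond _ mD); apply: eq_integrable intg => // x _ /=.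
    by rewrite patchE indicE; case: (_ \in _); rewrite ?mul1r ?mul0r.
  have ip := integrable_funepos mD intgD; have im := integrable_funeneg mD intgD.
  have : {ae mu, forall x, D x -> ((EFin \o g)^\+ x = (EFin \o g)^\- x)%E}.
    apply: (ae_eq_disks S) => //; try by move=> x; rewrite ?funepos_ge0 ?funeneg_ge0.
    move=> N x0 Dx0; have mB := measurable_disk S N x0.
    have intB : mu.-integrable (disk abs t N x0 : set (borel K)) (EFin \o g).
      by apply: integrableS intgD => //; exact: disk_D S _ _ Dx0.
    have : (\int[mu]_(x in (disk abs t N x0 : set (borel K))) (g x)%:E = 0)%E.
      rewrite -[LHS]fineK; last exact: integrable_fin_num.
      rewrite (_ : fine _ = 0)// -[RHS](g0 N x0 Dx0) /Rintegral; congr fine.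
      rewrite [LHS]integral_mkcond; apply: eq_integral => x _.
      by rewrite patchE indicE; case: (_ \in _); rewrite ?mul1r ?mul0r.
    rewrite integralE => /eqP; rewrite sube_eq; first by rewrite add0e => /eqP.
      exact: integrable_pos_fin_num.
    by rewrite fin_num_adde_defl// integrable_neg_fin_num.
  apply: aeS => x h Dx; have := h Dx; rewrite funeposE funenegE /=.
  rewrite -?EFinN -!EFin_max => -[].
  by rewrite /Num.max; case: ifP => g1; case: ifP => g2; move: g1 g2; lra.
have [i1 i2] := intH.
have r1 : {ae mu, forall x, D x -> complex.Re (H x) = 0}.
  apply: real0 => [|N x0 Dx0].
    by apply: eq_integrable i1 => // x _ /=; rewrite ReM ReC ImC mul0r subr0.
  have := congr1 (@complex.Re _) (disk0 N x0 Dx0); rewrite Re_cintegral => e.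
  apply: etrans e; by apply: eq_Rintegral => x _; rewrite ReM ReC ImC mul0r subr0.
have r2 : {ae mu, forall x, D x -> complex.Im (H x) = 0}.
  apply: real0 => [|N x0 Dx0].
    by apply: eq_integrable i2 => // x _ /=; rewrite ImM ReC ImC mul0r addr0.
  have := congr1 (@complex.Im _) (disk0 N x0 Dx0); rewrite Im_cintegral => e.
  apply: etrans e; by apply: eq_Rintegral => x _; rewrite ImM ReC ImC mul0r addr0.
by apply: aeS2 _ r1 r2 => x h1 h2 Dx; apply: complexP; [exact: h1|exact: h2].
Qed.

End Subdivision.

(** * Translates of the [psi l] *)

Lemma L2cvg_isometry (d : measure_display) (T : measurableType d) (R : realType)
    (mu : {measure set T -> \bar R}) (f_ g_ : nat -> T -> R[i]) (f g : T -> R[i]) :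
  (forall N, sqnorm mu (fun x => g_ N x - g x) = sqnorm mu (fun x => f_ N x - f x)) ->
  L2cvg mu f_ f -> L2cvg mu g_ g.
Proof. by rewrite /L2cvg => /funext ->. Qed.

Section Packets.
Context {R : realType} {K : topologicalFieldType}.
Context {mu : {measure set (borel K) -> \bar R}} {abs : K -> R}.
Context {p c q : nat} {t : K} {eps : 'I_c -> K} {chi : K -> R[i]}.
Hypothesis S : local_field_setting mu abs p q t eps chi.
Variable F : (K -> R[i]) -> K -> R[i].
Hypothesis hF : is_fourier_L2 mu chi F.

Local Notation D := (integers abs).
Local Notation u := (u p eps t).
Local Notation W := (wave (abs := abs) (p := p) (t := t) (eps := eps) (chi := chi)).

Variable phi : K -> R[i].
Hypothesis Lphi : cLp mu 2%:E phi.
Hypothesis phi_on : orthonormal_system mu (fun (k : nat) (x : K) => phi (x - u k)).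

Local Notation E := (scaled p q t eps phi).

Let oE : orthonormal_system mu E. Proof. exact: scaled_orthonormal S _ phi_on. Qed.
Let oW : orthonormal_system mu W. Proof. exact: wave_orthonormal S. Qed.
Let LE k : cLp mu 2%:E (E k). Proof. by case: oE. Qed.

(** The [u k] form an additive group that contains [t^-1 * u n]; translating by
    [u n] therefore only permutes the indices of the scaled functions. *)
Lemma index_shift : {sigma : nat -> nat -> nat |
  forall n k, u (sigma n k) = t^-1 * u n + u k}.
Proof.
apply: cid; have /choice[f hf] : forall nk : nat * nat, exists j,
    u j = t^-1 * u nk.1 + u nk.2.
  move=> [n k] /=; rewrite -(u_mul S); have [j hj] := u_add S (q * n) k.
  by exists j.
by exists (fun n k => f (n, k)) => n k; rewrite hf.
Qed.

Definition sigma : nat -> nat -> nat := sval index_shift.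

Lemma sigmaE n k : u (sigma n k) = t^-1 * u n + u k.
Proof. exact: (svalP index_shift). Qed.

Lemma sigma_inj n : injective (sigma n).
Proof.
move=> k k' e; apply: (u_inj S); apply: (addrI (t^-1 * u n)).
by rewrite -!sigmaE e.
Qed.

Section Single.
Variables (h : nat -> R[i]) (m psi : K -> R[i]).
Hypothesis hm : is_symbol mu chi D u q h m.
Hypothesis Lpsi : cLp mu 2%:E psi.
Hypothesis psi_hat : {ae mu, forall xi, F psi xi = m (t * xi) * F phi (t * xi)}.

Lemma cLp2_translate n : cLp mu 2%:E (fun x : K => psi (x - u n)).
Proof.
have := cLp2_affine S (- u n) (oner_neq0 K) Lpsi.
by congr cLp; apply/funext => x; rewrite /affine mul1r.
Qed.

Lemma translate_expansion n :
  L2cvg mu (partial_sum E (sigma n) h) (fun x : K => psi (x - u n)).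
Proof.
apply: L2cvg_isometry (scaled_expansion S hF Lphi phi_on hm Lpsi psi_hat) => N.
have Ld : cLp mu 2%:E (fun x => partial_sum E id h N x - psi x).
  by apply: cLp2B => //; exact: (cLp2_partial_sum oE).
rewrite -[RHS]mul1r -[X in X * _]invr1 -(abs1 S).
rewrite -(sqnorm_affine S (- u n) (oner_neq0 K) Ld); congr sqnorm; apply/funext => x.
rewrite /affine mul1r; congr (_ - _); apply: eq_bigr => k _; congr (_ * _).
by rewrite /scaled sigmaE; congr (_ * phi _); ring.
Qed.

(** The function on [D] whose coefficients are those of a translate of [psi]. *)
Definition modulated (n : nat) : K -> R[i] :=
  fun x => (chi (t^-1 * u n * x))^*%C * symbolD abs q m x.

Lemma cLp2_modulated n : cLp mu 2%:E (modulated n).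
Proof.
apply: cLp2_mul_le1; [exact: cmeasurable_chiJ S _| |exact: (cLp2_symbolD S hm)].
by move=> x; rewrite sqabsJ (sqabs_chi S).
Qed.

Lemma modulated_expansion n : L2cvg mu (partial_sum W (sigma n) h) (modulated n).
Proof.
apply: L2cvg_isometry (wave_expansion S hm) => N; rewrite /sqnorm; apply: esym.
rewrite -(@esqnorm_mul_unit _ _ _ mu (fun x => (chi (t^-1 * u n * x))^*%C)); last first.
  by move=> x; rewrite sqabsJ (sqabs_chi S).
congr (fine (esqnorm mu _)); apply/funext => x.
rewrite mulrBr; congr (_ - _); rewrite /partial_sum mulr_sumr.
apply: eq_bigr => k _.
rewrite mulrCA; congr (_ * _); rewrite /wave mulrCA; congr (_ * _).
by rewrite sigmaE mulrDl (chiD S) conjcM.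
Qed.

Lemma translate_closed_span n : closed_span mu E (fun x : K => psi (x - u n)).
Proof.
apply: (closed_span_lim LE _ (cLp2_translate n) (translate_expansion n)) => N.
by apply: (closed_span_sum LE) => k; apply: (closed_spanZ LE); exact: closed_span_gen.
Qed.

Lemma inner_scaled_translate n k :
  inner mu (E (sigma n k)) (fun x : K => psi (x - u n)) = (h k)^*%C.
Proof.
exact: (inner_coef oE k (@sigma_inj n) (cLp2_translate n) (translate_expansion n)).
Qed.

Lemma coef_cvg : \sum_(k < N) sqabs (h k) @[N --> \oo] --> sqnorm mu psi.
Proof.
have LP N : cLp mu 2%:E (partial_sum E id h N) by exact: (cLp2_partial_sum oE).
have := sqnorm_cvg LP Lpsi (scaled_expansion S hF Lphi phi_on hm Lpsi psi_hat).
by under eq_fun do rewrite (sqnorm_partial_sum oE)//.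
Qed.

End Single.
End Packets.

(** * Gram matrix and completeness *)

Lemma ae_forall_fin (d : measure_display) (T : measurableType d) (R : realType)
    (mu : {measure set T -> \bar R}) (I : finType) (P : I -> T -> Prop) :
  (forall i, {ae mu, forall x, P i x}) -> {ae mu, forall x, forall i, P i x}.
Proof. exact: filter_forall. Qed.

Lemma sum_nat_mul (V : nmodType) (q N : nat) (f : nat -> V) :
  \sum_(k < q * N) f k = \sum_(r < q) \sum_(n < N) f (r + q * n)%N.
Proof.
elim: N => [|N IH].
  by rewrite muln0 big_ord0 big1// => r _; rewrite big_ord0.
rewrite mulnS addnC big_split_ord/= IH.
under [RHS]eq_bigr do rewrite big_ord_recr/=.
rewrite big_split/=; congr (_ + _); apply: eq_bigr => r _.
by rewrite addnC.
Qed.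

Section WaveletPackets.
Context {R : realType} {K : topologicalFieldType}.
Context {mu : {measure set (borel K) -> \bar R}} {abs : K -> R}.
Context {p c q : nat} {t : K} {eps : 'I_c -> K} {chi : K -> R[i]}.
Hypothesis S : local_field_setting mu abs p q t eps chi.
Variable F : (K -> R[i]) -> K -> R[i].
Hypothesis hF : is_fourier_L2 mu chi F.

Local Notation D := (integers abs).
Local Notation u := (u p eps t).
Local Notation W := (wave (abs := abs) (p := p) (t := t) (eps := eps) (chi := chi)).

Variable phi : K -> R[i].
Hypothesis Lphi : cLp mu 2%:E phi.
Hypothesis phi_on : orthonormal_system mu (fun (k : nat) (x : K) => phi (x - u k)).

Local Notation modu := (modulated (abs := abs) (p := p) (q := q) (t := t) (eps := eps) (chi := chi)).
Local Notation E := (scaled p q t eps phi).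

Let oE : orthonormal_system mu E. Proof. exact: scaled_orthonormal S _ phi_on. Qed.
Let oW : orthonormal_system mu W. Proof. exact: wave_orthonormal S. Qed.
Let LE k : cLp mu 2%:E (E k). Proof. by case: oE. Qed.

Variables (h : 'I_q -> nat -> R[i]) (m psi : 'I_q -> K -> R[i]).
Hypothesis hm : forall l, is_symbol mu chi D u q (h l) (m l).
Hypothesis Lpsi : forall l, cLp mu 2%:E (psi l).
Hypothesis psi_hat : forall l,
  {ae mu, forall xi, F (psi l) xi = m l (t * xi) * F phi (t * xi)}.

Definition packet (l : 'I_q) (n : nat) : K -> R[i] := fun x => psi l (x - u n).

Let Lpacket l n : cLp mu 2%:E (packet l n).
Proof. exact: cLp2_translate S _ (Lpsi l) n. Qed.

(** The entries of [M * M^*]. *)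
Definition gram (l l' : 'I_q) (x : K) : R[i] :=
  \sum_(s < q) m l (t * x + t * u s) * (m l' (t * x + t * u s))^*%C.

Let B n n' x : R[i] := (chi (u n * x))^*%C * chi (u n' * x).

Let B_le1 n n' x : sqabs (B n n' x) <= 1.
Proof. by rewrite sqabsM sqabsJ !(sqabs_chi S) mulr1. Qed.

Let mB n n' : cmeasurable (B n n' : borel K -> R[i]).
Proof. by apply: cmeasurableM; [exact: cmeasurable_chiJ S _|exact: cmeasurable_chi S _]. Qed.

Let term l l' (s : nat) x := (\1_D x)%:C *
  (m l (t * x + t * u s) * (m l' (t * x + t * u s))^*%C).

(** The packets are replaced by functions on [D] with the same coefficients, and
    [D] is cut into the [q] pieces that become the columns of [M]; the factor [B]
    does not see the translation by [u s] since [chi (u n * u s) = 1]. *)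
Lemma inner_packet_sum l l' n n' :
  (forall s : nat, (s < q)%N -> cintegrable mu (fun x : borel K => term l l' s x * B n n' x)) /\
  inner mu (packet l n) (packet l' n') =
  \sum_(s < q) cintegral mu (fun x : borel K => term l l' s x * B n n' x).
Proof.
have q0 := q_neq0 S.
pose Hf x := q%:R%:C * ((m l x * (m l' x)^*%C) *
  ((chi (t^-1 * u n * x))^*%C * chi (t^-1 * u n' * x))).
have L1 := cLp2_modulated S (hm l) n; have L2 := cLp2_modulated S (hm l') n'.
have modE x : modu (m l) n x * (modu (m l') n' x)^*%C = (\1_D x)%:C * Hf x.
  rewrite /modulated /symbolD /Hf !conjcM conjcK !conjcC.
  rewrite -[in RHS]indicD_idem -[q%:R in RHS](@sqr_sqrtr R)// expr2 rmorphM/=.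
  by ring.
have intH : cintegrable mu (fun x : borel K => (\1_D x)%:C * Hf x).
  by have := cintegrable_inner L1 L2; congr cintegrable; apply/funext.
have [int_s sum_s] := integral_subdivide S intH.
have HfE s x : (\1_D x)%:C * Hf (t * x + t * u s) = q%:R%:C * (term l l' s x * B n n' x).
  rewrite /Hf /term /B.
  have argE k : t^-1 * u k * (t * x + t * u s) = u k * x + u k * u s.
    by field; exact: t_neq0 S.
  by rewrite !argE !(chiD S) !(chi_uu S) !mulr1; ring.
have termE s : (fun x : borel K => term l l' s x * B n n' x) =
    (fun x => (q%:R^-1)%:C * ((\1_D x)%:C * Hf (t * x + t * u s))).
  by apply/funext => x; rewrite HfE mulrA -rmorphM/= mulVf// mul1r.
split=> [s sq|]; first by rewrite termE; apply: cintegrableZ; exact: int_s.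
have -> : inner mu (packet l n) (packet l' n') =
    inner mu (modu (m l) n) (modu (m l') n').
  apply: (inner_transfer oE oW (Lpacket l n) (Lpacket l' n') L1 L2
    (translate_expansion S hF Lphi phi_on (hm l) (Lpsi l) (psi_hat l) n)
    (translate_expansion S hF Lphi phi_on (hm l') (Lpsi l') (psi_hat l') n')
    (modulated_expansion S (hm l) n) (modulated_expansion S (hm l') n')).
rewrite /inner; under eq_fun do rewrite modE.
rewrite sum_s (abs_t S) mulr_sumr; apply: eq_bigr => s _.
by rewrite termE cintegralZ//; exact: int_s.
Qed.

Let gramE l l' x : (\1_D x)%:C * gram l l' x = \sum_(s < q) term l l' s x.
Proof. by rewrite /gram mulr_sumr. Qed.

Lemma cintegrable_gram l l' :
  cintegrable mu (fun x : borel K => (\1_D x)%:C * gram l l' x).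
Proof.
under eq_fun do rewrite gramE; apply: cintegrable_sum => s _.
have [/(_ s (ltn_ord s)) + _] := inner_packet_sum l l' 0 0.
congr cintegrable; apply/funext => x.
by rewrite /B (u0 S) mul0r (chi0 S) conjc1 !mulr1.
Qed.

Lemma packet_gram l l' n n' : inner mu (packet l n) (packet l' n') =
  cintegral mu (fun x : borel K => ((\1_D x)%:C * gram l l' x) * B n n' x).
Proof.
have [int_s ->] := inner_packet_sum l l' n n'.
rewrite -cintegral_sum; last by move=> s _; exact: int_s.
by congr cintegral; apply/funext => x; rewrite gramE mulr_suml.
Qed.

Let WB n n' x : W n x * (W n' x)^*%C = (\1_D x)%:C * B n n' x.
Proof.
by rewrite /wave !conjcM conjcC conjcK -[in RHS]indicD_idem /B; ring.
Qed.

(** Orthonormality prescribes all the Fourier coefficients of the entries of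
    [M * M^*], which determine them. *)
Lemma packet_orthonormal_gram :
  (forall l l' n n', inner mu (packet l n) (packet l' n') =
     ((l == l') && (n == n'))%:R) <->
  {ae mu, forall x, forall l l', D x -> gram l l' x = (l == l')%:R}.
Proof.
split=> [on|ae_gram l l' n n'].
  apply: ae_forall_fin => l; apply: ae_forall_fin => l'.
  have intc : cintegrable mu (fun x : borel K => (\1_D x)%:C * (l == l')%:R : R[i]).
    have := cintegrableZ (l == l')%:R (cintegrable_inner (cLp2_wave S 0) (cLp2_wave S 0)).
    congr cintegrable; apply/funext => x.
    by rewrite WB /B (u0 S) mul0r (chi0 S) conjc1 !mulr1 mulrC.
  have diffE x : (\1_D x)%:C * (gram l l' x - (l == l')%:R) =
      (\1_D x)%:C * gram l l' x + (-1) * ((\1_D x)%:C * (l == l')%:R) by ring.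
  have intd : cintegrable mu (fun x : borel K => (\1_D x)%:C * (gram l l' x - (l == l')%:R)).
    under eq_fun do rewrite diffE.
    by apply: cintegrableD; [exact: cintegrable_gram|exact: cintegrableZ].
  have unique := fourier_unique S intd _.
  apply: aeS (unique _) => [x h0 /h0/eqP|n]; first by rewrite subr_eq0 => /eqP.
  have intG : cintegrable mu (fun x : borel K => ((\1_D x)%:C * gram l l' x) * B n 0 x).
    by apply: cintegrable_mul_le1 => //; exact: cintegrable_gram.
  have intW := cintegrable_inner (cLp2_wave S n) (cLp2_wave S 0).
  have -> : (fun x : borel K => (\1_D x)%:C * (gram l l' x - (l == l')%:R) *
      (chi (u n * x))^*%C) = (fun x => ((\1_D x)%:C * gram l l' x) * B n 0 x +
      (- (l == l')%:R) * (W n x * (W 0 x)^*%C)).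
    by apply/funext => x; rewrite WB /B (u0 S) mul0r (chi0 S); ring.
  rewrite cintegralD//; last exact: cintegrableZ.
  rewrite cintegralZ// -packet_gram on -[cintegral _ _]/(inner mu (W n) (W 0%N)).
  by rewrite (proj2 oW) -mulnb natrM; ring.
rewrite packet_gram.
have -> : cintegral mu (fun x : borel K => ((\1_D x)%:C * gram l l' x) * B n n' x) =
    cintegral mu (fun x : borel K => (l == l')%:R * (W n x * (W n' x)^*%C)).
  apply: ae_eq_cintegral.
  - apply: cmeasurableM (mB n n').
    exact: cintegrable_measurable (cintegrable_gram l l').
  - apply: cmeasurableM; first exact: cmeasurable_cst.
    exact: cintegrable_measurable (cintegrable_inner (cLp2_wave S n) (cLp2_wave S n')).
  - apply: aeS ae_gram => x /(_ l l') h'; rewrite WB.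
    have [Dx|nDx] := pselect (D x); first by rewrite h'//; ring.
    by rewrite indicE memNset// !mul0r mulr0.
rewrite cintegralZ; last exact: cintegrable_inner (cLp2_wave S n) (cLp2_wave S n').
by rewrite -[cintegral _ _]/(inner mu (W n) (W n')) (proj2 oW) -natrM mulnb.
Qed.

Lemma index_difference : {d : nat -> nat -> nat | forall j n, u (d j n) = u j - u n}.
Proof.
apply: cid; have /choice[f hf] : forall jn : nat * nat, exists k,
    u k = u jn.1 - u jn.2.
  by move=> [j n] /=; have [k hk] := u_sub S j n; exists k.
by exists (fun j n => f (j, n)) => j n; rewrite hf.
Qed.

Let d := sval index_difference.
Let dE j n : u (d j n) = u j - u n. Proof. exact: (svalP index_difference). Qed.

(** Among the translates of [psi l], the one by [u (d j n)] has its coefficient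
    number [r + q * n] on the scaled function number [r + q * j]. *)
Lemma inner_scaled_packet l j n r : (r < q)%N ->
  inner mu (E (r + q * j)) (packet l (d j n)) = (h l (r + q * n))^*%C.
Proof.
move=> rq; have <- : sigma S (d j n) (r + q * n) = (r + q * j)%N.
  apply: (u_inj S); rewrite (sigmaE S) dE !(u_split S)//; ring.
exact: (inner_scaled_translate S hF Lphi phi_on (hm l) (Lpsi l) (psi_hat l)).
Qed.

Section Orthonormal.
Hypothesis on : orthonormal_system mu (fun ln : 'I_q * nat => packet ln.1 ln.2).

Let rows j N : seq ('I_q * nat) := [seq (l, d j n) | l <- enum 'I_q, n <- iota 0 N].

Let rows_uniq j N : uniq (rows j N).
Proof.
apply: allpairs_uniq; [exact: enum_uniq|exact: iota_uniq|].
move=> [l n] [l' n'] _ _ /= [-> /(congr1 u)]; rewrite !dE => /addrI/oppr_inj/(u_inj S).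
by move=> ->.
Qed.

Let energy r N : R := \sum_(l < q) \sum_(n < N) sqabs (h l (r + q * n)).

Let sum_rows r j N : (r < q)%N ->
  \sum_(i <- rows j N) sqabs (inner mu (E (r + q * j)) (packet i.1 i.2)) = energy r N.
Proof.
move=> rq; rewrite big_allpairs_dep big_enum/=; apply: eq_bigr => l _.
have -> : iota 0 N = index_iota 0 N by rewrite /index_iota subn0.
rewrite big_mkord; apply: eq_bigr => n _.
by rewrite inner_scaled_packet// sqabsJ.
Qed.

Let sqnormE1 k : sqnorm mu (E k) = 1.
Proof. by apply: (@complexI R); rewrite -inner_sqnorm (proj2 oE) eqxx. Qed.

Let energy_le1 r N : (r < q)%N -> energy r N <= 1.
Proof.
move=> rq; rewrite -(sum_rows 0 N rq) -(sqnormE1 (r + q * 0)).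
exact: (bessel on (LE _) (rows_uniq 0 N)).
Qed.

(** The [q] energies are at most one by Bessel's inequality and their sum tends
    to the sum of the squared norms of the [q] unit vectors [psi l], so each of
    them tends to one. *)
Let energy_gt r e : (r < q)%N -> 0 < e -> exists N, 1 - e < energy r N.
Proof.
move=> rq e0; have q0 : 0 < q%:R :> R by rewrite ltr0n (q_gt0 S).
have npsi l : sqnorm mu (psi l) = 1.
  apply: (@complexI R); rewrite -inner_sqnorm; have := proj2 on (l, 0%N) (l, 0%N).
  rewrite eqxx /= => e1; apply: etrans e1; congr inner; apply/funext => x;
    by rewrite /packet (u0 S) subr0.
have near_l l : \forall N \near \oo, 1 - e / q%:R < \sum_(k < N) sqabs (h l k).
  have := coef_cvg S hF Lphi phi_on (hm l) (Lpsi l) (psi_hat l).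
  rewrite npsi => /cvgr_gt; apply; rewrite ltrBlDr ltrDl divr_gt0//.
have [N _ hN] : \forall N \near \oo, forall l, 1 - e / q%:R < \sum_(k < N) sqabs (h l k).
  exact: filter_forall.
exists N; have total : q%:R - e < \sum_(r < q) energy r N.
  have -> : \sum_(r < q) energy r N = \sum_(l < q) \sum_(k < q * N) sqabs (h l k).
    rewrite exchange_big; apply: eq_bigr => l _.
    by rewrite (sum_nat_mul _ _ (fun k => sqabs (h l k))).
  have -> : q%:R - e = \sum_(l < q) (1 - e / q%:R).
    by rewrite sumr_const card_ord -[RHS]mulr_natl mulrBr mulr1 mulrCA divff ?mulr1// gt_eqF.
  apply: ltr_sum => [|l _]; first by apply/hasP; exists (Ordinal rq) => //; rewrite mem_index_enum.
  by apply: hN; rewrite /= leq_pmull// (q_gt0 S).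
rewrite (bigD1 (Ordinal rq))//= in total.
have : \sum_(i < q | i != Ordinal rq) energy i N <= \sum_(i < q | i != Ordinal rq) 1.
  by apply: ler_sum => i _; exact: energy_le1.
rewrite sumr_const cardC1 card_ord => rest.
have : (q.-1)%:R = q%:R - 1 :> R by rewrite -subn1 natrB// (q_gt0 S).
by move: total rest; lra.
Qed.

Lemma scaled_in_span k :
  closed_span mu (fun ln : 'I_q * nat => packet ln.1 ln.2) (E k).
Proof.
apply: (closed_span_parseval on (LE k)) => e e0.
have kq : (k %% q < q)%N by rewrite ltn_mod (q_gt0 S).
have [N hN] := energy_gt kq e0.
exists (rows (k %/ q) N); first exact: rows_uniq.
rewrite sqnormE1; apply: lt_le_trans hN _; rewrite -(sum_rows (k %/ q) N kq).
by rewrite addnC mulnC -divn_eq.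
Qed.

End Orthonormal.

Lemma packet_closed_span l n : closed_span mu E (packet l n).
Proof.
exact: (translate_closed_span S hF Lphi phi_on (hm l) (Lpsi l) (psi_hat l)).
Qed.

End WaveletPackets.

Section Unitarity.
Context {R : realType} {K : topologicalFieldType}.
Context {p c q : nat} {t : K} {eps : 'I_c -> K}.

Lemma unitarymx_gram (m : 'I_q -> K -> R[i]) (x : K) :
  (\matrix_(l < q, k < q) m l (t * x + t * u p eps t k)) \is unitarymx <->
  forall l l', gram (p := p) (eps := eps) (t := t) m l l' x = (l == l')%:R.
Proof.
split=> [/unitarymxP/matrixP M1 l l'|M1].
  by have := M1 l l'; rewrite !mxE => <-; apply: eq_bigr => k _; rewrite !mxE.
apply/unitarymxP/matrixP => l l'; rewrite !mxE -M1.
by apply: eq_bigr => k _; rewrite !mxE.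
Qed.

End Unitarity.

Theorem lemma1
  (R : realType) (K : topologicalFieldType) (hK : is_local_field K)
  (p : nat) (hp : p \in [pchar K])
  (mu : {measure set (borel K) -> \bar R}) (hmu : is_haar mu)
  (abs : K -> R) (habs : is_modulus mu abs)
  (hD : mu (integers abs) = 1%E)
  (t : K) (ht : is_prime_element abs t)
  (c q : nat) (hc : (0 < c)%N) (hq : q = (p ^ c)%N)
  (hres : has_residue_field_GF abs q)
  (eps : 'I_c -> K) (heps : is_GF_basis abs p eps)
  (chi : K -> R[i]) (hchi : is_basic_character p eps t chi)
  (F : (K -> R[i]) -> (K -> R[i])) (hF : is_fourier_L2 mu chi F)
  (phi : K -> R[i]) (hphi : cLp mu 2%:E phi)
  (hphi_on : orthonormal_system mu (fun (k : nat) (x : K) => phi (x - u p eps t k)))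
  (V : set (K -> R[i]))
  (hV : V = closed_span mu (fun (k : nat) (x : K) =>
          (Num.sqrt q%:R)%:C * phi (t^-1 * x - u p eps t k)))
  (h : 'I_q -> nat -> R[i])
  (hh : forall l, cvgn (series (fun k => Normc.normc (h l k) ^+ 2)))
  (m : 'I_q -> K -> R[i])
  (hm : forall l, is_symbol mu chi (integers abs) (u p eps t) q (h l) (m l))
  (psi : 'I_q -> K -> R[i]) (hpsi : forall l, cLp mu 2%:E (psi l))
  (hpsi_hat : forall l,
     {ae mu, forall xi, F (psi l) xi = m l (t * xi) * F phi (t * xi)})
  (Psi : 'I_q * nat -> K -> R[i])
  (hPsi : Psi = fun lk x => psi lk.1 (x - u p eps t lk.2)) :
  (orthonormal_system_in mu V Psi <->
   {ae mu, forall xi, integers abs xi ->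
     (\matrix_(l < q, k < q) m l (t * xi + t * u p eps t k)) \is unitarymx})
  /\ (orthonormal_system mu Psi -> orthonormal_basis mu V Psi).
Proof.
have S : local_field_setting mu abs p q t eps chi by split.
have LPsi i : cLp mu 2%:E (Psi i) by rewrite hPsi; exact: (cLp2_translate S (hpsi i.1)).
have PsiV i : V (Psi i).
  rewrite hV hPsi; exact: (packet_closed_span S hF hphi hphi_on hm hpsi hpsi_hat).
have gramP := packet_orthonormal_gram S hF hphi hphi_on hm hpsi hpsi_hat.
split; last first.
  move=> on; split=> //; rewrite hV.
  apply: closed_span_sub => //; first by case: (scaled_orthonormal S hphi_on).
  by move=> k; rewrite hPsi in on *; exact: (scaled_in_span S hF hphi hphi_on hm hpsi hpsi_hat on).
have onP : orthonormal_system mu Psi <->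
    (forall l l' n n', inner mu (packet (p := p) (eps := eps) (t := t) psi l n)
       (packet (p := p) (eps := eps) (t := t) psi l' n') = ((l == l') && (n == n'))%:R).
  split=> [[_ on] l l' n n'|on].
    by have := on (l, n) (l', n'); rewrite hPsi.
  by split=> // -[l n] [l' n']; rewrite hPsi; exact: on.
split=> [[/onP/gramP on _]|ae_unitary].
  apply: aeS on => x G Dx; apply/unitarymx_gram => l l'; exact: G.
split=> //; apply/onP/gramP; apply: aeS ae_unitary => x M1 l l' Dx.
by move: l l'; exact/unitarymx_gram/M1.
Qed.
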